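(* Let $A$ be a non-positive DG-ring. Then the category $\operatorname{Inj}(A)$ is closed under arbitrary direct sums (in $\mathsf{D}(A)$) if and only if the ring $\mathrm{H}^0(A)$ is a left noetherian ring and for each $i < 0$, the left $\mathrm{H}^0(A)$-module $\mathrm{H}^i(A)$ is finitely generated.
   Context: Rings are associative and unital; modules and DG-modules are left (DG-)modules. A DG-ring is a $\mathbb{Z}$-graded ring $A=\bigoplus_n A^n$ with a $\mathbb{Z}$-linear differential $d$ of degree $+1$, $d\circ d=0$, satisfying $d(ab)=d(a)b+(-1)^i a\,d(b)$ for $a\in A^i$. It is non-positive if $A^i=0$ for all $i>0$; then $\mathrm{H}^0(A)$ is a ring. $\mathsf{D}(A)$ is the derived category of left DG-modules over $A$, and $\mathsf{D}^{\mathrm{b}}(A)$ is its full subcategory of DG-modules with bounded cohomology. Direct sums in $\mathsf{D}(A)$ are direct sums of DG-modules. For $N\in\mathsf{D}(A)$, $\inf(N)=\inf\{n\mid \mathrm{H}^n(N)\neq 0\}$, and $\operatorname{Ext}^i_A(N,M)=\mathrm{H}^i(\mathrm{R}\operatorname{Hom}_A(N,M))$. The injective dimension of $M\in\mathsf{D}(A)$ is $\operatorname{inj\,dim}_A(M)=\inf\{n\in\mathbb{Z}\mid \operatorname{Ext}^i_A(N,M)=0 \text{ for any } N\in\mathsf{D}^{\mathrm{b}}(A) \text{ and any } i>n-\inf(N)\}$. $\operatorname{Inj}(A)$ is the full subcategory of $\mathsf{D}(A)$ consisting of those $M$ such that either $M\cong 0$, or $\inf(M)=0$ and $\operatorname{inj\,dim}_A(M)=0$.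 *)

(* Defs.v *)
From HB Require Import structures.
From mathcomp Require Import all_boot all_order all_algebra.
From mathcomp Require Import boolp classical_sets functions cardinality.
From mathcomp Require Import constructive_ereal.

Set Implicit Arguments.
Unset Strict Implicit.
Unset Printing Implicit Defensive.

Import Order.TTheory GRing.Theory Num.Theory.
Local Open Scope ring_scope.
Local Open Scope quotient_scope.

Definition trivial_zmod (V : zmodType) : Prop := forall x : V, x = 0.

Definition finitely_generated (R : pzRingType) (M : lmodType R) : Prop :=
  exists k (g : 'I_k -> M), forall x, exists c : 'I_k -> R,
    x = \sum_(i < k) c i *: g i.

(* A left ideal of [R] is a submodule of the left module [R^o]. *)
Definition left_noetherian (R : pzRingType) : Prop :=
  forall I : nat -> {pred R^o},
    (forall n, GRing.submod_closed (I n)) ->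
    (forall n, {subset I n <= I n.+1}) ->
    exists m, forall n, (m <= n)%N -> I n =i I m.

(* The subquotient [Z / (Z :&: B)] of an abelian group. *)

Section Subquotient.
Variables (V : zmodType) (Z B : zmodClosed V).

Record subnum := SubNum { subnum_val : V; _ : subnum_val \in Z }.
HB.instance Definition _ := [isSub for subnum_val].
HB.instance Definition _ := [Choice of subnum by <:].
HB.instance Definition _ := [SubChoice_isSubZmodule of subnum by <:].

Definition subden : {pred subnum} := [pred x | val x \in B].

Fact subden_zmod_closed : zmod_closed subden.
Proof.
split=> [|x y xB yB]; first exact: (rpred0 B).
exact: (rpredB xB yB).
Qed.
HB.instance Definition _ := GRing.isZmodClosed.Build _ subden subden_zmod_closed.

Definition subquot := Quotient.quot subden.
HB.instance Definition _ := GRing.Zmodule.on subquot.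

Definition subclass x (xZ : x \in Z) : subquot := \pi_subquot (SubNum xZ).
Definition subrepr (c : subquot) : V := val (repr c).

Lemma subrepr_num c : subrepr c \in Z.
Proof. exact: valP. Qed.

Lemma subreprK c : subclass (subrepr_num c) = c.
Proof.
rewrite -[RHS]reprK /subclass; congr \pi_subquot; exact: val_inj.
Qed.

Lemma subclass_eqP x y (xZ : x \in Z) (yZ : y \in Z) :
  reflect (subclass xZ = subclass yZ) (x - y \in B).
Proof.
apply: (iffP idP) => [xyB|/eqmodP]; first by apply/eqmodP.
by [].
Qed.

Lemma subclassP c : exists x (xZ : x \in Z), c = subclass xZ.
Proof. by exists (subrepr c), (subrepr_num c); rewrite subreprK. Qed.

Lemma subclassD x y (xZ : x \in Z) (yZ : y \in Z) :
  subclass xZ + subclass yZ = subclass (rpredD xZ yZ).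
Proof.
have piD : {morph \pi_(Quotient.quot subden) : u v / u + v} by exact: raddfD.
rewrite /subclass -piD; congr \pi_subquot; exact: val_inj.
Qed.

End Subquotient.

(* A decomposition of [V] as the internal direct sum of the subgroups
   [V^n = homog G n]: [component G n] is the projection onto [V^n]. *)
Record grading (V : zmodType) := Grading {
  component : int -> {additive V -> V};
  componentK : forall m n x,
    component m (component n x) = if m == n then component n x else 0;
  component_sum : forall x, exists2 s : seq int,
    uniq s & x = \sum_(n <- s) component n x
}.

Definition homog (V : zmodType) (G : grading V) (n : int) : {pred V} :=
  [pred x | component G n x == x].

Fact homog_zmod_closed V (G : grading V) n : zmod_closed (homog G n).
Proof.
split=> [|x y]; rewrite !inE ?raddf0 //.
by move=> /eqP xn /eqP yn; rewrite raddfB xn yn.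
Qed.
HB.instance Definition _ V G n :=
  GRing.isZmodClosed.Build _ (@homog V G n) (homog_zmod_closed G n).

Record dgRing := DGRing {
  dgr_sort :> pzRingType;
  dgr_grading : grading dgr_sort;
  dgr_diff : {additive dgr_sort -> dgr_sort};
  dgr_homog1 : 1 \in homog dgr_grading 0;
  dgr_homogM : forall i j a b,
    a \in homog dgr_grading i -> b \in homog dgr_grading j ->
    a * b \in homog dgr_grading (i + j);
  dgr_diff_homog : forall i a,
    a \in homog dgr_grading i -> dgr_diff a \in homog dgr_grading (i + 1);
  dgr_diff_diff : forall a, dgr_diff (dgr_diff a) = 0;
  dgr_leibniz : forall i a b, a \in homog dgr_grading i ->
    dgr_diff (a * b) = dgr_diff a * b + (-1) ^+ `|i| * (a * dgr_diff b)
}.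

Definition nonpositive (A : dgRing) : Prop :=
  forall i : int, 0 < i -> forall a : A, a \in homog (dgr_grading A) i -> a = 0.

Record dgModule (A : dgRing) := DGModule {
  dgm_sort :> lmodType A;
  dgm_grading : grading dgm_sort;
  dgm_diff : {additive dgm_sort -> dgm_sort};
  dgm_homogZ : forall i j (a : A) x,
    a \in homog (dgr_grading A) i -> x \in homog dgm_grading j ->
    a *: x \in homog dgm_grading (i + j);
  dgm_diff_homog : forall i x,
    x \in homog dgm_grading i -> dgm_diff x \in homog dgm_grading (i + 1);
  dgm_diff_diff : forall x, dgm_diff (dgm_diff x) = 0;
  dgm_leibniz : forall i (a : A) x, a \in homog (dgr_grading A) i ->
    dgm_diff (a *: x) = dgr_diff A a *: x + (-1) ^+ `|i| *: (a *: dgm_diff x)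
}.

Definition dg_regular (A : dgRing) : dgModule A :=
  @DGModule A A^o (dgr_grading A) (dgr_diff A) (@dgr_homogM A)
    (@dgr_diff_homog A) (@dgr_diff_diff A) (@dgr_leibniz A).

Section ZeroModule.
Variable A : dgRing.
Let V : lmodType A := 'rV[A]_0.

Fact row0_eq (x y : V) : x = y.
Proof. by apply/rowP=> -[]. Qed.

Definition dg_zero_grading : grading V.
Proof.
exists (fun=> \0) => [m n x|x]; first exact: row0_eq.
by exists [::] => //; exact: row0_eq.
Defined.

Definition dg_zero : dgModule A.
Proof.
apply: (@DGModule A V dg_zero_grading \0).
- by move=> i j a x _ _; rewrite inE; apply/eqP/row0_eq.
- by move=> i x _; rewrite inE; apply/eqP/row0_eq.
- by move=> x; exact: row0_eq.
- by move=> i a x _; exact: row0_eq.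
Defined.
End ZeroModule.

Section Cohomology.
Variables (A : dgRing) (M : dgModule A) (n : int).

Definition cocycle : {pred M} :=
  [pred x | (x \in homog (dgm_grading M) n) && (dgm_diff M x == 0)].

Definition boundary : {pred M} :=
  [pred x | `[< exists2 y, y \in homog (dgm_grading M) (n - 1)
                         & x = dgm_diff M y >]].

Lemma cocycleP x : reflect
  (x \in homog (dgm_grading M) n /\ dgm_diff M x = 0) (x \in cocycle).
Proof. by apply: (iffP andP) => -[? /eqP]. Qed.

Lemma boundaryP x : reflect
  (exists2 y, y \in homog (dgm_grading M) (n - 1) & x = dgm_diff M y)
  (x \in boundary).
Proof. exact: asboolP. Qed.

Fact cocycle_zmod_closed : zmod_closed cocycle.
Proof.
split=> [|x y /cocycleP[xn dx] /cocycleP[yn dy]]; apply/cocycleP.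
  by rewrite rpred0 raddf0.
by rewrite rpredB // raddfB /= dx dy subrr.
Qed.
HB.instance Definition _ :=
  GRing.isZmodClosed.Build _ cocycle cocycle_zmod_closed.

Fact boundary_zmod_closed : zmod_closed boundary.
Proof.
split=> [|x y /boundaryP[x' x'n ->] /boundaryP[y' y'n ->]]; apply/boundaryP.
  by exists 0; rewrite ?rpred0 ?raddf0.
by exists (x' - y'); rewrite ?rpredB ?raddfB.
Qed.
HB.instance Definition _ :=
  GRing.isZmodClosed.Build _ boundary boundary_zmod_closed.

Definition cohomology := subquot cocycle boundary.
HB.instance Definition _ := GRing.Zmodule.on cohomology.

End Cohomology.
Arguments cocycle {A} M n.
Arguments boundary {A} M n.

Definition acyclic (A : dgRing) (M : dgModule A) : Prop :=
  forall n, trivial_zmod (cohomology M n).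

Definition cohomologically_bounded (A : dgRing) (M : dgModule A) : Prop :=
  exists a b : int, forall n, n < a \/ b < n -> trivial_zmod (cohomology M n).

Section Products.
Variables (A : dgRing) (M : dgModule A).
Implicit Types (i j : int) (a : A) (x : M).

Lemma cocycleZ i j a x : a \in cocycle (dg_regular A) i -> x \in cocycle M j ->
  a *: x \in cocycle M (i + j).
Proof.
move=> /cocycleP[ai da] /cocycleP[xj dx]; apply/cocycleP; split.
  exact: dgm_homogZ.
by rewrite (dgm_leibniz _ ai) dx [dgr_diff A a]da scale0r !scaler0 addr0.
Qed.

Lemma boundaryZr i j a x : a \in cocycle (dg_regular A) i ->
  x \in boundary M j -> a *: x \in boundary M (i + j).
Proof.
move=> /cocycleP[ai da] /boundaryP[y yj ->]; apply/boundaryP.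
have day : dgm_diff M (a *: y) = (-1) ^+ `|i| *: (a *: dgm_diff M y).
  by rewrite (dgm_leibniz _ ai) [dgr_diff A a]da scale0r add0r.
exists ((-1) ^+ `|i| *: (a *: y)).
  by rewrite rpredZsign -addrA dgm_homogZ.
by rewrite raddfZsign /= day scalerA -expr2 sqrr_sign scale1r.
Qed.

Lemma boundaryZl i j a x : a \in boundary (dg_regular A) i ->
  x \in cocycle M j -> a *: x \in boundary M (i + j).
Proof.
move=> /boundaryP[b bi ->] /cocycleP[xj dx]; apply/boundaryP.
exists ((b : A) *: x); first by rewrite addrAC; exact: dgm_homogZ.
by rewrite (dgm_leibniz _ bi) dx !scaler0 addr0.
Qed.

Lemma cocycleZ0 n a x : a \in cocycle (dg_regular A) 0 ->
  x \in cocycle M n -> a *: x \in cocycle M n.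
Proof. by move=> aZ xZ; rewrite -[n]add0r cocycleZ. Qed.

End Products.

Definition H0 (A : dgRing) := cohomology (dg_regular A) 0.
HB.instance Definition _ (A : dgRing) := GRing.Zmodule.on (H0 A).

Lemma cohomologyP (A : dgRing) (M : dgModule A) n (c : cohomology M n) :
  exists (x : M) (xZ : x \in cocycle M n), c = subclass _ xZ.
Proof. by have [x [xZ ->]] := subclassP c; exists x, xZ. Qed.

Lemma H0P (A : dgRing) (c : H0 A) :
  exists (a : A) (aZ : a \in cocycle (dg_regular A) 0), c = subclass _ aZ.
Proof. by have [x [xZ ->]] := subclassP c; exists x, xZ. Qed.

Section H0Action.
Variables (A : dgRing) (M : dgModule A) (n : int).
Implicit Types (a b : H0 A) (x y : cohomology M n).

Fact H0_act_proof a x : (subrepr a : A) *: (subrepr x : M) \in cocycle M n.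
Proof. by apply: cocycleZ0; exact: subrepr_num. Qed.

Definition H0_act a x : cohomology M n := subclass _ (H0_act_proof a x).

Lemma H0_actE (a : A) (x : M) (aZ : a \in cocycle (dg_regular A) 0)
    (xZ : x \in cocycle M n) (axZ : a *: x \in cocycle M n) :
  H0_act (subclass _ aZ) (subclass _ xZ) = subclass _ axZ.
Proof.
apply/subclass_eqP; set a' : A := subrepr _; set x' : M := subrepr _.
have a'Z : a' \in cocycle (dg_regular A) 0 by exact: subrepr_num.
have x'Z : x' \in cocycle M n by exact: subrepr_num.
have a'a : a' - a \in boundary (dg_regular A) 0.
  by apply/(subclass_eqP _ (subrepr_num _) aZ); exact: subreprK.
have x'x : x' - x \in boundary M n.
  by apply/(subclass_eqP _ (subrepr_num _) xZ); exact: subreprK.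
have -> : a' *: x' - a *: x = (a' - a) *: x' + a *: (x' - x).
  by rewrite scalerBl scalerBr addrA subrK.
by rewrite -[n]add0r rpredD ?(boundaryZl a'a) ?boundaryZr ?add0r.
Qed.

End H0Action.

Section H0Ring.
Variable A : dgRing.

Fact cocycle1 : 1 \in cocycle (dg_regular A) 0.
Proof.
apply/cocycleP; split; first exact: dgr_homog1.
have := dgr_leibniz 1 (dgr_homog1 A); rewrite !mulr1 mul1r expr0 mul1r.
by move/eqP; rewrite -[X in X == _]addr0 (inj_eq (addrI _)) eq_sym => /eqP.
Qed.

Definition H0_one : H0 A := subclass _ cocycle1.

Variables (M : dgModule A) (n : int).
Implicit Types (a b : H0 A) (x y : cohomology M n).

Fact H0_act1 x : H0_act H0_one x = x.
Proof.
have [y [yZ ->]] := cohomologyP x.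
have y1Z : (1 : A) *: y \in cocycle M n by rewrite scale1r.
by rewrite (H0_actE _ _ y1Z); apply/subclass_eqP; rewrite scale1r subrr rpred0.
Qed.

Fact H0_actA a b x : H0_act a (H0_act b x) = H0_act (H0_act a b) x.
Proof.
have [[a' [aZ ->]] [b' [bZ ->]]] := (H0P a, H0P b).
have [x' [xZ ->]] := cohomologyP x.
have bx : b' *: x' \in cocycle M n by exact: cocycleZ0.
have ab : a' *: (b' : A^o) \in cocycle (dg_regular A) 0.
  exact: (@cocycleZ0 _ (dg_regular A)).
have abx : a' *: (b' *: x') \in cocycle M n by exact: cocycleZ0.
have abx' : (a' * b') *: x' \in cocycle M n by rewrite -scalerA.
rewrite (H0_actE _ _ bx) (H0_actE _ _ abx) (H0_actE _ _ ab) (H0_actE _ _ abx').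
by apply/subclass_eqP; rewrite scalerA subrr rpred0.
Qed.

Fact H0_actDr a : {morph @H0_act A M n a : x y / x + y}.
Proof.
move=> x y; have [a' [aZ ->]] := H0P a.
have [[x' [xZ ->]] [y' [yZ ->]]] := (cohomologyP x, cohomologyP y).
have ax : a' *: x' \in cocycle M n by exact: cocycleZ0.
have ay : a' *: y' \in cocycle M n by exact: cocycleZ0.
have axy : a' *: (x' + y') \in cocycle M n by rewrite scalerDr rpredD.
rewrite subclassD !(H0_actE _ _ axy) (H0_actE _ _ ax) (H0_actE _ _ ay) subclassD.
by apply/subclass_eqP; rewrite scalerDr subrr rpred0.
Qed.

Fact H0_actDl x : {morph (@H0_act A M n)^~ x : a b / a + b}.
Proof.
move=> a b; have [x' [xZ ->]] := cohomologyP x.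
have [[a' [aZ ->]] [b' [bZ ->]]] := (H0P a, H0P b).
have ax : a' *: x' \in cocycle M n by exact: cocycleZ0.
have bx : b' *: x' \in cocycle M n by exact: cocycleZ0.
have abx : ((a' : A) + b') *: x' \in cocycle M n by rewrite scalerDl rpredD.
rewrite subclassD !(H0_actE _ _ abx) (H0_actE _ _ ax) (H0_actE _ _ bx) subclassD.
by apply/subclass_eqP; rewrite scalerDl subrr rpred0.
Qed.

End H0Ring.

Section H0Instances.
Variable A : dgRing.

Fact H0_mulr1 : right_id (H0_one A) (@H0_act A (dg_regular A) 0).
Proof.
move=> a; have [a' [aZ ->]] := H0P a.
have a1 : a' *: (1 : A^o) \in cocycle (dg_regular A) 0 by rewrite [_ *: _]mulr1.
rewrite (H0_actE _ _ a1).
by apply/subclass_eqP; rewrite [_ *: _]mulr1 subrr rpred0.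
Qed.

HB.instance Definition _ := GRing.Zmodule_isPzRing.Build (H0 A)
  (@H0_actA A (dg_regular A) 0) (@H0_act1 A (dg_regular A) 0) H0_mulr1
  (fun a b x => @H0_actDl A (dg_regular A) 0 x a b)
  (@H0_actDr A (dg_regular A) 0).

Variables (M : dgModule A) (n : int).
HB.instance Definition _ := GRing.Zmodule_isLmodule.Build (H0 A) (cohomology M n)
  (@H0_actA A M n) (@H0_act1 A M n) (@H0_actDr A M n) (@H0_actDl A M n).

End H0Instances.

Record dgHom (A : dgRing) (N M : dgModule A) := DGHom {
  dgh_fun :> {linear N -> M};
  dgh_homog : forall i x, x \in homog (dgm_grading N) i ->
    dgh_fun x \in homog (dgm_grading M) i;
  dgh_diff : forall x, dgh_fun (dgm_diff N x) = dgm_diff M (dgh_fun x)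
}.

Section CohomologyMap.
Variables (A : dgRing) (N M : dgModule A) (f : dgHom N M) (n : int).

Fact cohomology_map_proof (c : cohomology N n) :
  f (subrepr c) \in cocycle M n.
Proof.
have /cocycleP[cn dc] : subrepr c \in cocycle N n by exact: subrepr_num.
by apply/cocycleP; rewrite dgh_homog // -dgh_diff dc raddf0.
Qed.

Definition cohomology_map (c : cohomology N n) : cohomology M n :=
  subclass _ (cohomology_map_proof c).

End CohomologyMap.

Definition quasi_iso (A : dgRing) (N M : dgModule A) (f : dgHom N M) : Prop :=
  forall n, bijective (cohomology_map f (n := n)).

(* Isomorphism in [D(A)], the localization at the quasi-isomorphisms: every
   isomorphism is represented by a roof of quasi-isomorphisms. *)
Definition derived_iso (A : dgRing) (N M : dgModule A) : Prop :=
  exists (P : dgModule A) (s : dgHom P N) (t : dgHom P M),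
    quasi_iso s /\ quasi_iso t.

(* The complex [Hom_A(N, M)]: in degree [n] it consists of the graded maps of
    degree [n] that are [A]-linear up to the Koszul sign. *)

Section HomComplex.
Variables (A : dgRing) (N M : dgModule A).

Record hom_degree (n : int) (f : N -> M) : Prop := HomDegree {
  hom_degreeB : zmod_morphism f;
  hom_degree_homog : forall i x, x \in homog (dgm_grading N) i ->
    f x \in homog (dgm_grading M) (n + i);
  hom_degreeZ : forall i (a : A) x, a \in homog (dgr_grading A) i ->
    f (a *: x) = (-1) ^+ (`|n| * `|i|) *: (a *: f x)
}.

Definition hom_diff (n : int) (f : N -> M) : N -> M :=
  fun x => dgm_diff M (f x) - (-1) ^+ `|n| *: f (dgm_diff N x).

Definition hom_cocycle n : {pred N -> M} :=
  [pred f | `[< hom_degree n f /\ hom_diff n f = 0 >]].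

Definition hom_boundary n : {pred N -> M} :=
  [pred f | `[< exists2 g, hom_degree (n - 1) g & f = hom_diff (n - 1) g >]].

Lemma hom_degree0 n : hom_degree n 0.
Proof.
split=> [x y|i x _|i a x _]; first by rewrite subr0.
- exact: (rpred0 (homog _ _)).
- by rewrite !scaler0.
Qed.

Lemma hom_degree_sub n f g :
  hom_degree n f -> hom_degree n g -> hom_degree n (f - g).
Proof.
move=> [fB fn fZ] [gB gn gZ]; split=> [x y|i x xi|i a x ai].
- rewrite !fctE fB gB !opprB addrACA [RHS]addrACA; congr (_ + _).
  exact: addrC.
- by rewrite !fctE; apply: rpredB; [exact: fn | exact: gn].
- by rewrite !fctE (fZ _ _ _ ai) (gZ _ _ _ ai) !scalerBr.
Qed.

Lemma hom_diffB n f g : hom_diff n (f - g) = hom_diff n f - hom_diff n g.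
Proof.
apply/funext=> x; rewrite /hom_diff !fctE raddfB scalerBr /=.
rewrite !opprB addrACA [RHS]addrACA; congr (_ + _); exact: addrC.
Qed.

Lemma hom_diff0 n : hom_diff n 0 = 0.
Proof. by rewrite -[X in hom_diff n X](subrr 0) hom_diffB subrr. Qed.

Fact hom_cocycle_zmod_closed n : zmod_closed (hom_cocycle n).
Proof.
split=> [|f g /asboolP[fn df] /asboolP[gn dg]]; apply/asboolP.
  by split; [exact: hom_degree0 | exact: hom_diff0].
by split; [exact: hom_degree_sub | rewrite hom_diffB df dg subrr].
Qed.
HB.instance Definition _ n :=
  GRing.isZmodClosed.Build _ (hom_cocycle n) (hom_cocycle_zmod_closed n).

Fact hom_boundary_zmod_closed n : zmod_closed (hom_boundary n).
Proof.
split=> [|f g /asboolP[f' f'n ->] /asboolP[g' g'n ->]]; apply/asboolP.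
  by exists 0; [exact: hom_degree0 | rewrite hom_diff0].
by exists (f' - g'); [exact: hom_degree_sub | rewrite hom_diffB].
Qed.
HB.instance Definition _ n :=
  GRing.isZmodClosed.Build _ (hom_boundary n) (hom_boundary_zmod_closed n).

Definition hom_cohomology n : zmodType :=
  subquot (hom_cocycle n) (hom_boundary n).

End HomComplex.

Definition K_projective (A : dgRing) (P : dgModule A) : Prop :=
  forall C : dgModule A, acyclic C -> forall n, trivial_zmod (hom_cohomology P C n).

Record K_projective_resolution (A : dgRing) (N : dgModule A) := KProjRes {
  kpr_obj :> dgModule A;
  kpr_map : dgHom kpr_obj N;
  kpr_K_projective : K_projective kpr_obj;
  kpr_quasi_iso : quasi_iso kpr_map
}.

(* [RHom_A(N, M)] is computed by [Hom_A(P, M)] for any K-projective resolution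
   [P] of [N]; up to isomorphism, [Ext] does not depend on [P]. *)
Definition Ext (A : dgRing) (N : dgModule A) (P : K_projective_resolution N)
  (M : dgModule A) (i : int) : zmodType := hom_cohomology P M i.

Definition Ext_vanishes (A : dgRing) (N M : dgModule A) (i : int) : Prop :=
  exists P : K_projective_resolution N, trivial_zmod (Ext P M i).

(* The infimum in [\bar int]: [+oo] for the empty set, [-oo] for a set that is
   not bounded below. *)
Definition int_inf (S : set int) : \bar int :=
  infimum +oo%E (@EFin int @` S)%classic.

Definition dg_inf (A : dgRing) (N : dgModule A) : \bar int :=
  int_inf [set n : int | ~ trivial_zmod (cohomology N n)]%classic.

Definition inj_dim (A : dgRing) (M : dgModule A) : \bar int :=
  int_inf [set n : int | forall N : dgModule A, cohomologically_bounded N ->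
    forall i : int, (n%:E - dg_inf N < i%:E)%E -> Ext_vanishes N M i]%classic.

Definition Inj (A : dgRing) (M : dgModule A) : Prop :=
  derived_iso M (dg_zero A) \/ (dg_inf M = 0%:E /\ inj_dim M = 0%:E).

Section DirectSum.
Variables (A : dgRing) (X : Type) (M : X -> dgModule A).
Local Open Scope classical_set_scope.

Record dsum := DSum {
  dsum_fun :> forall x, M x;
  dsum_finite : finite_set [set x | dsum_fun x <> 0]
}.
HB.instance Definition _ := gen_eqMixin dsum.
HB.instance Definition _ := gen_choiceMixin dsum.

Lemma dsum_eqP (f g : dsum) : (forall x, f x = g x) -> f = g.
Proof.
case: f g => [f ff] [g gf] /= fg; have {}fg : f = g by apply/functional_extensionality_dep.
by case: _ / fg in gf *; congr DSum; exact: Prop_irrelevance.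
Qed.

Fact dsum0_finite : finite_set [set x | (0 : M x) <> 0].
Proof. by apply: sub_finite_set (finite_set0 X) => x /=. Qed.
Definition dsum0 := DSum dsum0_finite.

Fact dsum_map_finite (h : forall x, M x -> M x) (f : dsum) :
  (forall x, h x 0 = 0) -> finite_set [set x | h x (f x) <> 0].
Proof.
by move=> h0; apply: sub_finite_set (dsum_finite f) => x /= hf fx0; rewrite fx0 in hf.
Qed.
Definition dsum_map h h0 f := DSum (@dsum_map_finite h f h0).

Fact dsumD_finite (f g : dsum) : finite_set [set x | f x + g x <> 0].
Proof.
have fin : finite_set ([set x | f x <> 0] `|` [set x | g x <> 0]).
  by rewrite finite_setU; split; exact: dsum_finite.
apply: sub_finite_set fin => x /= fg.
by have [fx0|?] := pselect (f x = 0); [right|left] => // gx0; rewrite fx0 gx0 addr0 in fg.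
Qed.
Definition dsumD f g := DSum (dsumD_finite f g).

Definition dsumN := dsum_map (h := fun=> -%R) (fun=> oppr0 _).

Fact dsumDA : associative dsumD.
Proof. by move=> f g h; apply: dsum_eqP => x; rewrite /= addrA. Qed.
Fact dsumDC : commutative dsumD.
Proof. by move=> f g; apply: dsum_eqP => x; rewrite /= addrC. Qed.
Fact dsum0D : left_id dsum0 dsumD.
Proof. by move=> f; apply: dsum_eqP => x; rewrite /= add0r. Qed.
Fact dsumND : left_inverse dsum0 dsumN dsumD.
Proof. by move=> f; apply: dsum_eqP => x; rewrite /= addNr. Qed.
HB.instance Definition _ :=
  GRing.isZmodule.Build dsum dsumDA dsumDC dsum0D dsumND.

Definition dsumZ (a : A) := dsum_map (h := fun=> *:%R a) (fun=> scaler0 _ a).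

Fact dsumZA a b f : dsumZ a (dsumZ b f) = dsumZ (a * b) f.
Proof. by apply: dsum_eqP => x; rewrite /= scalerA. Qed.
Fact dsum1Z : left_id 1 dsumZ.
Proof. by move=> f; apply: dsum_eqP => x; rewrite /= scale1r. Qed.
Fact dsumZDr : right_distributive dsumZ +%R.
Proof. by move=> a f g; apply: dsum_eqP => x; rewrite /= scalerDr. Qed.
Fact dsumZDl f : {morph dsumZ^~ f : a b / a + b}.
Proof. by move=> a b; apply: dsum_eqP => x; rewrite /= scalerDl. Qed.
HB.instance Definition _ :=
  GRing.Zmodule_isLmodule.Build A dsum dsumZA dsum1Z dsumZDr dsumZDl.

Lemma dsum_sumE (I : Type) (s : seq I) (F : I -> dsum) x :
  (\sum_(i <- s) F i) x = \sum_(i <- s) F i x.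
Proof. exact: (big_morph (fun f : dsum => f x)). Qed.

Section DsumAdditive.
Variable h : forall x, {additive M x -> M x}.
Definition dsum_additive := dsum_map (h := fun x => h x) (fun x => raddf0 (h x)).
Fact dsum_additive_zmod_morphism : zmod_morphism dsum_additive.
Proof. by move=> f g; apply: dsum_eqP => x; rewrite /= raddfB. Qed.
HB.instance Definition _ := GRing.isZmodMorphism.Build dsum dsum
  dsum_additive dsum_additive_zmod_morphism.
End DsumAdditive.

Definition dsum_component n : {additive dsum -> dsum} :=
  dsum_additive (fun x => component (dgm_grading (M x)) n).

Fact dsum_componentK m n f : dsum_component m (dsum_component n f) =
  if m == n then dsum_component n f else 0.
Proof. by apply: dsum_eqP => x; rewrite /= componentK; case: eqP. Qed.

Fact dsum_component_sum f : exists2 s : seq int,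
  uniq s & f = \sum_(n <- s) dsum_component n f.
Proof.
have [s sE] := (@finite_seqP {classic X} _).1 (dsum_finite f).
have [t tP] := choice (fun x => let: ex_intro2 t tu ft :=
  component_sum (dgm_grading (M x)) (f x) in
  ex_intro (fun t => uniq t /\
    f x = \sum_(n <- t) component (dgm_grading (M x)) n (f x)) t (conj tu ft)).
exists (undup (flatten [seq t x | x <- s])); first exact: undup_uniq.
apply: dsum_eqP => x; rewrite dsum_sumE /=.
have [fx0|fx0] := pselect (f x = 0).
  by rewrite fx0 big1 // => n _; rewrite raddf0.
have xs : (x : {classic X}) \in s by move: fx0; rewrite -[_ <> _]/([set x | f x <> 0] x) sE.
have [tu ft] := tP x; rewrite [LHS]ft [RHS](bigID [in t x]) /= [X in _ + X]big1 ?addr0.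
  rewrite -[RHS]big_filter; apply: perm_big; apply: uniq_perm => //.
    by rewrite filter_uniq ?undup_uniq.
  move=> n; rewrite mem_filter mem_undup; case: (boolP (n \in t x)) => //= nt.
  by apply/esym/flattenP; exists (t x) => //; exact: (@map_f {classic X} _ t s x xs).
move=> n nt; rewrite ft raddf_sum big_seq big1 // => m mt.
by rewrite componentK; case: eqP nt => // ->; rewrite mt.
Qed.

Definition dsum_grading : grading dsum :=
  Grading dsum_componentK dsum_component_sum.

Lemma dsum_homogP n (f : dsum) : reflect
  (forall x, f x \in homog (dgm_grading (M x)) n) (f \in homog dsum_grading n).
Proof.
apply: (iffP eqP) => [fn x|fn]; first by apply/eqP; rewrite -[in RHS]fn.
by apply: dsum_eqP => x; apply/eqP/fn.
Qed.

Definition dsum_diff : {additive dsum -> dsum} :=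
  dsum_additive (fun x => dgm_diff (M x)).

Definition dg_dsum : dgModule A.
Proof.
apply: (@DGModule A dsum dsum_grading dsum_diff).
- move=> i j a f ai /dsum_homogP fj; apply/dsum_homogP => x.
  exact: (dgm_homogZ ai (fj x)).
- move=> i f /dsum_homogP fi; apply/dsum_homogP => x; exact: (dgm_diff_homog (fi x)).
- by move=> f; apply: dsum_eqP => x; exact: dgm_diff_diff.
- move=> i a f ai; apply: dsum_eqP => x; by rewrite /= (dgm_leibniz _ ai).
Defined.

End DirectSum.

(* Main.v *)
(* A DG-module M belongs to Inj(A) if and only if it satisfies a Baer-type criterion
   (injectivity_criterion): derived maps to M defined on a DG-left ideal A^{<j} + W,
   with W in Z^j(A), extend to A. For M in Inj(A) this is the vanishing of Ext between
   the bounded DG-module A / (A^{<j} + W) and M. Conversely, for a semi-free P and a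
   cocycle f of Hom(P, M) sending cocycles of P to boundaries, a null-homotopy of f is
   built one cell at a time by Zorn's lemma, the criterion being precisely the condition
   under which the homotopy extends over the next cell; taking for M an acyclic module,
   the same argument shows that semi-free modules are K-projective.

   If H^0(A) is left noetherian and the H^i(A) are finitely generated, W is finitely
   generated modulo boundaries, so an extension problem into a direct sum involves only
   finitely many summands, and the criterion passes to direct sums. Conversely, the
   graded character dual Hom_Z(A, Q/Z) satisfies the criterion; if a countable direct sum
   of copies of it does, then Bass' argument gives the ascending chain condition on
   every H^j(A). *)
From HB Require Import structures.
From mathcomp Require Import all_boot all_order all_algebra.
From mathcomp Require Import boolp classical_sets functions cardinality.
From mathcomp Require Import constructive_ereal zify.
Require Import Defs.
Import Order.TTheory GRing.Theory Num.Theory.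
Local Open Scope ring_scope.

Set Implicit Arguments.
Unset Strict Implicit.
Unset Printing Implicit Defensive.

(** The criterion is stated on cochains because a derived map out of [A^{<j} + W] need not be a map
    of DG-modules; it is recorded by [c] and by an additive relation that is single-valued only
    modulo boundaries. The hypothesis that pairs over 0 are boundaries makes the test module, which
    stands for the quotient of [A] by the ideal, cohomologically zero below degree [j]. Injective
    dimension 0 then kills Ext in degrees above [-j], and [1 - j] is the first of these: this is the
    origin of the constants. In the construction of a homotopy the obstacle is that a careless value
    on one cell may block a later cell; the clause of the criterion about [x + w *: m] rules this
    out. The character dual vanishes in negative degrees, so its boundaries of degree 0 are zero and
    conditions modulo boundaries become equations. *)

Lemma odd_absD (i j : int) : odd `|i + j| = odd `|i| (+) odd `|j|.
Proof. lia. Qed.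

Lemma odd_absN (i : int) : odd `|- i| = odd `|i|.
Proof. by rewrite abszN. Qed.

Ltac parity := rewrite ?(oddD, oddM, oddS, odd_absD, odd_absN) /=;
  repeat match goal with |- context [odd ?n] => case: (odd n) end.

Lemma sign_odd (R : pzRingType) m n : odd m = odd n -> (-1) ^+ m = (-1) ^+ n :> R.
Proof. by move=> mn; rewrite -(signr_odd R m) mn signr_odd. Qed.

Lemma sign_oddN (R : pzRingType) m n :
  odd m = ~~ odd n -> (-1) ^+ m = - (-1) ^+ n :> R.
Proof. by move=> mn; rewrite -[RHS]mulN1r -exprS; apply: sign_odd; rewrite oddS. Qed.

Lemma scaler_signC (R : pzRingType) (V : lmodType R) (a : R) n (x : V) :
  a *: ((-1) ^+ n *: x) = (-1) ^+ n *: (a *: x).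
Proof. by rewrite !scalerA commr_sign. Qed.

Lemma scale_signK (R : pzRingType) (V : lmodType R) n (x : V) :
  (-1) ^+ n *: ((-1) ^+ n *: x) = x.
Proof. by rewrite scalerA -expr2 sqrr_sign scale1r. Qed.

Lemma subrACA (V : zmodType) (a b c d : V) : a - b - (c - d) = a - c - (b - d).
Proof. by rewrite !opprB addrACA [RHS]addrACA; congr (_ + _); exact: addrC. Qed.

(** * Subquotients and gradings through representatives *)

Section Subquotients.
Variables (V : zmodType) (Z B : zmodClosed V).

Lemma subclass0 (Z0 : 0 \in Z) : subclass B Z0 = 0.
Proof.
apply: (addIr (subclass B Z0)); rewrite add0r subclassD.
by apply/subclass_eqP; rewrite addr0 subrr rpred0.
Qed.

Lemma subclass_eq0 x (xZ : x \in Z) : (subclass B xZ = 0) <-> x \in B.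
Proof.
rewrite -(subclass0 (rpred0 Z)); split.
  by move/subclass_eqP; rewrite subr0.
by move=> xB; apply/subclass_eqP; rewrite subr0.
Qed.

Lemma trivial_subquotP : trivial_zmod (subquot Z B) <-> {subset Z <= B}.
Proof.
split=> [t x xZ|ZB c]; first exact/(subclass_eq0 xZ)/t.
by have [x [xZ ->]] := subclassP c; apply/subclass_eq0/ZB.
Qed.

End Subquotients.

Section Grading.
Variables (V : zmodType) (G : grading V).
Implicit Types (x y : V) (m n : int).

Lemma homogP n x : reflect (component G n x = x) (x \in homog G n).
Proof. exact: eqP. Qed.

Lemma component_homog n x : component G n x \in homog G n.
Proof. by apply/homogP; rewrite componentK eqxx. Qed.

Lemma component_homogE m n x :
  x \in homog G n -> component G m x = if m == n then x else 0.
Proof. by move=> /homogP <-; rewrite componentK. Qed.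

Lemma homog_ind (P : V -> Prop) : P 0 -> (forall x y, P x -> P y -> P (x + y)) ->
  (forall n x, x \in homog G n -> P x) -> forall x, P x.
Proof.
move=> P0 PD Ph x; have [s _ ->] := component_sum G x.
by apply: big_ind => // n _; apply: Ph (component_homog n x).
Qed.

Lemma component_inj x y : (forall n, component G n x = component G n y) -> x = y.
Proof.
move=> xy; apply/subr0_eq; have [s _ ->] := component_sum G (x - y).
by rewrite big1 // => n _; rewrite raddfB /= xy subrr.
Qed.

Lemma component_out (s : seq int) x n : x = \sum_(m <- s) component G m x ->
  n \notin s -> component G n x = 0.
Proof.
move=> -> ns; rewrite raddf_sum big_seq big1 // => m ms.
by rewrite componentK; case: eqP ns => // ->; rewrite ms.
Qed.

(** The list [t] may exceed the support, so gradings offset by different [k] can share one list, as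
    the cone requires. *)
Lemma component_sum_sub (k : int) (t : seq int) x : uniq t ->
  (forall n, component G (n + k) x != 0 -> n \in t) ->
  x = \sum_(n <- t) component G (n + k) x.
Proof.
move=> ut xt; apply: component_inj => m; rewrite raddf_sum /=.
under eq_bigr do rewrite componentK.
have [mt|mt] := boolP (m - k \in t).
  rewrite (bigD1_seq (m - k)) //= subrK eqxx big1 ?addr0 // => n nm.
  by case: eqP => // mn; case/eqP: nm; rewrite mn addrK.
have -> : component G m x = 0.
  by apply/eqP; apply: contraNT mt => mx; apply: xt; rewrite subrK.
rewrite big_seq big1 // => n nt; case: eqP => // mn.
by rewrite mn addrK nt in mt.
Qed.

Lemma grading_bound x : exists t : seq int, forall n, component G n x != 0 -> n \in t.
Proof.
have [s us xs] := component_sum G x; exists s => n; apply: contraNT => ns.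
by rewrite (component_out xs ns).
Qed.

Lemma homog_cast m n x : x \in homog G m -> m = n -> x \in homog G n.
Proof. by move=> + <-. Qed.
End Grading.

Lemma component_additive (V W : zmodType) (G : grading V) (H : grading W)
    (k : int) (f : {additive V -> W}) :
  (forall n x, x \in homog G n -> f x \in homog H (n + k)) ->
  forall n x, component H n (f x) = f (component G (n - k) x).
Proof.
move=> fk n; apply: (@homog_ind _ G) => [|x y fx fy|m x xm].
- by rewrite !raddf0.
- by rewrite !raddfD fx fy.
rewrite (component_homogE _ (fk _ _ xm)) (component_homogE _ xm).
have -> : (n == m + k) = (n - k == m) by apply/eqP/eqP; lia.
by case: ifP => //; rewrite raddf0.
Qed.


(** * Koszul signs for inhomogeneous elements *)

Section Twist.
Variable A : dgRing.
Implicit Types (a b : A) (i j : int) (p q : nat).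
Local Notation AA := (homog (dgr_grading A)).
Local Notation cp := (component (dgr_grading A)).

Definition grading_support a : seq int := sval (cid2 (component_sum (dgr_grading A) a)).

(** The Koszul sign for moving an element of degree [p] past [a], extended additively to
    inhomogeneous [a]. It is multiplicative in [a] and depends only on the parity of [p], which
    spares most sign computations a decomposition of [a]. *)
Definition twist p a : A := \sum_(n <- grading_support a) (-1) ^+ (p * `|n|) * cp n a.

Lemma component_twist p n a : cp n (twist p a) = (-1) ^+ (p * `|n|) * cp n a.
Proof.
rewrite /twist /grading_support; case: cid2 => s /= us as_.
rewrite raddf_sum /=.
have [ns|ns] := boolP (n \in s).
  rewrite (bigD1_seq n) //= big1 ?addr0 => [|m mn].
    by rewrite raddfMsign /= componentK eqxx.
  by rewrite raddfMsign /= componentK eq_sym (negPf mn) mulr0.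
rewrite (component_out as_ ns) mulr0 big_seq big1 // => m ms.
by rewrite raddfMsign /= componentK; case: eqP ns => [->|_ _]; rewrite ?ms ?mulr0.
Qed.

Fact twist_zmod_morphism p : zmod_morphism (twist p).
Proof.
move=> a b; apply: (@component_inj _ (dgr_grading A)) => n.
by rewrite raddfB /= !component_twist raddfB mulrBr.
Qed.
HB.instance Definition _ p := GRing.isZmodMorphism.Build A A (twist p) (twist_zmod_morphism p).

Lemma twistE p i a : a \in AA i -> twist p a = (-1) ^+ (p * `|i|) * a.
Proof.
move=> ai; apply: (@component_inj _ (dgr_grading A)) => n.
rewrite component_twist raddfMsign /= (component_homogE n ai).
by case: eqP => [->|]; rewrite ?mulr0.
Qed.

Lemma twist_homog p i a : a \in AA i -> twist p a \in AA i.
Proof. by move=> ai; rewrite (twistE _ ai) rpredMsign. Qed.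

Lemma twistM p : {morph twist p : a b / a * b}.
Proof.
move=> a b; move: a b; apply: (@homog_ind _ (dgr_grading A)) => [b|a a' aP a'P b|i a ai].
- by rewrite raddf0 mul0r mul0r raddf0.
- by rewrite raddfD !mulrDl raddfD /= aP a'P.
apply: (@homog_ind _ (dgr_grading A)) => [|b b' bP b'P|j b bj].
- by rewrite raddf0 !mulr0 raddf0.
- by rewrite raddfD !mulrDr raddfD /= bP b'P.
rewrite (twistE _ ai) (twistE _ bj) (twistE _ (dgr_homogM ai bj)).
rewrite -mulrA [a * (_ * b)]mulrA commr_sign -mulrA mulrA -exprD.
by congr (_ * _); apply: sign_odd; nia.
Qed.

Lemma twist1 p : twist p 1 = 1.
Proof. by rewrite (twistE _ (dgr_homog1 A)) muln0 mul1r. Qed.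

Lemma twist_twist p q a : twist p (twist q a) = twist (p + q) a.
Proof.
move: a; apply: (@homog_ind _ (dgr_grading A)) => [|a b aP bP|i a ai].
- by rewrite !raddf0.
- by rewrite !raddfD /= aP bP.
by rewrite (twistE p (twist_homog _ ai)) !(twistE _ ai) mulrA -exprD mulnDl.
Qed.

Lemma twist_odd p q : odd p = odd q -> twist p =1 twist q.
Proof.
move=> pq; apply: (@homog_ind _ (dgr_grading A)) => [|a b aP bP|i a ai].
- by rewrite !raddf0.
- by rewrite !raddfD /= aP bP.
by rewrite !(twistE _ ai); congr (_ * _); apply: sign_odd; rewrite !oddM pq.
Qed.

Lemma twist0 a : twist 0 a = a.
Proof.
move: a; apply: (@homog_ind _ (dgr_grading A)) => [|a b aP bP|i a ai].
- by rewrite !raddf0.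
- by rewrite !raddfD /= aP bP.
by rewrite (twistE _ ai) mul0n mul1r.
Qed.

Lemma twist1K a : twist 1 (twist 1 a) = a.
Proof. by rewrite twist_twist -[RHS]twist0; apply: twist_odd. Qed.

Lemma twist_diff p a : twist p (dgr_diff A a) = (-1) ^+ p * dgr_diff A (twist p a).
Proof.
move: a; apply: (@homog_ind _ (dgr_grading A)) => [|a b aP bP|i a ai].
- by rewrite !raddf0 mulr0.
- by rewrite !raddfD /= aP bP mulrDr.
rewrite (twistE _ (dgr_diff_homog ai)) (twistE _ ai) raddfMsign /= mulrA -exprD.
by congr (_ * _); apply: sign_odd; nia.
Qed.

Lemma dgr_leibniz_twist a b :
  dgr_diff A (a * b) = dgr_diff A a * b + twist 1 a * dgr_diff A b.
Proof.
move: a b; apply: (@homog_ind _ (dgr_grading A)) => [b|a a' aP a'P b|i a ai b].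
- by rewrite !(mul0r, raddf0) addr0.
- by rewrite !mulrDl !raddfD /= !mulrDl aP a'P addrACA.
by rewrite (dgr_leibniz _ ai) (twistE _ ai) mul1n mulrA.
Qed.

Lemma dgr_diff1 : dgr_diff A 1 = 0.
Proof. by have /cocycleP[_] := cocycle1 A. Qed.

Variable M : dgModule A.
Implicit Types x y : M.

Lemma dgm_leibniz_twist a x :
  dgm_diff M (a *: x) = dgr_diff A a *: x + twist 1 a *: dgm_diff M x.
Proof.
move: a x; apply: (@homog_ind _ (dgr_grading A)) => [x|a a' aP a'P x|i a ai x].
- by rewrite !(scale0r, raddf0) addr0.
- by rewrite !scalerDl !raddfD /= !scalerDl aP a'P addrACA.
by rewrite (dgm_leibniz _ ai) (twistE _ ai) mul1n scalerA.
Qed.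

End Twist.

(** * Cohomology and quasi-isomorphisms on cocycles *)

Section CohomologyFacts.
Variable A : dgRing.
Implicit Types M N : dgModule A.

Lemma trivial_cohomologyP M n :
  trivial_zmod (cohomology M n) <-> {subset cocycle M n <= boundary M n}.
Proof. exact: trivial_subquotP. Qed.

Lemma trivial_hom_cohomologyP M N n : trivial_zmod (hom_cohomology M N n) <->
  {subset hom_cocycle n <= @hom_boundary A M N n}.
Proof. exact: trivial_subquotP. Qed.

Lemma cohomology_map_subclass M N (f : dgHom N M) n x
    (xZ : x \in cocycle N n) (fxZ : f x \in cocycle M n) :
  cohomology_map f (subclass (boundary N n) xZ) = subclass _ fxZ.
Proof.
apply/subclass_eqP; rewrite -raddfB.
have : subrepr (subclass (boundary N n) xZ) - x \in boundary N n.
  by apply/(subclass_eqP _ (subrepr_num _) xZ); rewrite subreprK.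
case/boundaryP=> y yn ->; apply/boundaryP.
by exists (f y); [exact: dgh_homog | exact: dgh_diff].
Qed.

Lemma dgh_cocycle M N (f : dgHom N M) n x :
  x \in cocycle N n -> f x \in cocycle M n.
Proof.
case/cocycleP=> xn dx; apply/cocycleP.
by split; [exact: dgh_homog | rewrite -dgh_diff dx raddf0].
Qed.

Lemma quasi_isoP M N (f : dgHom N M) : quasi_iso f <-> forall n,
  (forall x, x \in cocycle N n -> f x \in boundary M n -> x \in boundary N n) /\
  (forall y, y \in cocycle M n ->
     exists2 x, x \in cocycle N n & f x - y \in boundary M n).
Proof.
split=> [qf n|qf n].
  have [g fK gK] := qf n; split=> [x xZ fxB|y yZ].
    apply/(subclass_eq0 (boundary N n) xZ); apply: (can_inj fK).
    rewrite (cohomology_map_subclass xZ (dgh_cocycle f xZ)).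
    rewrite -(subclass0 (boundary N n) (rpred0 _)).
    rewrite (cohomology_map_subclass _ (dgh_cocycle f (rpred0 _))).
    by apply/subclass_eqP; rewrite raddf0 subr0.
  have [x [xZ xE]] := subclassP (g (subclass (boundary M n) yZ)).
  exists x => //; apply/(subclass_eqP _ (dgh_cocycle f xZ) yZ).
  by rewrite -(cohomology_map_subclass xZ) -xE gK.
have [finj fsurj] := qf n.
have surj (c : cohomology M n) : exists c', cohomology_map f c' = c.
  have [y [yZ ->]] := subclassP c; have [x xZ fxy] := fsurj y yZ.
  exists (subclass (boundary N n) xZ).
  by rewrite (cohomology_map_subclass xZ (dgh_cocycle f xZ)); apply/subclass_eqP.
have [g gK] := choice surj.
exists g => // c.
have [x' [x'Z gE]] := subclassP (g (cohomology_map f c)).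
have [x [xZ cE]] := subclassP c.
have : cohomology_map f (subclass _ x'Z) = cohomology_map f (subclass _ xZ).
  by rewrite -gE gK cE.
rewrite !(cohomology_map_subclass _ (dgh_cocycle f _)) => /subclass_eqP.
rewrite -raddfB => /finj xx; rewrite gE cE; apply/subclass_eqP/xx; exact: rpredB.
Qed.

(** The leg to the zero module makes the apex of the roof acyclic, and surjectivity of the other leg
    passes this to [M]; conversely the roof is [M <- M -> 0]. *)
Lemma derived_iso_zero M : derived_iso M (dg_zero A) <-> acyclic M.
Proof.
split=> [[P [s [t [/quasi_isoP qs /quasi_isoP qt]]]] n|acM].
  apply/trivial_cohomologyP => y yZ; have [_ ss] := qs n.
  have [x xZ sxy] := ss y yZ.
  have : x \in boundary P n.
    apply: (qt n).1 => //; apply/boundaryP; exists 0; first exact: rpred0.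
    exact: row0_eq.
  case/boundaryP=> z zn xE; rewrite -[y](subKr (s x)) rpredB //.
  by apply/boundaryP; exists (s z); rewrite ?xE; [exact: dgh_homog | exact: dgh_diff].
pose i : dgHom M M := DGHom (dgh_fun := idfun) (fun i x xi => xi) (fun=> erefl).
have zh k x : x \in homog (dgm_grading M) k ->
    (\0 : {linear M -> dg_zero A}) x \in homog (dgm_grading (dg_zero A)) k.
  by move=> _; exact: rpred0.
pose z : dgHom M (dg_zero A) := DGHom zh (fun x => row0_eq _ _).
exists M, i, z; split; apply/quasi_isoP => n; split.
- by [].
- by move=> y yZ; exists y; rewrite ?subrr ?rpred0.
- by move=> x xZ _; exact: (trivial_cohomologyP M n).1.
move=> y _; exists 0; first exact: rpred0.
by apply/boundaryP; exists 0; [exact: rpred0 | exact: row0_eq].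
Qed.

End CohomologyFacts.

Section HomFacts.
Variables (A : dgRing) (N M : dgModule A) (n : int).
Implicit Types (f g h : N -> M) (a : A) (x : N).

Lemma hom_degree_twist f a x : hom_degree n f -> f (a *: x) = twist `|n| a *: f x.
Proof.
move=> fn; have fB := hom_degreeB fn.
have f0 : f 0 = 0 by rewrite -(subrr 0) fB subrr.
have fD u v : f (u + v) = f u + f v.
  by rewrite -[v in LHS]opprK fB -[- v]sub0r fB f0 sub0r opprK.
move: a x; apply: (@homog_ind _ (dgr_grading A)) => [x|a b aP bP x|i a ai x].
- by rewrite raddf0 !scale0r.
- by rewrite scalerDl fD aP bP raddfD scalerDl.
by rewrite (hom_degreeZ fn _ ai) (twistE _ ai) scalerA.
Qed.

Lemma hom_cocycleP f : reflect (hom_degree n f /\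
    forall x, dgm_diff M (f x) = (-1) ^+ `|n| *: f (dgm_diff N x))
  (f \in hom_cocycle n).
Proof.
apply: (iffP (asboolP _)) => -[fn df]; split=> //.
  by move=> x; apply/subr0_eq; have := congr1 (fun g => g x) df.
by apply/funext => x; rewrite /hom_diff df subrr.
Qed.

Lemma hom_boundaryP f : reflect (exists2 h, hom_degree (n - 1) h &
    forall x, f x = dgm_diff M (h x) - (-1) ^+ `|n - 1| *: h (dgm_diff N x))
  (f \in hom_boundary n).
Proof.
apply: (iffP (asboolP _)) => -[h hn fE]; exists h => //.
  by rewrite fE.
by apply/funext.
Qed.

End HomFacts.

Section Nonpositive.
Variables (A : dgRing) (A_nonpos : nonpositive A).
Implicit Types a : A.

Lemma diff_homog0 a : a \in homog (dgr_grading A) 0 -> dgr_diff A a = 0.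
Proof. by move=> a0; apply: (A_nonpos (i := 0 + 1)) (dgr_diff_homog a0). Qed.

Lemma twist_homog0 p a : a \in homog (dgr_grading A) 0 -> twist p a = a.
Proof. by move=> a0; rewrite (twistE _ a0) muln0 mul1r. Qed.

End Nonpositive.

Section Components.
Variable A : dgRing.
Implicit Types (N : dgModule A) (i n : int).

Lemma component_scale N i (b : A) (x : N) n : b \in homog (dgr_grading A) i ->
  component (dgm_grading N) n (b *: x) = b *: component (dgm_grading N) (n - i) x.
Proof.
move=> bi; apply: (component_additive (f := *:%R b)) => m y ym.
by rewrite addrC; exact: dgm_homogZ.
Qed.

Lemma component_mul i (b a : A) n : b \in homog (dgr_grading A) i ->
  component (dgr_grading A) n (b * a) = b * component (dgr_grading A) (n - i) a.
Proof. exact: (@component_scale (dg_regular A)). Qed.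

Lemma component_diff N n (x : N) :
  component (dgm_grading N) n (dgm_diff N x) = dgm_diff N (component (dgm_grading N) (n - 1) x).
Proof. by apply: component_additive; exact: dgm_diff_homog. Qed.

Lemma component_dgr_diff n (a : A) :
  component (dgr_grading A) n (dgr_diff A a) = dgr_diff A (component (dgr_grading A) (n - 1) a).
Proof. exact: (@component_diff (dg_regular A)). Qed.

End Components.

(** * Sub-DG-modules *)

Section SubDGModule.
Variables (A : dgRing) (X : dgModule A) (S : submodClosed X).
Hypothesis S_comp : forall n x, x \in S -> component (dgm_grading X) n x \in S.
Hypothesis S_diff : forall x, x \in S -> dgm_diff X x \in S.

Record dgsub := DGSub { dgsub_val : X; _ : dgsub_val \in S }.
HB.instance Definition _ := [isSub for dgsub_val].
HB.instance Definition _ := [Choice of dgsub by <:].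
HB.instance Definition _ := [SubChoice_isSubLmodule of dgsub by <:].

Definition dgsub_lift (f : {additive X -> X}) (fS : forall x, x \in S -> f x \in S)
  (u : dgsub) : dgsub := DGSub (fS _ (valP u)).
Fact dgsub_lift_zmod f fS : zmod_morphism (@dgsub_lift f fS).
Proof. by move=> x y; apply: val_inj; rewrite /= raddfB. Qed.
HB.instance Definition _ f fS :=
  GRing.isZmodMorphism.Build dgsub dgsub (@dgsub_lift f fS) (dgsub_lift_zmod fS).

Definition dgsub_component n : {additive dgsub -> dgsub} := dgsub_lift (@S_comp n).

Fact dgsub_componentK m n x : dgsub_component m (dgsub_component n x) =
  if m == n then dgsub_component n x else 0.
Proof. by apply: val_inj; rewrite /= componentK; case: eqP. Qed.

Fact dgsub_component_sum x : exists2 s : seq int,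
  uniq s & x = \sum_(n <- s) dgsub_component n x.
Proof.
have [s us xE] := component_sum (dgm_grading X) (val x).
by exists s => //; apply: val_inj; rewrite raddf_sum.
Qed.

Definition dgsub_grading : grading dgsub := Grading dgsub_componentK dgsub_component_sum.

Lemma dgsub_homogE n (u : dgsub) :
  (u \in homog dgsub_grading n) = (val u \in homog (dgm_grading X) n).
Proof. by []. Qed.

Definition dg_sub : dgModule A.
Proof.
apply: (@DGModule A dgsub dgsub_grading (dgsub_lift S_diff)).
- move=> i j a x ai xj; exact: (dgm_homogZ ai xj).
- by move=> i x; rewrite !dgsub_homogE; exact: dgm_diff_homog.
- by move=> x; apply: val_inj; exact: dgm_diff_diff.
- by move=> i a x ai; apply: val_inj; exact: (dgm_leibniz _ ai).
Defined.

End SubDGModule.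

(** * Direct sums and semi-free modules *)

Section DirectSumFacts.
Variables (A : dgRing) (X : Type) (M : X -> dgModule A).
Local Notation dsum := (dsum M).
Implicit Types (f g : dsum) (x y : X).

Lemma dsum_supp f : exists2 s : seq {classic X}, uniq s &
  forall x, f x <> 0 -> (x : {classic X}) \in s.
Proof.
have [s sE] := (@finite_seqP {classic X} _).1 (dsum_finite f).
exists (undup s); first exact: undup_uniq.
by move=> x fx0; rewrite mem_undup; move: fx0; rewrite -[_ <> _]/([set x | f x <> 0]%classic x) sE.
Qed.

(** [X] is an arbitrary type, so [x = y] is decided classically and [m] is transported along the
    equality. *)
Definition dsum_in_fun x (m : M x) y : M y :=
  if pselect (x = y) is left e then ecast z (M z) e m else 0.

Lemma dsum_in_fun_id x m : dsum_in_fun m x = m :> M x.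
Proof.
by rewrite /dsum_in_fun; case: pselect => // e; rewrite (Prop_irrelevance e erefl).
Qed.

Lemma dsum_in_fun_neq x m y : x <> y -> @dsum_in_fun x m y = 0.
Proof. by rewrite /dsum_in_fun; case: pselect. Qed.

Fact dsum_in_finite x m : finite_set [set y | @dsum_in_fun x m y <> 0]%classic.
Proof.
apply: (sub_finite_set _ (finite_set1 x)) => y /=.
by rewrite /dsum_in_fun; case: pselect => // <-.
Qed.

Definition dsum_in x (m : M x) : dsum := DSum (dsum_in_finite m).

Lemma dsum_in_id x (m : M x) : dsum_in m x = m.
Proof. exact: dsum_in_fun_id. Qed.

Lemma dsum_in_neq x (m : M x) y : x <> y -> dsum_in m y = 0.
Proof. exact: dsum_in_fun_neq. Qed.

Fact dsum_in_zmod x : zmod_morphism (@dsum_in x).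
Proof.
move=> m m'; apply: dsum_eqP => y; have [<-|xy] := pselect (x = y).
  by rewrite /= !dsum_in_fun_id.
by rewrite /= !dsum_in_fun_neq ?subr0.
Qed.
HB.instance Definition _ x := GRing.isZmodMorphism.Build (M x) dsum (@dsum_in x) (@dsum_in_zmod x).

Lemma dsum_inZ x a (m : M x) : dsum_in (a *: m) = a *: dsum_in m.
Proof.
apply: dsum_eqP => y; have [<-|xy] := pselect (x = y).
  by rewrite /= !dsum_in_fun_id.
by rewrite /= !dsum_in_fun_neq ?scaler0.
Qed.

Lemma dsum_decomp f (s : seq {classic X}) : uniq s ->
  (forall x, f x <> 0 -> (x : {classic X}) \in s) -> f = \sum_(x <- s) dsum_in (f x).
Proof.
move=> us fs; apply: dsum_eqP => y; rewrite dsum_sumE.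
have [ys|ys] := boolP ((y : {classic X}) \in s).
  rewrite (bigD1_seq (y : {classic X})) //= big1 ?addr0 ?dsum_in_fun_id // => x /eqP xy.
  exact: dsum_in_neq.
rewrite big_seq big1 => [|x xs].
  by apply: contrapT => /fs; rewrite (negPf ys).
by apply: dsum_in_neq => xy; rewrite -xy xs in ys.
Qed.

Lemma dsum_ind (P : dsum -> Prop) : P 0 -> (forall f g, P f -> P g -> P (f + g)) ->
  (forall x (m : M x), P (dsum_in m)) -> forall f, P f.
Proof.
move=> P0 PD Ph f; have [s us sP] := dsum_supp f.
by rewrite (dsum_decomp us sP); apply: big_ind.
Qed.

Lemma dsum_mem_boundary n f :
  (forall x, f x \in boundary (M x) n) -> f \in boundary (dg_dsum M) n.
Proof.
move=> fB; have [s us sP] := dsum_supp f.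
rewrite (dsum_decomp us sP); apply: rpred_sum => x _.
have /boundaryP[y yn fx] := fB x; apply/boundaryP; exists (dsum_in y).
  apply/dsum_homogP => z; have [<-|xz] := pselect (x = z).
    by rewrite dsum_in_id.
  by rewrite dsum_in_neq // rpred0.
apply: dsum_eqP => z; have [<-|xz] := pselect (x = z).
  by rewrite /= !dsum_in_fun_id.
by rewrite /= !dsum_in_fun_neq // raddf0.
Qed.

Lemma dsum_boundary n f x : f \in boundary (dg_dsum M) n -> f x \in boundary (M x) n.
Proof.
case/boundaryP=> g /dsum_homogP gn ->; apply/boundaryP.
by exists (g x) => //; exact: gn.
Qed.

Variable V : zmodType.
Variable k : forall x, {additive M x -> V}.

(** The universal property of the direct sum, with an abelian group as target so that it also serves
    maps that are linear only up to sign; by [dsum_liftE] the chosen support does not matter. *)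
Definition dsum_lift f : V := \sum_(x <- s2val (cid2 (dsum_supp f))) k x (f x).

Lemma dsum_liftE f (s : seq {classic X}) : uniq s ->
  (forall x, f x <> 0 -> (x : {classic X}) \in s) ->
  dsum_lift f = \sum_(x <- s) k x (f x).
Proof.
rewrite /dsum_lift; case: cid2 => t ut ft us fs /=.
pose b (x : {classic X}) := `[< f x <> 0 >].
have red (u : seq {classic X}) : \sum_(x <- u) k x (f x) = \sum_(x <- [seq x <- u | b x]) k x (f x).
  rewrite big_filter [RHS]big_mkcond; apply: eq_bigr => x _; rewrite /b; case: asboolP => // fx.
  by rewrite (contrapT fx) raddf0.
rewrite red [RHS]red; apply: perm_big; apply: uniq_perm; rewrite ?filter_uniq // => x.
by rewrite !mem_filter /b; case: asboolP => //= fx; rewrite ft // fs.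
Qed.

Fact dsum_lift_zmod : zmod_morphism dsum_lift.
Proof.
move=> f g; have [[s us fs] [t ut gt]] := (dsum_supp f, dsum_supp g).
have sub (h : dsum) : (forall x, f x = 0 -> g x = 0 -> h x = 0) ->
    forall x, h x <> 0 -> (x : {classic X}) \in undup (s ++ t).
  move=> hP x hx; rewrite mem_undup mem_cat.
  have [f0|/fs-> //] := pselect (f x = 0).
  have [g0|/gt->] := pselect (g x = 0); last by rewrite orbT.
  by case: hx; apply: hP.
have us' := undup_uniq (s ++ t).
rewrite (dsum_liftE us' (sub f _)) // (dsum_liftE us' (sub g _)) //.
rewrite (dsum_liftE us' (sub (f - g) _)) => [|x f0 g0]; last first.
  by rewrite /= f0 g0 oppr0 addr0.
by rewrite -sumrB; apply: eq_bigr => x _; rewrite -raddfB.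
Qed.
HB.instance Definition _ := GRing.isZmodMorphism.Build dsum V dsum_lift dsum_lift_zmod.

Lemma dsum_lift_in x (m : M x) : dsum_lift (dsum_in m) = k x m.
Proof.
rewrite (@dsum_liftE _ [:: (x : {classic X})]) //; last first.
  move=> y; rewrite mem_seq1; have [->|xy] := pselect (y = x); first by rewrite eqxx.
  by rewrite dsum_in_neq // => /esym.
by rewrite big_seq1 dsum_in_id.
Qed.

End DirectSumFacts.

Section Shift.
Variables (A : dgRing) (M : dgModule A) (k : int).

Definition shift_component (n : int) : {additive M -> M} := component (dgm_grading M) (n - k).

Fact shift_componentK m n x : shift_component m (shift_component n x) =
  if m == n then shift_component n x else 0.
Proof. by rewrite /shift_component componentK (inj_eq (addIr _)). Qed.

Fact shift_component_sum x : exists2 s : seq int,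
  uniq s & x = \sum_(n <- s) shift_component n x.
Proof.
have [s us xE] := component_sum (dgm_grading M) x.
exists [seq n + k | n <- s]; first by rewrite map_inj_uniq //; exact: addIr.
by rewrite big_map [LHS]xE; apply: eq_bigr => n _; rewrite /shift_component addrK.
Qed.

Definition shift_grading : grading M := Grading shift_componentK shift_component_sum.

Lemma shift_homogE n x : (x \in homog shift_grading n) = (x \in homog (dgm_grading M) (n - k)).
Proof. by []. Qed.

(* Keeping the scalar action on the left and the differential unchanged makes
   the shift by any [k] sign-free: one thinks of the suspension as acting from
   the right. *)
Definition dg_shift : dgModule A.
Proof.
apply: (@DGModule A M shift_grading (dgm_diff M)).
- by move=> i j a x ai; rewrite !shift_homogE => xj; rewrite -addrA dgm_homogZ.
- by move=> i x; rewrite !shift_homogE addrAC; exact: dgm_diff_homog.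
- exact: dgm_diff_diff.
- exact: dgm_leibniz.
Defined.

End Shift.

(** * Free graded modules with a twisted differential *)

Section FreeModule.
Variables (A : dgRing) (X : Type) (deg : X -> int).

Local Notation FM := (fun e => dg_shift (dg_regular A) (deg e)).

(** Its own differential acts on the coefficients and kills the generators, since 1 is a cocycle of
    [A]. *)
Definition free_graded : dgModule A :=
  dg_dsum FM.

Definition free_coef (e : X) (p : free_graded) : A := dsum_fun p e.

Definition free_gen (e : X) : free_graded :=
  dsum_in (M := FM) (x := e) (1 : A).

Fact free_coef_zmod e : zmod_morphism (free_coef e).
Proof. by []. Qed.
HB.instance Definition _ e :=
  GRing.isZmodMorphism.Build free_graded A (free_coef e) (@free_coef_zmod e).

Lemma free_coefB p q e : free_coef e (p - q) = free_coef e p - free_coef e q.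
Proof. by []. Qed.
Lemma free_coefD p q e : free_coef e (p + q) = free_coef e p + free_coef e q.
Proof. by []. Qed.
Lemma free_coefZ a p e : free_coef e (a *: p) = a * free_coef e p.
Proof. by []. Qed.
Lemma free_coef0 e : free_coef e 0 = 0.
Proof. by []. Qed.
Lemma free_coef_gen e : free_coef e (free_gen e) = 1.
Proof. exact: (@dsum_in_id _ _ FM e (1 : A)). Qed.
Lemma free_coef_gen_neq e e' : e <> e' -> free_coef e' (free_gen e) = 0.
Proof. by move=> ee; apply: (@dsum_in_neq _ _ FM e (1 : A)). Qed.

Lemma free_homogP n p : reflect
  (forall e, free_coef e p \in homog (dgr_grading A) (n - deg e))
  (p \in homog (dgm_grading free_graded) n).
Proof. exact: dsum_homogP. Qed.

Lemma free_gen_homog e : free_gen e \in homog (dgm_grading free_graded) (deg e).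
Proof.
apply/free_homogP => e'; have [<-|ee] := pselect (e = e').
  by rewrite free_coef_gen subrr dgr_homog1.
by rewrite free_coef_gen_neq // rpred0.
Qed.

Lemma free_ind (P : free_graded -> Prop) : P 0 ->
  (forall p q, P p -> P q -> P (p + q)) ->
  (forall a e, P (a *: free_gen e)) -> forall p, P p.
Proof.
move=> P0 PD Ph; apply: dsum_ind => // e a.
by rewrite -[a]mulr1 -/((a : A) *: (1 : A^o)) dsum_inZ; apply: Ph.
Qed.

Lemma free_expand p : exists s : seq (A * X), p = \sum_(u <- s) u.1 *: free_gen u.2.
Proof.
elim/free_ind: p => [|p q [s ->] [t ->]|a e].
- by exists [::]; rewrite big_nil.
- by exists (s ++ t); rewrite big_cat.
- by exists [:: (a, e)]; rewrite big_seq1.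
Qed.

Section Extension.
Variables (M : lmodType A) (n : nat) (k : X -> M).

Definition free_ext_term (e : X) (a : A) : M := twist n a *: k e.
Fact free_ext_term_zmod e : zmod_morphism (free_ext_term e).
Proof. by move=> a b; rewrite /free_ext_term raddfB scalerBl. Qed.
HB.instance Definition _ e :=
  GRing.isZmodMorphism.Build A M (free_ext_term e) (@free_ext_term_zmod e).

(** Linear up to the sign of a map of degree [n]: the same extension gives DG-maps ([n = 0]),
    differentials ([n = 1]) and homotopies. *)
Definition free_ext : {additive free_graded -> M} :=
  dsum_lift (M := FM) (fun e => free_ext_term e).

Lemma free_ext0 : free_ext 0 = 0. Proof. exact: raddf0. Qed.
Lemma free_extN : {morph free_ext : p / - p}. Proof. exact: raddfN. Qed.
Lemma free_extD : {morph free_ext : p q / p + q}. Proof. exact: raddfD. Qed.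
Lemma free_extB : {morph free_ext : p q / p - q}. Proof. exact: raddfB. Qed.

Lemma free_extE p (s : seq {classic X}) : uniq s ->
  (forall e, free_coef e p <> 0 -> (e : {classic X}) \in s) ->
  free_ext p = \sum_(e <- s) twist n (free_coef e p) *: k e.
Proof.
exact: (@dsum_liftE _ _ FM M (fun e => free_ext_term e : {additive A -> M})).
Qed.

Lemma free_extZgen a e : free_ext (a *: free_gen e) = twist n a *: k e.
Proof. by rewrite -[_ *: _]dsum_inZ [LHS]dsum_lift_in /free_ext_term [_ *: _]mulr1. Qed.

Lemma free_ext_gen e : free_ext (free_gen e) = k e.
Proof. by rewrite -[free_gen e]scale1r free_extZgen twist1 scale1r. Qed.

Lemma free_extZ a p : free_ext (a *: p) = twist n a *: free_ext p.
Proof.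
elim/free_ind: p => [|p q pP qP|b e].
- by rewrite scaler0 raddf0 scaler0.
- by rewrite scalerDr !raddfD /= pP qP.
by rewrite scalerA !free_extZgen twistM scalerA.
Qed.

End Extension.

(** Partial lifts carry meaning only on their own set of cells, so values off the support have to be
    irrelevant. *)
Lemma eq_free_ext (M : lmodType A) n (k k' : X -> M) p :
  (forall e, free_coef e p <> 0 -> k e = k' e) -> free_ext n k p = free_ext n k' p.
Proof.
move=> kk; have [s us sP] := dsum_supp p.
rewrite !(free_extE _ _ us sP); apply: eq_bigr => e _.
have [->|pe] := pselect (free_coef e p = 0).
  by rewrite !raddf0 !scale0r.
by rewrite kk.
Qed.

Lemma free_ext_homog (M : dgModule A) n (r : int) (k : X -> M) i p :
  (forall e, free_coef e p <> 0 -> k e \in homog (dgm_grading M) (r + deg e)) ->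
  p \in homog (dgm_grading free_graded) i ->
  free_ext n k p \in homog (dgm_grading M) (r + i).
Proof.
move=> kr /free_homogP pi; have [s us sP] := dsum_supp p.
rewrite (free_extE _ _ us sP); apply: rpred_sum => e _.
have [->|pe] := pselect (free_coef e p = 0).
  by rewrite raddf0 scale0r rpred0.
apply: homog_cast (dgm_homogZ (twist_homog n (pi e)) (kr e pe)) _; lia.
Qed.

Section Twisted.
Variable bd : X -> free_graded.

(* Locked, since unification would otherwise match [free_diff p] with a sum. *)
Fact free_diff_key : unit. Proof. exact: tt. Qed.
Definition free_diff : free_graded -> free_graded :=
  locked_with free_diff_key (fun p => dgm_diff free_graded p + free_ext 1 bd p).

Lemma free_diffE p : free_diff p = dgm_diff free_graded p + free_ext 1 bd p.
Proof. by rewrite /free_diff unlock. Qed.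

Fact free_diff_zmod : zmod_morphism free_diff.
Proof. by move=> p q; rewrite !free_diffE !raddfB /= opprD addrACA. Qed.
HB.instance Definition _ :=
  GRing.isZmodMorphism.Build free_graded free_graded free_diff free_diff_zmod.

Lemma free_diffD : {morph free_diff : p q / p + q}.
Proof. exact: raddfD. Qed.

Lemma free_diffZ a p : free_diff (a *: p) = dgr_diff A a *: p + twist 1 a *: free_diff p.
Proof. by rewrite !free_diffE dgm_leibniz_twist free_extZ scalerDr addrA. Qed.

Lemma free_diff_gen e : free_diff (free_gen e) = bd e.
Proof.
rewrite free_diffE free_ext_gen; suff -> : dgm_diff free_graded (free_gen e) = 0 by rewrite add0r.
apply: dsum_eqP => e'; have [<-|ee] := pselect (e = e').
  by rewrite /= dsum_in_fun_id; exact: dgr_diff1.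
by rewrite /= dsum_in_fun_neq // raddf0.
Qed.

Hypothesis bd_homog : forall e, bd e \in homog (dgm_grading free_graded) (deg e + 1).
Hypothesis bd_diff : forall e, free_diff (bd e) = 0.

Fact free_diff_homog i p : p \in homog (dgm_grading free_graded) i ->
  free_diff p \in homog (dgm_grading free_graded) (i + 1).
Proof.
move=> pi; rewrite free_diffE rpredD //; first exact: dgm_diff_homog.
by rewrite addrC; apply: free_ext_homog => // e _; rewrite addrC; exact: bd_homog.
Qed.

Fact free_diff_diff p : free_diff (free_diff p) = 0.
Proof.
elim/free_ind: p => [|p q pP qP|a e].
- by rewrite !raddf0.
- by rewrite (free_diffD p q) (free_diffD (free_diff p)) pP qP addr0.
rewrite free_diffZ (free_diffD (_ *: _)) !free_diffZ !free_diff_gen bd_diff.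
rewrite dgr_diff_diff scale0r add0r scaler0 addr0.
by rewrite twist_diff expr1 mulN1r scaleNr addNr.
Qed.

Definition dg_free : dgModule A.
Proof.
apply: (@DGModule A free_graded (dgm_grading free_graded) free_diff).
- exact: dgm_homogZ.
- exact: free_diff_homog.
- exact: free_diff_diff.
- move=> i a p ai; rewrite [LHS]free_diffZ (twistE _ ai) mul1n scalerA //.
Defined.

End Twisted.
End FreeModule.
#[global] Arguments free_ext : simpl never.

(** * The injectivity criterion *)

Section Criterion.
Variables (A : dgRing) (M : dgModule A).

(* A derived map from the DG-left ideal [A^{<j} + W] of [A], [W] in [Z^j(A)], to the
   shift of [M] by [-j], twisted by [c]: on cohomology it is the relation [G] with
   domain [W]. Solving the problem by [m] means extending it to [a |-> a m] on all of
   [A]; the obstruction lies in [Ext^(1 - j)(A / (A^{<j} + W), M)]. *)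
Record lifting_problem (j : int) (c : M) (G : A -> M -> Prop) : Prop := LiftingProblem {
  lp_cocycle : c \in cocycle M (1 - j);
  lp_homog : forall w x, G w x ->
    w \in homog (dgr_grading A) j /\ x \in homog (dgm_grading M) 0;
  lp_dom : forall w x, G w x ->
    dgr_diff A w = 0 /\ dgm_diff M x = (-1) ^+ `|1 - j| *: (w *: c);
  lp_sub : forall w x w' x', G w x -> G w' x' -> G (w - w') (x - x');
  lp_scale : forall b w x, b \in homog (dgr_grading A) 0 -> G w x -> G (b * w) (b *: x);
  lp_diffl : forall a, a \in homog (dgr_grading A) (j - 1) ->
    G (dgr_diff A a) ((-1) ^+ `|1 - j| *: (a *: c));
  lp_diffr : forall y, y \in homog (dgm_grading M) (0 - 1) -> G 0 (dgm_diff M y)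
}.

(* With [c = 0], [j = 0] this is Baer's criterion for [H^0(M)]; in general it also
   encodes [H^(-j)(M) = Hom(H^j(A), H^0(M))]. *)
Definition injectivity_criterion : Prop := forall j c G, lifting_problem j c G ->
  (forall x, G 0 x -> x \in boundary M 0) ->
  exists m, [/\ m \in homog (dgm_grading M) (- j), dgm_diff M m = c &
    forall w x, G w x -> x + w *: m \in boundary M 0].

(** A primitive [m] of [c] turns every [x + w *: m] into a cocycle, hence into a boundary. *)
Lemma acyclic_criterion : acyclic M -> injectivity_criterion.
Proof.
move=> acM j c G [cZ Gh Gd _ _ _ _] _.
have acP n := (trivial_cohomologyP M n).1 (acM n).
have /boundaryP[m mh cE] := acP _ _ cZ.
have mj : m \in homog (dgm_grading M) (- j) by apply: homog_cast mh _; lia.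
exists m; split=> // w x Gwx; apply: acP; apply/cocycleP.
have [[wj x0] [dw dx]] := (Gh w x Gwx, Gd w x Gwx); split.
  by rewrite rpredD //; apply: homog_cast (dgm_homogZ wj mj) _; lia.
rewrite raddfD /= dx (dgm_leibniz _ wj) dw scale0r add0r -cE.
rewrite -scalerDl (@sign_oddN _ _ `|j|) ?addNr ?scale0r //; lia.
Qed.

End Criterion.

Section FreeSupport.
Variables (A : dgRing) (X : Type) (deg : X -> int) (S : set X).
Local Notation F := (free_graded A deg).

Definition supported (p : F) : Prop := forall e, free_coef e p <> 0 -> S e.

Lemma supported0 : supported 0.
Proof. by move=> e; rewrite free_coef0. Qed.

Lemma supportedD p q : supported p -> supported q -> supported (p + q).
Proof.
move=> sp sq e; rewrite free_coefD => pq.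
have [p0|/sp //] := pselect (free_coef e p = 0).
by apply: sq => q0; rewrite p0 q0 addr0 in pq.
Qed.

Lemma supportedZ a p : supported p -> supported (a *: p).
Proof. by move=> sp e; rewrite free_coefZ => ap; apply: sp => p0; rewrite p0 mulr0 in ap. Qed.

Lemma supportedN p : supported p -> supported (- p).
Proof. by rewrite -scaleN1r; exact: supportedZ. Qed.

Lemma supportedB p q : supported p -> supported q -> supported (p - q).
Proof. by move=> sp sq; apply: supportedD => //; exact: supportedN. Qed.

Lemma supported_gen e : S e -> supported (free_gen A deg e).
Proof.
move=> Se e'; have [<-//|ee] := pselect (e = e').
by rewrite free_coef_gen_neq.
Qed.

Lemma supported_coef p e : supported p -> ~ S e -> free_coef e p = 0.
Proof. by move=> sp nS; apply: contrapT => /sp. Qed.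

Lemma supported_ind (P : F -> Prop) : P 0 -> (forall p q, P p -> P q -> P (p + q)) ->
  (forall a e, S e -> P (a *: free_gen A deg e)) -> forall p, supported p -> P p.
Proof.
move=> P0 PD Pg p sp; have [s us ps] := dsum_supp p.
rewrite (dsum_decomp us ps); elim/big_ind: _ => // e _.
have [pe|/sp Se] := pselect (free_coef e p = 0).
  by rewrite [dsum_fun p e]pe raddf0.
by have := Pg (free_coef e p) e Se; rewrite -[_ *: _]dsum_inZ [_ *: _]mulr1.
Qed.

End FreeSupport.
Arguments supported {A X deg} S p.

(** * Null-homotopies built cell by cell *)

Section CellularLifting.
Variables (A : dgRing) (A_nonpos : nonpositive A).
Variables (X : Type) (deg : X -> int) (bd : X -> free_graded A deg).
Hypothesis bd_homog : forall e, bd e \in homog (dgm_grading (free_graded A deg)) (deg e + 1).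
Hypothesis bd_diff : forall e, free_diff bd (bd e) = 0.
(** Semi-freeness as an induction principle, in place of an exhaustive filtration. *)
Hypothesis bd_wf : forall S : set X,
  (forall e, supported S (bd e) -> S e) -> forall e, S e.
Local Notation P := (dg_free bd_homog bd_diff).
Local Notation D := (dgm_diff P).
Local Notation gen := (free_gen A deg).
Variables (M : dgModule A) (critM : injectivity_criterion M).
Variables (i : int) (f : P -> M) (fZ : f \in hom_cocycle i).
Hypothesis f_boundary : forall p, p \in cocycle P (- i) -> f p \in boundary M 0.

Let fn : hom_degree i f. Proof. by have /hom_cocycleP[] := fZ. Qed.
Let df x : dgm_diff M (f x) = (-1) ^+ `|i| *: f (D x).
Proof. by have /hom_cocycleP[_] := fZ. Qed.
Let fB : {morph f : x y / x - y}. Proof. exact: hom_degreeB fn. Qed.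
Let f0 : f 0 = 0. Proof. by rewrite -(subrr 0) fB subrr. Qed.
Let fN : {morph f : x / - x}. Proof. by move=> x; rewrite -sub0r fB f0 sub0r. Qed.
Let fD : {morph f : x y / x + y}. Proof. by move=> x y; rewrite -[y in LHS]opprK fB fN opprK. Qed.
Let fh n x : x \in homog (dgm_grading P) n -> f x \in homog (dgm_grading M) (i + n).
Proof. exact: hom_degree_homog fn _ _. Qed.
Let f_scale a x : f (a *: x) = twist `|i| a *: f x. Proof. exact: hom_degree_twist. Qed.
Let DB p q : D (p - q) = D p - D q. Proof. exact: raddfB. Qed.
Let DD p q : D (p + q) = D p + D q. Proof. exact: raddfD. Qed.
Let DZ a p : D (a *: p) = dgr_diff A a *: p + twist 1 a *: D p.
Proof. exact: free_diffZ. Qed.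
Let Dgen e : D (gen e) = bd e. Proof. exact: free_diff_gen. Qed.
Let D_homog n p : p \in homog (dgm_grading P) n -> D p \in homog (dgm_grading P) (n + 1).
Proof. exact: dgm_diff_homog. Qed.
Let DDp p : D (D p) = 0. Proof. exact: dgm_diff_diff. Qed.

Local Notation ext k := (free_ext deg `|i - 1| k).
Local Notation sg := ((-1) ^+ `|i|).

(* [pl_bound] is the global constraint that keeps the lift extendable from one cell to
   the next: it prescribes [k] on every coboundary of [P] supported on [S]. *)
Record partial_lift (S : set X) (k : X -> M) : Prop := PartialLift {
  pl_closed : forall e, S e -> supported S (bd e);
  pl_homog : forall e, S e -> k e \in homog (dgm_grading M) (i - 1 + deg e);
  pl_diff : forall e, S e -> dgm_diff M (k e) = f (gen e) - sg *: ext k (bd e);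
  pl_bound : forall p, p \in homog (dgm_grading P) (- i) -> supported S (D p) ->
    f p - sg *: ext k (D p) \in boundary M 0
}.

(** Without cells, [pl_bound] concerns only cocycles of [P], which is the hypothesis
    [f_boundary]. *)
Lemma partial_lift0 : partial_lift set0 (fun=> 0).
Proof.
split=> // p pi sp; have Dp0 : D p = 0.
  by apply: dsum_eqP => e; apply: (supported_coef sp).
by rewrite Dp0 raddf0 scaler0 subr0; apply/f_boundary/cocycleP.
Qed.

Section Step.
Variables (S : set X) (k : X -> M) (Sk : partial_lift S k).
Local Notation H := (ext k).

Let supp_diff q : supported S q -> supported S (D q).
Proof.
move: q; apply: supported_ind => [|p p' sp sp'|a e Se].
- by rewrite raddf0; exact: supported0.
- by rewrite DD; exact: supportedD.
rewrite DZ Dgen; apply: supportedD; apply: supportedZ; first exact: supported_gen.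
exact: pl_closed Sk _ Se.
Qed.

Lemma ext_diff q : supported S q -> dgm_diff M (H q) = f q - sg *: H (D q).
Proof.
move: q; apply: supported_ind => [|p p' sp sp'|a e Se].
- by rewrite !raddf0 f0 ?subr0 ?addr0.
- by rewrite DD fD !raddfD /= sp sp' addrACA.
rewrite DZ Dgen f_scale free_extZgen dgm_leibniz_twist (pl_diff Sk Se) free_extD.
rewrite free_extZgen free_extZ !twist_twist (twist_diff `|i - 1|).
rewrite !scalerBr !scalerDr !scalerA.
have -> : sg * ((-1) ^+ `|i - 1| * dgr_diff A (twist `|i - 1| a)) =
    - dgr_diff A (twist `|i - 1| a).
  by rewrite mulrA -exprD (@sign_oddN _ _ 0) ?mulN1r //; lia.
rewrite (twist_odd (p := 1 + `|i - 1|) (q := `|i|)); last lia.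
rewrite (twist_odd (p := `|i - 1| + 1) (q := `|i|)); last lia.
by rewrite commr_sign scaleNr opprD opprK addrCA.
Qed.

Lemma ext_homog n q : supported S q -> q \in homog (dgm_grading P) n ->
  H q \in homog (dgm_grading M) (i - 1 + n).
Proof. by move=> sq; apply: free_ext_homog => e /sq Se; exact: pl_homog Sk _ Se. Qed.

Variables (e : X) (nSe : ~ S e) (Sbd : supported S (bd e)).
Let n := deg e.
(** The degree of the coefficient of [gen e] in [D p] for [p] of degree [-i]. *)
Let j := 1 - i - n.
Let c := f (gen e) - sg *: H (bd e).
(** The sign that turns [- sg *: ext k' (w *: gen e)], the share of the new cell in [pl_bound], into
    the [+ w *: m] of the criterion. *)
Let kap : nat := `|i| + `|i - 1| * `|j| + 1.

(** What [pl_bound] will demand of the value [m] at [e]: if [D p] reaches only [S] and [e], with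
    coefficient [w] at [e], then [x + w *: m] must be a boundary. The term [dgm_diff M y] provides
    [lp_diffr]. *)
Let G (w : A) (x : M) : Prop := exists p q y,
  [/\ p \in homog (dgm_grading P) (- i), supported S q, D p = w *: gen e + q,
    y \in homog (dgm_grading M) (0 - 1) &
    w \in homog (dgr_grading A) j /\
    x = (-1) ^+ kap *: (f p - sg *: H q) + dgm_diff M y].

Lemma step_homog w p q : p \in homog (dgm_grading P) (- i) ->
  w \in homog (dgr_grading A) j -> D p = w *: gen e + q ->
  q \in homog (dgm_grading P) (1 - i).
Proof.
move=> pi wj /(canLR (addKr _)) <-.
rewrite addrC rpredB //; first by apply: homog_cast (D_homog pi) _; lia.
by apply: homog_cast (dgm_homogZ wj (free_gen_homog A deg e)) _; rewrite /j /n; lia.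
Qed.

Lemma step_problem : lifting_problem j c G.
Proof.
have ch : c \in homog (dgm_grading M) (1 - j).
  rewrite rpredB ?rpredZsign //.
    by apply: homog_cast (fh (free_gen_homog A deg e)) _; rewrite /j /n; lia.
  by apply: homog_cast (ext_homog Sbd (bd_homog e)) _; rewrite /j /n; lia.
have dext : dgm_diff M (H (bd e)) = f (bd e).
  by rewrite (ext_diff Sbd) -Dgen DDp raddf0 scaler0 subr0.
split.
- apply/cocycleP; split=> //; rewrite /c raddfB /= raddfZsign /= dext df Dgen subrr //.
- move=> w x [p [q [y [pi sq Dp yh [wj ->]]]]]; split=> //.
  have qh := step_homog pi wj Dp.
  rewrite rpredD ?rpredZsign ?rpredB ?rpredZsign //.
  + by apply: homog_cast (fh pi) _; lia.
  + by apply: homog_cast (ext_homog sq qh) _; lia.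
  by apply: homog_cast (dgm_diff_homog yh) _; lia.
- move=> w x [p [q [y [pi sq Dp yh [wj ->]]]]].
  have DDp0 := DDp p; rewrite Dp DD DZ Dgen in DDp0.
  (* This is the coefficient of [gen e] in [D (D p) = 0], since neither [bd e] nor [D q] involves
     [e]. *)
  have dw : dgr_diff A w = 0.
    have := congr1 (free_coef e) DDp0.
    rewrite !free_coefD !free_coefZ free_coef_gen mulr1.
    rewrite (supported_coef Sbd nSe) (supported_coef (supp_diff sq) nSe).
    by rewrite mulr0 !addr0.
  split=> //; rewrite raddfD dgm_diff_diff addr0 raddfZsign raddfB raddfZsign /=.
  have -> : dgm_diff M (f p) - sg *: dgm_diff M (H q) = sg *: (twist `|i| w *: c).
    rewrite df ext_diff // -scalerBr; congr (_ *: _).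
    rewrite Dp fD f_scale opprB addrA [X in X - _]addrAC addrK /c scalerBr; congr (_ + _).
    have -> : D q = - (twist 1 w *: bd e).
      by apply/eqP; rewrite -addr_eq0 addrC; rewrite dw scale0r add0r in DDp0; apply/eqP.
    rewrite free_extN free_extZ twist_twist scalerN !scalerA commr_sign.
    by rewrite (twist_odd (p := `|i - 1| + 1) (q := `|i|)) //; lia.
  rewrite (twistE _ wj) -!scalerA !scalerA -exprD; congr (_ *: _); rewrite mulrA -exprD.
  by congr (_ * _); apply: sign_odd; rewrite /kap /j; parity.
- move=> w x w' x' [p [q [y [pi sq Dp yh [wj ->]]]]] [p' [q' [y' [pi' sq' Dp' yh' [wj' ->]]]]].
  exists (p - p'), (q - q'), (y - y'); split; rewrite ?rpredB //.
  - exact: supportedB.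
  - by rewrite DB Dp Dp' scalerBl opprD addrACA.
  split=> //; rewrite fB free_extB (scalerBr sg) subrACA (scalerBr (_ ^+ kap) (_ - _) (_ - _)).
  by rewrite (raddfB (dgm_diff M)) opprD addrACA.
- move=> b w x b0 [p [q [y [pi sq Dp yh [wj ->]]]]].
  exists (b *: p), (b *: q), (b *: y); split.
  - by apply: homog_cast (dgm_homogZ b0 pi) _; lia.
  - exact: supportedZ.
  - by rewrite DZ diff_homog0 // scale0r add0r twist_homog0 // Dp scalerDr scalerA.
  - by apply: homog_cast (dgm_homogZ b0 yh) _; lia.
  split; first by apply: homog_cast (dgr_homogM b0 wj) _; lia.
  rewrite scalerDr dgm_leibniz_twist diff_homog0 // scale0r add0r twist_homog0 //.
  congr (_ + _); rewrite f_scale free_extZ !twist_homog0 //.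
  by rewrite scaler_signC scalerBr scaler_signC.
(* The differential of [a *: gen e] has coefficient [dgr_diff A a] at [e] and the rest in [S]. *)
- move=> a aj; exists (a *: gen e), (twist 1 a *: bd e), 0; split.
  - by apply: homog_cast (dgm_homogZ aj (free_gen_homog A deg e)) _; rewrite /j /n; lia.
  - exact: supportedZ.
  - by rewrite DZ Dgen.
  - exact: rpred0.
  split; first by apply: homog_cast (dgr_diff_homog aj) _; lia.
  rewrite raddf0 addr0 f_scale free_extZ twist_twist.
  rewrite (twist_odd (p := `|i - 1| + 1) (q := `|i|)); last lia.
  have -> : twist `|i| a *: f (gen e) - sg *: (twist `|i| a *: H (bd e)) =
      twist `|i| a *: c.
    by rewrite /c scalerBr scaler_signC.
  rewrite (twistE _ aj) !scalerA mulrA -exprD; congr (_ * _ *: _).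
  by apply: sign_odd; rewrite /kap /j; parity.
- move=> y yh; exists 0, 0, y; split=> //; rewrite ?rpred0 //.
  - by rewrite scale0r addr0; exact: raddf0.
  by split; rewrite ?rpred0 // f0 free_ext0 scaler0 subrr scaler0 add0r.
Qed.

Lemma partial_lift_step : exists2 k' : X -> M,
  partial_lift (S `|` [set e])%classic k' & forall e', S e' -> k' e' = k e'.
Proof.
(* A coefficient 0 at [e] means that [D p] already lies over [S], where [pl_bound] is known. *)
have Gb x : G 0 x -> x \in boundary M 0.
  case=> p [q [y [pi sq Dp yh [_ ->]]]]; rewrite scale0r add0r in Dp.
  rewrite rpredD ?rpredZsign -?Dp ?(pl_bound Sk pi) ?Dp //.
  by apply/boundaryP; exists y.
have [m [mh dm mb]] := critM step_problem Gb.
pose k' e' := if pselect (e' = e) then m else k e'.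
have k'S e' : S e' -> k' e' = k e'.
  by rewrite /k' => Se'; case: pselect => // ee'; case: nSe; rewrite -ee'.
have k'e : k' e = m by rewrite /k'; case: pselect.
have extS q : supported S q -> ext k' q = H q.
  by move=> sq; apply: eq_free_ext => e' /sq; exact: k'S.
exists k' => //; split.
- by move=> e' [/(pl_closed Sk) sb|->] e'' /=; [move/sb; left | move/Sbd; left].
- move=> e' [Se'|->]; first by rewrite k'S //; exact: pl_homog Sk _ Se'.
  by rewrite k'e; apply: homog_cast mh _; rewrite /j /n; lia.
- move=> e' [Se'|->].
    by rewrite k'S // (pl_diff Sk Se') extS //; exact: pl_closed Sk _ Se'.
  by rewrite k'e extS.
move=> p pi sDp; set w := free_coef e (D p); set q := D p - w *: gen e.
have Dp : D p = w *: gen e + q by rewrite addrC subrK.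
have sq : supported S q.
  move=> e' qe'; have [ee'|ee'] := pselect (e = e').
    by case: qe'; rewrite /q -ee' free_coefB free_coefZ free_coef_gen mulr1 subrr.
  have : free_coef e' (D p) <> 0.
    move=> e'0; case: qe'; rewrite /q free_coefB e'0 free_coefZ.
    by rewrite free_coef_gen_neq // mulr0 subrr.
  by move/sDp => -[//|/= /esym].
have wj : w \in homog (dgr_grading A) j.
  have /free_homogP/(_ e) := D_homog pi.
  by move/homog_cast; apply; rewrite /j /n; lia.
(* The conclusion [mb] of the criterion at this pair is, up to sign, the new [pl_bound]. *)
have Gw : G w ((-1) ^+ kap *: (f p - sg *: H q)).
  exists p, q, 0; split=> //; first exact: rpred0.
  by rewrite raddf0 addr0.
have := mb _ _ Gw; rewrite -(rpredZsign _ kap) scalerDr scale_signK.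
suff -> : f p - sg *: ext k' (D p) = f p - sg *: H q + (-1) ^+ kap *: (w *: m) by [].
rewrite Dp free_extD free_extZgen k'e extS // scalerDr opprD addrA addrAC; congr (_ + _).
rewrite (twistE _ wj) !scalerA mulrA -exprD -scaleNr -mulNr; congr (_ * _ *: _).
by apply/esym/sign_oddN; rewrite /kap /j; parity.
Qed.

End Step.

(* Zorn's lemma on the sets [S] of cells closed under differentials. *)
Lemma total_lift : exists k, partial_lift setT k.
Proof.
pose T := {t : set X * (X -> M) | partial_lift t.1 t.2}.
(* Values off the cells are ignored, so this is only a preorder. *)
pose R (t u : T) := `[< forall e, (sval t).1 e ->
  (sval u).1 e /\ (sval u).2 e = (sval t).2 e >].
have t0 : T by exists (set0, fun=> 0); exact: partial_lift0.
have [//|t u v /asboolP tu /asboolP uv|F Ftot|[[S k] Sk] tmax] := @ZL_preorder T t0 R.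
- by move=> t; apply/asboolP.
- apply/asboolP => e te; have [ue <-] := tu e te; have [ve <-] := uv e ue; by split.
(* The empty chain is bounded by the empty lift; otherwise [t1] starts the induction over a finite
   support. *)
- have [[t1 Ft1]|F0] := pselect (exists t, F t); last first.
    by exists t0 => t Ft; case: F0; exists t.
  pose S e := exists2 t, F t & (sval t).1 e.
  have [k kP] : exists k : X -> M, forall e t, F t -> (sval t).1 e -> k e = (sval t).2 e.
    have /choice[k kP] e : exists m, forall t, F t -> (sval t).1 e -> m = (sval t).2 e.
      have [[u Fu ue]|nSe] := pselect (S e); last by exists 0 => t Ft te; case: nSe; exists t.
      exists ((sval u).2 e) => t Ft te.
      by have [/asboolP /(_ e te)[_ ->]|/asboolP /(_ e ue)[_ ->]] := Ftot t u Ft Fu.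
    by exists k => e t Ft te; exact: kP.
  (* Finitely many cells of the union already lie in one member of a totally ordered family. *)
  have supp1 p : supported S p -> exists2 t, F t & supported (sval t).1 p.
    move=> sp; have [s us ps] := dsum_supp p.
    have [t Ft ts] : exists2 t, F t & forall e, (e : {classic X}) \in s -> S e -> (sval t).1 e.
      elim: (s : seq {classic X}) => [|e s' [t Ft ts]]; first by exists t1.
      have [[u Fu ue]|nSe] := pselect (S e); last first.
        by exists t => // e'; rewrite inE => /predU1P[->|/ts].
      have [/asboolP tu|/asboolP ut] := Ftot t u Ft Fu.
        exists u => // e'; rewrite inE => /predU1P[-> //|/ts te' Se'].
        exact: (tu e' (te' Se')).1.
      exists t => // e'; rewrite inE => /predU1P[-> _|/ts //]; exact: (ut e ue).1.
    exists t => // e pe; apply: ts (sp e pe); exact: ps.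
  have extE t p : F t -> supported (sval t).1 p -> ext k p = ext (sval t).2 p.
    by move=> Ft tp; apply: eq_free_ext => e /tp te; exact: kP.
  have Sk : partial_lift S k.
    split.
    - by move=> e [t Ft te] e' be'; exists t => //; exact: pl_closed (svalP t) _ te _ be'.
    - by move=> e [t Ft te]; rewrite (kP e t) //; exact: pl_homog (svalP t) _ te.
    - move=> e [t Ft te]; rewrite (kP e t) // (extE t) //; first exact: pl_diff (svalP t) _ te.
      exact: pl_closed (svalP t) _ te.
    - move=> p pi /supp1[t Ft tp]; rewrite (extE t) //; exact: pl_bound (svalP t) _ pi tp.
  exists (exist _ (S, k) Sk) => t Ft; apply/asboolP => e te /=.
  by split; [exists t | exact: kP].
suff ST : S = setT by exists k; rewrite -ST.
(* By maximality [S] contains every cell whose boundary it supports. *)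
apply/seteqP; split=> // e0 _; apply: bd_wf e0 => e Sbd; apply: contrapT => nSe.
have [k' S'k' k'k] := partial_lift_step Sk nSe Sbd.
have /asboolP/(_ e)[|//] : R (exist _ (_, k') S'k') (exist _ (S, k) Sk).
  by apply: tmax; apply/asboolP => e' Se' /=; split; [left | exact: k'k].
by right.
Qed.

Theorem cellular_lifting : f \in hom_boundary i.
Proof.
have [k kT] := total_lift; have sT (p : P) : supported setT p by [].
apply/hom_boundaryP; exists (ext k).
  split=> [p q|n p pn|n a p an].
  - exact: free_extB.
  - exact: (ext_homog kT (sT p) pn).
  - by rewrite free_extZ (twistE _ an) scalerA.
move=> p; rewrite (ext_diff kT (sT p)) (@sign_oddN _ `|i - 1| `|i|); last lia.
by rewrite scaleNr opprK subrK.
Qed.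

End CellularLifting.

(** * Cellular resolutions *)

(** The recursion of [cell_data] runs through [foldr] to be structural on nested lists; here its
    sums become big operators. *)
Lemma foldr_sum (V : zmodType) (I : Type) (g : I -> V) s :
  foldr (fun u v => g u + v) 0 s = \sum_(u <- s) g u.
Proof. by elim: s => [|u s IHs]; rewrite ?big_nil ?big_cons //= IHs. Qed.

Section CellularResolution.
Variables (A : dgRing) (A_nonpos : nonpositive A) (N : dgModule A).

(* [Cell n s y] is a generator of degree [n] meant to have the differential
   [\sum_(u <- s) u.1 *: u.2] and the image [y] in [N]. *)
Inductive cell := Cell of int & seq (A * cell) & N.

Definition cell_deg (e : cell) : int := let: Cell n _ _ := e in n.
Local Notation F := (free_graded A cell_deg).
Local Notation gen := (free_gen A cell_deg).

Definition cell_chain (s : seq (A * cell)) : F := \sum_(u <- s) u.1 *: gen u.2.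

(* Cells whose data are inconsistent get zero differential and zero image; they
   are harmless, being killed by further cells. *)
Fixpoint cell_data (e : cell) : F * N :=
  let: Cell n s y := e in
  let z := cell_chain s in
  let dz := dgm_diff F z +
    foldr (fun u v => twist 1 u.1 *: (cell_data u.2).1 + v) 0 s in
  let az := foldr (fun u v => u.1 *: (cell_data u.2).2 + v) 0 s in
  if `[< [/\ z \in homog (dgm_grading F) (n + 1), dz = 0,
             y \in homog (dgm_grading N) n & az = dgm_diff N y] >]
  then (z, y) else (0, 0).

Definition cell_bd e := (cell_data e).1.
Definition cell_aug e := (cell_data e).2.
Local Notation aug := (free_ext cell_deg 0 cell_aug).

Definition cell_valid n s y :=
  [/\ cell_chain s \in homog (dgm_grading F) (n + 1),
      free_diff cell_bd (cell_chain s) = 0,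
      y \in homog (dgm_grading N) n & aug (cell_chain s) = dgm_diff N y].

Lemma cell_dataE n s y :
  cell_data (Cell n s y) = if `[< cell_valid n s y >] then (cell_chain s, y) else (0, 0).
Proof.
rewrite /= /cell_valid free_diffE.
have -> : foldr (fun u v => twist 1 u.1 *: (cell_data u.2).1 + v) 0 s =
    free_ext cell_deg 1 cell_bd (cell_chain s).
  rewrite /cell_chain raddf_sum foldr_sum.
  by apply: eq_bigr => u _; rewrite free_extZgen.
suff -> : foldr (fun u v => u.1 *: (cell_data u.2).2 + v) 0 s = aug (cell_chain s) by [].
rewrite /cell_chain raddf_sum foldr_sum.
by apply: eq_bigr => u _; rewrite free_extZgen twist0.
Qed.

Lemma cell_cases e :
  (cell_bd e = 0 /\ cell_aug e = 0) \/
  [/\ cell_bd e \in homog (dgm_grading F) (cell_deg e + 1),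
      free_diff cell_bd (cell_bd e) = 0,
      cell_aug e \in homog (dgm_grading N) (cell_deg e) &
      aug (cell_bd e) = dgm_diff N (cell_aug e)].
Proof.
case: e => n s y; rewrite /cell_bd /cell_aug cell_dataE.
by case: asboolP => [v|_]; [right | left].
Qed.

Lemma cell_bd_homog e : cell_bd e \in homog (dgm_grading F) (cell_deg e + 1).
Proof. by have [[-> _]|[]] := cell_cases e; rewrite ?rpred0. Qed.

Lemma cell_bd_diff e : free_diff cell_bd (cell_bd e) = 0.
Proof. by have [[-> _]|[]] := cell_cases e; rewrite ?raddf0. Qed.

Lemma cell_aug_homog e : cell_aug e \in homog (dgm_grading N) (cell_deg e).
Proof. by have [[_ ->]|[]] := cell_cases e; rewrite ?rpred0. Qed.

Lemma cell_aug_diff e : aug (cell_bd e) = dgm_diff N (cell_aug e).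
Proof. by have [[-> ->]|[]] := cell_cases e; rewrite ?raddf0. Qed.

Fixpoint all_cells (S : set cell) (s : seq (A * cell)) : Prop :=
  if s is u :: s' then S u.2 /\ all_cells S s' else True.

Lemma supported_cell_bd S n s y : all_cells S s -> supported S (cell_bd (Cell n s y)).
Proof.
move=> Ss; rewrite /cell_bd cell_dataE; case: asboolP => _; last exact: supported0.
rewrite /= /cell_chain; elim: s Ss => [_|u s IHs [Su /IHs]].
  by rewrite big_nil; exact: supported0.
rewrite big_cons; apply: supportedD; apply: supportedZ; exact: supported_gen.
Qed.

(** Structural induction on cells, with an inner fixpoint for all cells in the list [s], which
    support the boundary. *)
Lemma cell_bd_wf (S : set cell) :
  (forall e, supported S (cell_bd e) -> S e) -> forall e, S e.
Proof.
move=> SP; exact: (fix IH e : S e := let: Cell n s y := e in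
  SP _ (supported_cell_bd (n := n) (y := y) ((fix aux s : all_cells S s :=
    if s is u :: s' then conj (IH u.2) (aux s') else I) s))).
Qed.

Definition cell_complex : dgModule A := dg_free cell_bd_homog cell_bd_diff.

Definition cell_map : cell_complex -> N := aug.
Fact cell_map_zmod : zmod_morphism cell_map. Proof. exact: raddfB. Qed.
HB.instance Definition _ :=
  GRing.isZmodMorphism.Build cell_complex N cell_map cell_map_zmod.
Fact cell_map_scalable : scalable cell_map.
Proof. by move=> a p; rewrite /cell_map free_extZ twist0. Qed.
HB.instance Definition _ :=
  GRing.isScalable.Build A cell_complex N *:%R cell_map cell_map_scalable.

Fact cell_map_homog i p : p \in homog (dgm_grading cell_complex) i ->
  cell_map p \in homog (dgm_grading N) i.
Proof.
move=> pi; rewrite -[i]add0r; apply: free_ext_homog => // e _.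
by rewrite add0r cell_aug_homog.
Qed.

Fact cell_map_diff p : cell_map (dgm_diff cell_complex p) = dgm_diff N (cell_map p).
Proof.
rewrite /cell_map -[dgm_diff cell_complex p]/(free_diff cell_bd p).
elim/free_ind: p => [|p q pP qP|a e].
- by rewrite !raddf0.
- by rewrite (free_diffD cell_bd) !free_extD pP qP raddfD.
rewrite free_diffZ free_extD !free_extZ free_diff_gen cell_aug_diff free_ext_gen.
by rewrite !twist0 dgm_leibniz_twist.
Qed.

Definition cell_hom : dgHom cell_complex N :=
  DGHom (dgh_fun := cell_map) cell_map_homog cell_map_diff.

(** No stages are needed because a cell exists for every chain: a cocycle [p] with image
    [dgm_diff N y] is the differential of the cell made of an expansion of [p] and of [y], and a
    cocycle [y] of [N] is the image of a cell with empty boundary. *)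
Lemma cell_hom_quasi_iso : quasi_iso cell_hom.
Proof.
apply/quasi_isoP => n; split=> [p /cocycleP[pn dp] /boundaryP[y yn py]|y /cocycleP[yn dy]].
  have [s ps] := free_expand p.
  have v : cell_valid (n - 1) s y.
    by split; rewrite /cell_chain -?ps ?subrK.
  apply/boundaryP; exists (gen (Cell (n - 1) s y)).
    exact: (free_gen_homog A cell_deg (Cell (n - 1) s y)).
  rewrite [RHS]free_diff_gen /cell_bd cell_dataE asboolT //=.
have v : cell_valid n [::] y.
  by split; rewrite // /cell_chain big_nil ?rpred0 ?raddf0.
exists (gen (Cell n [::] y)); last first.
  rewrite [cell_hom _]free_ext_gen /cell_aug cell_dataE asboolT //= subrr; exact: rpred0.
apply/cocycleP; split; first exact: (free_gen_homog A cell_deg (Cell n [::] y)).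
by rewrite [LHS]free_diff_gen /cell_bd cell_dataE asboolT //= /cell_chain big_nil.
Qed.

Lemma cell_complex_K_projective : K_projective cell_complex.
Proof.
move=> C acC i; apply/trivial_hom_cohomologyP => f fZ.
apply: (cellular_lifting A_nonpos cell_bd_wf (acyclic_criterion acC) fZ) => p /cocycleP[pi dp].
apply: (trivial_cohomologyP C 0).1 => //; have /hom_cocycleP[fn df] := fZ.
have f0 : f 0 = 0 by rewrite -(subrr 0) (hom_degreeB fn) subrr.
apply/cocycleP; split; last by rewrite df dp f0 scaler0.
by rewrite -(subrr i); exact: hom_degree_homog fn _ _ pi.
Qed.

Definition cell_resolution : K_projective_resolution N :=
  KProjRes cell_complex_K_projective cell_hom_quasi_iso.

(** Only [H^{-i}(N)] matters, as for maps into an injective module: cocycles of degree [-i] in the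
    resolution are boundaries, so [f] sends them to boundaries. *)
Lemma criterion_Ext_vanishes (M : dgModule A) (i : int) : injectivity_criterion M ->
  trivial_zmod (cohomology N (- i)) -> Ext_vanishes N M i.
Proof.
move=> critM HN; exists cell_resolution; apply/trivial_hom_cohomologyP => f fZ.
apply: (cellular_lifting A_nonpos cell_bd_wf critM fZ) => p pZ.
have pB : p \in boundary cell_complex (- i).
  apply: ((quasi_isoP cell_hom).1 cell_hom_quasi_iso (- i)).1 => //.
  by apply: (trivial_cohomologyP N _).1 => //; exact: dgh_cocycle.
have /boundaryP[q qi ->] := pB; have /hom_cocycleP[fn df] := fZ.
apply/boundaryP; exists ((-1) ^+ `|i| *: f q).
  by rewrite rpredZsign; apply: homog_cast (hom_degree_homog fn qi) _; lia.
by rewrite raddfZsign /= df scale_signK.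
Qed.

End CellularResolution.

(* The direct sum of the cone of [id : A -> A] and of [M] shifted by [1 - j]; [e] stands
   for [`|1 - j|]. *)
Section ConeAmbient.
Variables (A : dgRing) (M : dgModule A) (e : nat) (j : int).
Local Notation cA := (component (dgr_grading A)).
Local Notation cM := (component (dgm_grading M)).

(** The parameters do not enter the carrier; they keep the module structures for different signs
    apart. *)
Definition cone_car of nat & int : Type := (A * M * A)%type.
Local Notation car := (cone_car e j).
HB.instance Definition _ := GRing.Zmodule.on car.

Implicit Types u v : car.

(** The twists are the signs of the shifts: in total degree [n], [w] has degree [n + 1] and [x] has
    degree [n + (1 - j)]. *)
Definition cone_scale (b : A) u : car :=
  (twist 1 b * u.1.1, twist e b *: u.1.2, b * u.2).

Fact cone_scaleA b b' u : cone_scale b (cone_scale b' u) = cone_scale (b * b') u.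
Proof. by rewrite /cone_scale /= !twistM !mulrA scalerA. Qed.
Fact cone_scale1 : left_id 1 cone_scale.
Proof. by case=> [[w x] a]; rewrite /cone_scale /= !twist1 !mul1r scale1r. Qed.
Fact cone_scaleDr : right_distributive cone_scale +%R.
Proof. by move=> b u v; rewrite /cone_scale /= !mulrDr scalerDr. Qed.
Fact cone_scaleDl u : {morph cone_scale^~ u : b b' / b + b'}.
Proof. by move=> b b'; rewrite /cone_scale !raddfD /= !mulrDl scalerDl. Qed.
HB.instance Definition _ := GRing.Zmodule_isLmodule.Build A car
  cone_scaleA cone_scale1 cone_scaleDr cone_scaleDl.

Definition cone_component_fun (n : int) u : car :=
  (cA (n + 1) u.1.1, cM (n + (1 - j)) u.1.2, cA (n + 0) u.2).
Fact cone_component_zmod n : zmod_morphism (cone_component_fun n).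
Proof. by move=> u v; rewrite /cone_component_fun /= !raddfB. Qed.
HB.instance Definition _ n :=
  GRing.isZmodMorphism.Build car car (cone_component_fun n) (cone_component_zmod n).
Definition cone_component n : {additive car -> car} := cone_component_fun n.

Fact cone_componentK m n u : cone_component m (cone_component n u) =
  if m == n then cone_component n u else 0.
Proof.
rewrite /= /cone_component_fun /= !componentK !(inj_eq (addIr _)).
by case: eqP.
Qed.

Lemma cone_sumE (s : seq int) (F : int -> car) : \sum_(n <- s) F n =
  (\sum_(n <- s) (F n).1.1, \sum_(n <- s) (F n).1.2, \sum_(n <- s) (F n).2).
Proof. by elim: s => [|n s IHs]; rewrite ?big_nil // !big_cons IHs. Qed.

Fact cone_component_sum u : exists2 s : seq int,
  uniq s & u = \sum_(n <- s) cone_component n u.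
Proof.
have [s1 p1] := grading_bound (dgr_grading A) u.1.1.
have [s2 p2] := grading_bound (dgm_grading M) u.1.2.
have [s3 p3] := grading_bound (dgr_grading A) u.2.
pose s := undup ([seq n - 1 | n <- s1] ++ [seq n - (1 - j) | n <- s2] ++ [seq n - 0 | n <- s3]).
exists s; first exact: undup_uniq.
have sub (k : int) t (n : int) : n + k \in t -> n \in [seq m - k | m <- t].
  by move=> nt; apply/mapP; exists (n + k); rewrite ?addrK.
rewrite cone_sumE; case: u p1 p2 p3 => [[w x] a] /= p1 p2 p3; congr (_, _, _);
  apply: component_sum_sub (undup_uniq _) _ => n.
- by move=> /p1/sub nt; rewrite mem_undup !mem_cat nt.
- by move=> /p2/sub nt; rewrite mem_undup !mem_cat nt orbT.
- by move=> /p3/sub nt; rewrite mem_undup !mem_cat nt !orbT.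
Qed.

Definition cone_grading : grading car := Grading cone_componentK cone_component_sum.

Lemma cone_homogP n u : reflect
  [/\ u.1.1 \in homog (dgr_grading A) (n + 1),
      u.1.2 \in homog (dgm_grading M) (n + (1 - j)) & u.2 \in homog (dgr_grading A) n]
  (u \in homog cone_grading n).
Proof.
apply: (iffP eqP) => [uE|[]].
  by rewrite -uE /= /cone_component_fun /= addr0; split; exact: component_homog.
case: u => [[w x] a] /= /homogP wn /homogP xn /homogP an.
by rewrite /cone_component_fun /= wn xn addr0 an.
Qed.

Definition cone_diff_fun u : car :=
  (- dgr_diff A u.1.1, (-1) ^+ e *: dgm_diff M u.1.2, dgr_diff A u.2 + u.1.1).
Fact cone_diff_zmod : zmod_morphism cone_diff_fun.
Proof.
move=> u v; congr (_, _, _) => /=.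
- by rewrite !raddfB.
- by rewrite !raddfB.
by rewrite raddfB opprD addrACA.
Qed.
HB.instance Definition _ :=
  GRing.isZmodMorphism.Build car car cone_diff_fun cone_diff_zmod.

Definition cone_ambient : dgModule A.
Proof.
apply: (@DGModule A car cone_grading cone_diff_fun).
- move=> i k b u bi /cone_homogP[wk xk ak]; apply/cone_homogP; split.
  + by rewrite -addrA; exact: dgr_homogM (twist_homog 1 bi) wk.
  + by rewrite -addrA; exact: dgm_homogZ (twist_homog e bi) xk.
  + exact: dgr_homogM bi ak.
- move=> i u /cone_homogP[wi xi ai]; apply/cone_homogP; split=> /=.
  + by rewrite rpredN; exact: dgr_diff_homog.
  + by rewrite rpredZsign addrAC; exact: dgm_diff_homog.
  + by rewrite rpredD //; exact: dgr_diff_homog.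
- move=> [[w x] a]; rewrite /= /cone_diff_fun /= raddfN raddfZsign raddfD /=.
  by rewrite !dgr_diff_diff dgm_diff_diff !scaler0 add0r subrr !oppr0.
- move=> i b u bi; have -> : (-1) ^+ `|i| *: (b *: cone_diff_fun u) = twist 1 b *: cone_diff_fun u.
    by rewrite scalerA (twistE _ bi) mul1n.
  case: u => [[w x] a]; rewrite /= /cone_diff_fun /=.
  congr (_, _, _) => /=.
  + by rewrite dgr_leibniz_twist twist_diff expr1 mulN1r mulNr mulrN opprD.
  + rewrite dgm_leibniz_twist twist_diff scalerDr scaler_signC !scalerA.
    by rewrite !twist_twist addnC.
  + by rewrite dgr_leibniz_twist mulrDr addrA.
Defined.

End ConeAmbient.

Section LiftingProblemFacts.
Variables (A : dgRing) (M : dgModule A) (j : int) (c : M) (G : A -> M -> Prop).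
Hypothesis GP : lifting_problem j c G.

Lemma lp0 : G 0 0.
Proof. by have := lp_diffr GP (rpred0 (homog (dgm_grading M) (0 - 1))); rewrite raddf0. Qed.

Lemma lpN w x : G w x -> G (- w) (- x).
Proof. by move=> Gwx; have := lp_sub GP lp0 Gwx; rewrite !sub0r. Qed.

Lemma lpD w x w' x' : G w x -> G w' x' -> G (w + w') (x + x').
Proof. by move=> Gwx /lpN Gwx'; have := lp_sub GP Gwx Gwx'; rewrite !opprK. Qed.

End LiftingProblemFacts.

(** * The test module of a lifting problem *)

Section TestModule.
Variables (A : dgRing) (A_nonpos : nonpositive A) (M : dgModule A).
Variables (j : int) (c : M) (G : A -> M -> Prop) (GP : lifting_problem j c G).
Local Notation cA := (component (dgr_grading A)).
Local Notation cM := (component (dgm_grading M)).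
Let e : nat := `|1 - j|.
Local Notation B := (cone_ambient M e j).

Let ch : c \in homog (dgm_grading M) (1 - j).
Proof. by have /cocycleP[] := lp_cocycle GP. Qed.
Let dc : dgm_diff M c = 0.
Proof. by have /cocycleP[] := lp_cocycle GP. Qed.

(* The cone of [L -> A], where [L -> A^{<j} + W] is the quasi-isomorphism whose fibre
   over [w] in [W] is [{x | G w x}]. After the change of variable
   [x |-> x + twist e a *: c], the map to [M] read off from [G] is the plain
   projection [(w, x, a) |-> x]. *)
Definition test_condition (u : B) : Prop :=
  G (cA j u.1.1) (cM 0 u.1.2 - twist e (cA (j - 1) u.2) *: c) /\
  forall l : int, 0 < l ->
    cA (j + l) u.1.1 = 0 /\ cM l u.1.2 = twist e (cA (j - 1 + l) u.2) *: c.

Definition test_pred : {pred B} := [pred u | `[< test_condition u >]].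

Lemma test_condition0 : test_condition 0.
Proof.
split; first by rewrite !raddf0 scale0r subr0; exact: lp0 GP.
by move=> l _; rewrite !raddf0 scale0r.
Qed.

Lemma test_conditionD u v : test_condition u -> test_condition v -> test_condition (u + v).
Proof.
move=> [Gu hu] [Gv hv]; split=> [|l l0].
  by rewrite !raddfD /= scalerDl opprD addrACA; exact: (lpD GP Gu Gv).
have [[uw ux] [vw vx]] := (hu l l0, hv l l0).
by rewrite !raddfD /= scalerDl uw vw ux vx addr0.
Qed.

Lemma test_conditionZ (b : A) u : test_condition u -> test_condition (b *: u).
Proof.
move: b; apply: (@homog_ind _ (dgr_grading A)) => [|b b' Pb Pb' cu|i b bi [Gu hu]].
- by rewrite scale0r => _; exact: test_condition0.
- by rewrite scalerDl; apply: test_conditionD; [exact: Pb | exact: Pb'].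
have [i0|i0] := ltP 0 i.
  by rewrite (A_nonpos i0 bi) scale0r; exact: test_condition0.
have cw n : cA n (b *: u).1.1 = twist 1 b * cA (n - i) u.1.1.
  exact: component_mul (twist_homog _ bi).
have cx n : cM n (b *: u).1.2 = twist e b *: cM (n - i) u.1.2.
  exact: component_scale (twist_homog _ bi).
have ca n : cA n (b *: u).2 = b * cA (n - i) u.2 by exact: component_mul.
split=> [|l l0]; last first.
  rewrite cw cx ca twistM -scalerA.
  have [|hw hx] := hu (l - i); first by lia.
  by rewrite -addrA hw mulr0 hx; split=> //; congr (_ *: (twist _ (cA _ _) *: _)); lia.
rewrite cw cx ca twistM -scalerA -scalerBr.
(* A scalar of negative degree takes the part over degree [j] from above [j], where the condition is
   rigid; the pair becomes [(0, 0)]. *)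
have [i00|i00] := eqVneq i 0; last first.
  have [|hw hx] := hu (- i); first by lia.
  rewrite hw mulr0 sub0r hx addrAC subrr scaler0; exact: lp0 GP.
rewrite i00 in bi *; rewrite !subr0 !(twist_homog0 _ bi).
exact: (lp_scale GP bi Gu).
Qed.

Fact test_pred_submod_closed : GRing.subsemimod_closed test_pred.
Proof.
split; first split.
- exact/asboolP/test_condition0.
- by move=> u v /asboolP cu /asboolP cv; exact/asboolP/test_conditionD.
by move=> b u /asboolP cu; exact/asboolP/test_conditionZ.
Qed.
HB.instance Definition _ := GRing.isSubmodClosed.Build A B test_pred test_pred_submod_closed.

Fact test_pred_component n u : u \in test_pred -> component (dgm_grading B) n u \in test_pred.
Proof.
move=> /asboolP[Gu hu]; apply/asboolP; rewrite /test_condition /= /cone_component_fun /= addr0.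
split=> [|l l0].
  rewrite !componentK.
  have -> : (j == n + 1) = (j - 1 == n) by apply/eqP/eqP; lia.
  have -> : (0 == n + (1 - j)) = (j - 1 == n) by apply/eqP/eqP; lia.
  case: eqP => [<-|_]; last by rewrite raddf0 scale0r subr0; exact: lp0 GP.
  have -> : j - 1 + 1 = j by lia.
  by have -> : j - 1 + (1 - j) = 0 by lia.
rewrite !componentK.
have -> : (j + l == n + 1) = (j - 1 + l == n) by apply/eqP/eqP; lia.
have -> : (l == n + (1 - j)) = (j - 1 + l == n) by apply/eqP/eqP; lia.
case: eqP => [<-|_]; last by rewrite raddf0 scale0r.
have -> : j - 1 + l + 1 = j + l by lia.
have -> : j - 1 + l + (1 - j) = l by lia.
exact: hu.
Qed.

Lemma diff_twist_scale a : dgm_diff M (twist e a *: c) = (-1) ^+ e *: (twist e (dgr_diff A a) *: c).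
Proof.
rewrite dgm_leibniz_twist dc scaler0 addr0 twist_diff -scalerA.
by rewrite scale_signK.
Qed.

Fact test_pred_diff u : u \in test_pred -> dgm_diff B u \in test_pred.
Proof.
case: u => [[w x] a] /asboolP[Gu hu]; rewrite /= in Gu hu; apply/asboolP.
have Gd a' : a' \in homog (dgr_grading A) (j - 1) ->
    G (dgr_diff A a') (twist e a' *: c).
  move=> ah; have := lp_diffl GP ah; congr (G _ _).
  by rewrite (twistE _ ah) -scalerA; congr (_ *: _); apply: sign_odd; rewrite /e; parity.
split=> [|l l0] /=.
  rewrite raddfN raddfZsign raddfD /= !component_dgr_diff component_diff.
  set a' := dgr_diff A _ + _.
  have a'h : a' \in homog (dgr_grading A) (j - 1).
    rewrite rpredD ?component_homog //.
    by apply: homog_cast (dgr_diff_homog (component_homog _ _ _)) _; lia.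
  have da' : dgr_diff A a' = dgr_diff A (cA (j - 1) w).
    by rewrite raddfD /= dgr_diff_diff add0r.
  have yh : (-1) ^+ e *: cM (0 - 1) x \in homog (dgm_grading M) (0 - 1).
    by rewrite rpredZsign component_homog.
  have := lpD GP (lp_diffr GP yh) (lpN GP (Gd a' a'h)).
  by rewrite add0r da' raddfZsign.
rewrite raddfN raddfZsign raddfD /= !component_dgr_diff component_diff.
(* Here the differential leads from the degree governed by [G] into the rigid range; that it lands
   there is [lp_dom]. *)
have [l1|l1] := eqVneq l 1.
  have [_] := lp_homog GP Gu; have [dw dx] := lp_dom GP Gu; move: dw dx.
  have -> : j + l - 1 = j by lia.
  have -> : j - 1 + l - 1 = j - 1 by lia.
  have -> : j - 1 + l = j by lia.
  have -> : l - 1 = 0 by lia.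
  move=> -> dx _; rewrite oppr0; split=> //.
  have -> : cM 0 x = (cM 0 x - twist e (cA (j - 1) a) *: c) + twist e (cA (j - 1) a) *: c.
    by rewrite subrK.
  rewrite raddfD /= diff_twist_scale dx -/e -scalerDr scale_signK.
  rewrite raddfD /= scalerDl addrC; congr (_ + _ *: _).
  rewrite (twistE _ (component_homog _ _ _)) -[LHS]mul1r -[1](expr0 (-1)).
  by congr (_ * _); apply: sign_odd; rewrite /e; parity.
have [|hw hx] := hu (l - 1); first by lia.
have -> : j + l - 1 = j + (l - 1) by lia.
have -> : j - 1 + l - 1 = j - 1 + (l - 1) by lia.
have -> : j - 1 + l = j + (l - 1) by lia.
by rewrite hw hx !raddf0 addr0 diff_twist_scale scale_signK.
Qed.

Definition test_module : dgModule A := dg_sub test_pred_component test_pred_diff.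
Local Notation N := test_module.

Definition test_val (u : N) : B := val u.

Lemma test_homogE n (u : N) :
  (u \in homog (dgm_grading N) n) = (test_val u \in homog (dgm_grading B) n).
Proof. by []. Qed.

Lemma test_diffE (u : N) : test_val (dgm_diff N u) = dgm_diff B (test_val u).
Proof. by []. Qed.

Lemma testP (u : N) : test_condition (test_val u).
Proof. by have /asboolP := valP u. Qed.

Definition test_elem (u : B) (cu : test_condition u) : N :=
  DGSub (S := test_pred) (introT (asboolP _) cu).

Lemma test_elemK u cu : test_val (@test_elem u cu) = u. Proof. by []. Qed.

Lemma test_val_inj : injective test_val. Proof. exact: val_inj. Qed.

(** In homogeneous terms: no condition below degree [j - 1], the relation in degree [j - 1], and
    only [a] is free above. *)
Lemma test_conditionP n u : u \in homog (dgm_grading B) n -> test_condition u <->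
  (n + 1 = j -> G u.1.1 (u.1.2 - twist e u.2 *: c)) /\
  (j < n + 1 -> u.1.1 = 0 /\ u.1.2 = twist e u.2 *: c).
Proof.
move=> /cone_homogP[wn xn an]; split=> [[Gu hu]|[Gu hu]].
  split=> nj.
    move: Gu; rewrite (component_homogE _ wn) (component_homogE _ xn) (component_homogE _ an).
    by rewrite -nj addrK eqxx (_ : 0 == _) ?eqxx //; apply/eqP; lia.
  have [|] := hu (n + 1 - j); first by lia.
  have -> : j + (n + 1 - j) = n + 1 by lia.
  have -> : j - 1 + (n + 1 - j) = n by lia.
  have -> : n + 1 - j = n + (1 - j) by lia.
  by move/homogP: wn => ->; move/homogP: xn => ->; move/homogP: an => ->.
split=> [|l l0].
  rewrite (component_homogE _ wn) (component_homogE _ xn) (component_homogE _ an).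
  have -> : (j - 1 == n) = (j == n + 1) by apply/eqP/eqP; lia.
  have -> : (0 == n + (1 - j)) = (j == n + 1) by apply/eqP/eqP; lia.
  case: eqP => [nj|_]; first exact: Gu.
  by rewrite raddf0 scale0r subr0; exact: lp0 GP.
rewrite (component_homogE _ wn) (component_homogE _ xn) (component_homogE _ an).
have -> : (j - 1 + l == n) = (j + l == n + 1) by apply/eqP/eqP; lia.
have -> : (l == n + (1 - j)) = (j + l == n + 1) by apply/eqP/eqP; lia.
case: eqP => [nj|_]; first by apply: hu; lia.
by rewrite raddf0 scale0r.
Qed.

End TestModule.

Section TestModuleLifting.
Variables (A : dgRing) (A_nonpos : nonpositive A) (M : dgModule A).
Variables (j : int) (c : M) (G : A -> M -> Prop) (GP : lifting_problem j c G).
Let e : nat := `|1 - j|.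
Local Notation B := (cone_ambient M e j).
Local Notation N := (test_module A_nonpos GP).
Local Notation tval := (@test_val A A_nonpos M j c G GP).
Local Notation telem := (@test_elem A A_nonpos M j c G GP _).

Lemma twist_parity p i (a : A) : a \in homog (dgr_grading A) i ->
  odd p && odd `|i| = false -> twist p a = a.
Proof.
move=> ai pi; rewrite (twistE _ ai) -[RHS]mul1r -[1 in RHS](expr0 (-1)).
by congr (_ * _); apply: sign_odd; rewrite oddM pi.
Qed.

(** In a cocycle [(w, x, a)] one has [w = - da], and [x] is a cocycle, of negative degree unless
    [k = j - 1]. Once [x] is a boundary, [a] and a signed primitive of [x] form a primitive
    [(a, x1, 0)]. *)
Lemma test_cohomology_low k : (forall n : int, n < 0 -> trivial_zmod (cohomology M n)) ->
  k < j -> (k = j - 1 -> forall x, G 0 x -> x \in boundary M 0) ->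
  trivial_zmod (cohomology N k).
Proof.
move=> Mlow kj Gb; apply/trivial_cohomologyP => u /cocycleP[uk du].
have ub : tval u \in homog (dgm_grading B) k by rewrite -test_homogE.
have := (test_conditionP GP ub).1 (testP u).
have := congr1 tval du; rewrite test_diffE.
have /cone_homogP[] := ub.
case uE: (tval u) => [[w x] a] /= wk xk ak [dw dx da] [Gu _].
have {}dx : dgm_diff M x = 0 by rewrite -[LHS](scale_signK e) [X in _ *: X]dx scaler0.
have {}da : dgr_diff A a = - w by apply/eqP; rewrite -addr_eq0; apply/eqP.
have xB : x \in boundary M (k + (1 - j)).
  have [kj1|kj1] := eqVneq k (j - 1); last first.
    by apply: (trivial_cohomologyP M _).1; [apply: Mlow; lia | apply/cocycleP].
  have -> : k + (1 - j) = 0 by lia.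
  (* Adding the pair that [lp_diffl] gives at [a] cancels [w = - da] and leaves [G 0 x]. *)
  apply: (Gb kj1); have := Gu _; rewrite kj1 subrK => /(_ erefl) Gwx.
  rewrite kj1 in ak; have := lpD GP Gwx (lp_diffl GP ak).
  rewrite da subrr; congr (G 0 _).
  rewrite -[X in _ = X]addr0 -addrA; congr (_ + _); apply/eqP.
  rewrite addrC subr_eq0 (twistE _ ak) -scalerA; apply/eqP; congr (_ *: _).
  by apply: sign_odd; rewrite /e; parity.
have /boundaryP[x1 x1h xE] := xB.
have vh : ((a, (-1) ^+ e *: x1, 0) : B) \in homog (dgm_grading B) (k - 1).
  apply/cone_homogP; split=> /=; rewrite ?rpred0 //.
    by apply: homog_cast ak _; lia.
  by rewrite rpredZsign; apply: homog_cast x1h _; lia.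
(* The degree [k - 1] is below [j - 1], where nothing is required. *)
have cv : test_condition c G ((a, (-1) ^+ e *: x1, 0) : B).
  by apply/(test_conditionP GP vh); move: kj; clear; split; lia.
apply/boundaryP; exists (telem cv); first exact: vh.
apply: test_val_inj; rewrite uE test_diffE test_elemK /=.
by rewrite /cone_diff_fun /= raddf0 add0r da opprK raddfZsign /= scale_signK xE.
Qed.

(** From degree [j] on an element is determined by [a], and [A] vanishes in positive degrees. *)
Lemma test_homog_high k (u : N) : 0 < k -> j <= k -> u \in homog (dgm_grading N) k -> u = 0.
Proof.
move=> k0 jk uk; have ub : tval u \in homog (dgm_grading B) k by rewrite -test_homogE.
have := (test_conditionP GP ub).1 (testP u).
have /cone_homogP[] := ub.
case uE: (tval u) => [[w x] a] /= wk xk ak [_ []]; first by lia.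
move=> w0 xE; apply: test_val_inj; rewrite uE w0 xE (A_nonpos k0 ak).
by rewrite raddf0 scale0r.
Qed.

Lemma test_bounded : (forall n : int, n < 0 -> trivial_zmod (cohomology M n)) ->
  cohomologically_bounded N.
Proof.
move=> Mlow; exists (j - 1), `|j|%:Z => k [kj|kj].
  by apply: test_cohomology_low => //; lia.
apply/trivial_cohomologyP => u /cocycleP[uk _].
by rewrite (test_homog_high _ _ uk) ?rpred0 //; lia.
Qed.

Let ch : c \in homog (dgm_grading M) (1 - j).
Proof. by have /cocycleP[] := lp_cocycle GP. Qed.
Let dc : dgm_diff M c = 0.
Proof. by have /cocycleP[] := lp_cocycle GP. Qed.

Definition test_proj (u : N) : M := (tval u).1.2.

Lemma test_proj_homog i (u : N) : u \in homog (dgm_grading N) i ->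
  test_proj u \in homog (dgm_grading M) (i + (1 - j)).
Proof.
by rewrite test_homogE => /cone_homogP[].
Qed.

Lemma test_proj_diff u : test_proj (dgm_diff N u) = (-1) ^+ e *: dgm_diff M (test_proj u).
Proof. by []. Qed.

Lemma test_projD : {morph test_proj : u v / u + v}. Proof. by []. Qed.
Lemma test_projZ a u : test_proj (a *: u) = twist e a *: test_proj u. Proof. by []. Qed.

(* If [test_proj \o s = delta h] and [p] lifts the unit [(0, c, 1)] up to the boundary
   of [y], the solution is [h p - (-1) ^+ e *: test_proj y]. *)
Lemma test_lifting (P : dgModule A) (s : dgHom P N) : quasi_iso s ->
  trivial_zmod (hom_cohomology P M (1 - j)) ->
  exists m, [/\ m \in homog (dgm_grading M) (- j), dgm_diff M m = c &
    trivial_zmod (cohomology N (j - 1)) ->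
    forall w x, G w x -> x + w *: m \in boundary M 0].
Proof.
move=> /quasi_isoP qs /trivial_hom_cohomologyP vP.
have /vP/hom_boundaryP[h hn fE] : (test_proj \o s : P -> M) \in hom_cocycle (1 - j).
  apply/hom_cocycleP; split; last first.
    by move=> q; rewrite /= dgh_diff test_proj_diff scale_signK.
  split=> [q q'|i q qi|i a q ai] /=.
  - by rewrite raddfB.
  - by apply: homog_cast (test_proj_homog (dgh_homog s qi)) _; clear; lia.
  - by rewrite linearZ /= test_projZ (twistE _ ai) scalerA.
have hB := hom_degreeB hn.
have h0 : h 0 = 0 by rewrite -(subrr 0) hB subrr.
pose u0 : B := (0, c, 1).
have u0h : u0 \in homog (dgm_grading B) 0.
  by apply/cone_homogP; split; rewrite ?rpred0 ?dgr_homog1 //= add0r.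
have cu0 : test_condition c G u0.
  apply/(test_conditionP GP u0h); split=> /= _; rewrite twist1 scale1r ?subrr //.
  exact: lp0 GP.
have u0Z : telem cu0 \in cocycle N 0.
  apply/cocycleP; split; first exact: u0h.
  apply: test_val_inj; rewrite test_diffE test_elemK /= /cone_diff_fun /=.
  by rewrite raddf0 dgr_diff1 dc scaler0 addr0 oppr0.
have [p pZ /boundaryP[y yh spE]] := (qs 0).2 _ u0Z.
have /cocycleP[ph dp] := pZ.
have {}spE : s p = telem cu0 + dgm_diff N y by rewrite -spE addrC subrK.
have projp : c + (-1) ^+ e *: dgm_diff M (test_proj y) = dgm_diff M (h p).
  by have := fE p; rewrite /= spE test_projD test_proj_diff dp h0 scaler0 subr0.
exists (h p - (-1) ^+ e *: test_proj y); split.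
- rewrite rpredB ?rpredZsign //.
    by apply: homog_cast (hom_degree_homog hn ph) _; clear; lia.
  by apply: homog_cast (test_proj_homog yh) _; clear; lia.
- by rewrite raddfB raddfZsign /= -projp addrK.
move=> HN w x Gwx.
have [wj x0] := lp_homog GP Gwx; have [dw dx] := lp_dom GP Gwx.
have vh : ((w, x, 0) : B) \in homog (dgm_grading B) (j - 1).
  apply/cone_homogP; split; rewrite /= ?rpred0 ?subrK //.
  by apply: homog_cast x0 _; clear; lia.
have cv : test_condition c G ((w, x, 0) : B).
  apply/(test_conditionP GP vh); rewrite /= raddf0 scale0r subr0.
  by split=> //; clear; lia.
(* The pair [(w, x)] bounds [w] times the unit, so [w *: p] bounds in [N] and hence in [P]. *)
have dv : dgm_diff N (telem cv) = w *: telem cu0.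
  apply: test_val_inj; rewrite test_diffE test_elemK /= /cone_diff_fun /= dw dx.
  rewrite oppr0 raddf0 add0r -/e scale_signK.
  have -> : tval (w *: telem cu0) = (twist 1 w * 0, twist e w *: c, w * 1) by [].
  by rewrite mulr0 mulr1 (twist_parity wj) // /e; parity.
have dtw : dgr_diff A (twist 1 w) = 0.
  have := twist_diff 1 w; rewrite dw raddf0 expr1 mulN1r => /esym/eqP.
  by rewrite oppr_eq0 => /eqP.
have swp : s (w *: p) = dgm_diff N (telem cv + twist 1 w *: y).
  have wy : w *: dgm_diff N y = dgm_diff N (twist 1 w *: y).
    by rewrite dgm_leibniz_twist dtw scale0r add0r twist1K.
  have -> : s (w *: p) = w *: s p by exact: linearZ.
  by rewrite spE scalerDr -dv wy raddfD.
have tyh : twist 1 w *: y \in homog (dgm_grading N) (j - 1).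
  exact: dgm_homogZ (twist_homog 1 wj) yh.
have vyh : telem cv + twist 1 w *: y \in homog (dgm_grading N) (j - 1).
  by rewrite rpredD.
have wpZ : w *: p \in cocycle P j.
  apply/cocycleP; split; first by rewrite -[j]addr0 dgm_homogZ.
  by rewrite dgm_leibniz_twist dw dp scale0r scaler0 addr0.
have /boundaryP[q qh wpE] : w *: p \in boundary P j.
  apply: (qs j).1 => //; rewrite swp; apply/boundaryP; by exists (telem cv + twist 1 w *: y).
(* Two primitives of [s (w *: p)] differ by a cocycle of degree [j - 1], which bounds by [HN]. *)
have : s q - (telem cv + twist 1 w *: y) \in cocycle N (j - 1).
  apply/cocycleP; split; first exact: rpredB (dgh_homog s qh) vyh.
  by rewrite raddfB -dgh_diff -wpE swp subrr.
move=> /((trivial_cohomologyP N _).1 HN)/boundaryP[r rh rE].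
have sqE : s q = telem cv + twist 1 w *: y + dgm_diff N r by rewrite -rE addrC subrK.
(* The homotopy formula at [q] exhibits [x + w *: m] as a boundary. *)
have := fE q; rewrite /= sqE !test_projD test_projZ test_proj_diff -wpE.
rewrite (hom_degree_twist _ _ hn) scalerA (_ : _ * twist _ w = w); last first.
  by rewrite (twistE _ wj) mulrA -exprD -[RHS]mul1r -[1 in RHS](expr0 (-1));
    congr (_ * _); apply: sign_odd; parity.
rewrite twist_twist (_ : twist _ w = - ((-1) ^+ e * w)); last first.
  by rewrite (twistE _ wj) -mulNr; congr (_ * _); apply: sign_oddN; rewrite /e; parity.
rewrite scaleNr => /(canRL (addrK _)) E.
apply/boundaryP; exists (h q - (-1) ^+ e *: test_proj r).
  rewrite rpredB ?rpredZsign //.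
    by apply: homog_cast (hom_degree_homog hn qh) _; clear; lia.
  by apply: homog_cast (test_proj_homog rh) _; clear; lia.
rewrite scalerBr scalerA commr_sign addrCA E raddfB (raddfZsign (dgm_diff M)) /=.
by rewrite addrA [w *: h p + _]addrC subrK.
Qed.

End TestModuleLifting.

(** * Injective DG-modules and the criterion *)

Section IntInf.
Local Open Scope classical_set_scope.
Implicit Types (S : set int) (x n : int).

Lemma int_inf_eqP S x :
  int_inf S = x%:E <-> S x /\ forall n, S n -> x <= n.
Proof.
rewrite /int_inf; split=> [|[Sx xmin]].
  rewrite /infimum; case: ifPn => // _; case: xgetP => // y -> [lb ub] yx.
  rewrite yx in lb ub.
  have xmin n : S n -> x <= n by move=> Sn; rewrite -lee_fin; apply: lb; exists n.
  split=> //; apply: contrapT => nSx.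
  (* If [x] were not attained, [x + 1] would still be a lower bound. *)
  have : ((x + 1)%:E <= x%:E)%E.
    apply: ub => _ [n Sn <-]; rewrite lee_fin; have := xmin n Sn.
    by have [xn|] := eqVneq x n; [case: nSx; rewrite xn | lia].
  by rewrite lee_fin; lia.
rewrite /infimum ifF; last by apply/negbTE/set0P; exists x%:E, x.
have infx : infimums (EFin @` S) x%:E.
  by split=> [_ [n Sn <-]|y]; [rewrite lee_fin xmin | apply; exists x].
by case: xgetP => [y _ infy|/(_ x%:E) //]; exact: is_subset1_infimums infy infx.
Qed.

Lemma int_inf_set0 S : (forall n, ~ S n) -> int_inf S = +oo%E.
Proof.
move=> S0; rewrite /int_inf /infimum ifT //; apply/eqP/seteqP.
by split=> // y [n /S0].
Qed.

Lemma int_min_exists S (b : int) : (exists n, S n) -> (forall n, S n -> b <= n) ->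
  exists2 x, S x & forall n, S n -> x <= n.
Proof.
move=> [n Sn] Sb.
have exk : exists k : nat, `[< S (b + k%:Z) >].
  by exists `|n - b|%N; apply/asboolP; have := Sb n Sn => bn; rewrite (_ : b + _ = n) //; lia.
case: (ex_minnP exk) => k /asboolP Sk kmin; exists (b + k%:Z) => // m Sm.
have bm := Sb m Sm; have := kmin `|m - b|%N; rewrite (_ : b + `|m - b| = m); last lia.
by move=> /(_ (introT (asboolP _) Sm)); lia.
Qed.

End IntInf.

Section InjectivityCriterion.
Variables (A : dgRing) (A_nonpos : nonpositive A).
Implicit Types M N : dgModule A.

Lemma dg_inf_bounded N : cohomologically_bounded N ->
  (acyclic N /\ dg_inf N = +oo%E) \/
  exists n : int, [/\ dg_inf N = n%:E, ~ trivial_zmod (cohomology N n) &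
    forall k, k < n -> trivial_zmod (cohomology N k)].
Proof.
move=> [a [b Nab]]; pose S := [set n : int | ~ trivial_zmod (cohomology N n)]%classic.
have [Sn|Sn] := pselect (exists n, S n); last first.
  by left; split=> [n|]; [apply: contrapT => Hn | apply: int_inf_set0 => n Hn];
    apply: Sn; exists n.
have [n Hn nmin] : exists2 n, S n & forall k, S k -> n <= k.
  apply: (int_min_exists (b := a)) => // n Hn; rewrite leNgt; apply/negP => na.
  by apply/Hn/Nab; left.
right; exists n; split=> //; first exact/int_inf_eqP.
by move=> k kn; apply: contrapT => /nmin; rewrite leNgt kn.
Qed.

Definition inj_bound M (n : int) : Prop :=
  forall N, cohomologically_bounded N ->
    forall i : int, (n%:E - dg_inf N < i%:E)%E -> Ext_vanishes N M i.

(** Asking only for a lower bound [b] of the cohomology also covers acyclic [N], whose infimum is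
    [+oo]. *)
Lemma inj_bound_Ext M N (n b i : int) : inj_bound M n -> cohomologically_bounded N ->
  (forall k, k < b -> trivial_zmod (cohomology N k)) -> n - b < i -> Ext_vanishes N M i.
Proof.
move=> nM bN Nb nbi; apply: nM => //.
have [[_ ->]|[m [-> Hm _]]] := dg_inf_bounded bN; first by rewrite ltNyr.
rewrite -EFinB lte_fin; apply: le_lt_trans nbi; rewrite lerD2l lerN2 leNgt.
by apply/negP => /Nb.
Qed.

Lemma criterion_inj_bound M : injectivity_criterion M -> inj_bound M 0.
Proof.
move=> critM N bN i iN; apply: criterion_Ext_vanishes => //.
have [[acN _]|[n [nE _ nmin]]] := dg_inf_bounded bN; first exact: acN.
by apply: nmin; move: iN; rewrite nE -EFinB lte_fin; lia.
Qed.

(** For [j = 1 - k > 1] the ideal [A^{<j}] is all of [A], so with [W = 0] the criterion just solves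
    [dm = c]. *)
Lemma criterion_low M : injectivity_criterion M ->
  forall k : int, k < 0 -> trivial_zmod (cohomology M k).
Proof.
move=> critM k k0; apply/trivial_cohomologyP => c cZ.
have [||m [mh <- _]] := critM (1 - k) c (fun w x => w = 0 /\ x \in boundary M 0).
- split=> [|w x [-> /boundaryP[y yh ->]]|w x [-> /boundaryP[y yh ->]]
    |w x w' x' [-> xB] [-> x'B]|b w x b0 [-> /boundaryP[y yh ->]]|a ah|y yh].
  + by have -> : 1 - (1 - k) = k by lia.
  + by rewrite rpred0; split=> //; apply: homog_cast (dgm_diff_homog yh) _.
  + by rewrite raddf0 dgm_diff_diff scale0r scaler0.
  + by rewrite subrr rpredB.
  + split; first by rewrite mulr0.
    apply/boundaryP; exists (b *: y); first by apply: homog_cast (dgm_homogZ b0 yh) _; lia.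
    by rewrite dgm_leibniz_twist diff_homog0 // scale0r add0r twist_homog0.
  + rewrite (A_nonpos _ ah) ?raddf0 ?scale0r ?scaler0 ?rpred0 //; lia.
  + by split=> //; apply/boundaryP; exists y.
- by move=> x [].
by apply/boundaryP; exists m => //; apply: homog_cast mh _; lia.
Qed.

(** The largest relation compatible with [c] is admissible: its pairs over 0 are cocycles of degree
    0, hence boundaries. *)
Lemma criterion_acyclic M : injectivity_criterion M ->
  trivial_zmod (cohomology M 0) -> acyclic M.
Proof.
move=> critM H0M k; apply/trivial_cohomologyP => c cZ.
pose j := 1 - k; pose e := `|1 - j|%N.
have jk : 1 - j = k by rewrite /j; lia.
have /cocycleP[ch dc] := cZ.
have [||m [mh <- _]] := critM j c (fun w x =>
  [/\ w \in homog (dgr_grading A) j, dgr_diff A w = 0,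
      x \in homog (dgm_grading M) 0 & dgm_diff M x = (-1) ^+ e *: (w *: c)]).
- split=> [|w x [wj dw x0 dx]|w x [wj dw x0 dx]
    |w x w' x' [wj dw x0 dx] [wj' dw' x0' dx']|b w x b0 [wj dw x0 dx]|a ah|y yh].
  + by rewrite jk.
  + by [].
  + by [].
  + by split; rewrite ?rpredB // raddfB /= ?dw ?dw' ?subrr // dx dx' scalerBl scalerBr.
  + split; first by rewrite -[j]add0r dgr_homogM.
    * by rewrite dgr_leibniz_twist dw diff_homog0 // mul0r mulr0 addr0.
    * by rewrite -[0]add0r dgm_homogZ.
    * rewrite dgm_leibniz_twist dx diff_homog0 // scale0r add0r twist_homog0 //.
      by rewrite scaler_signC scalerA.
  + split; first by apply: homog_cast (dgr_diff_homog ah) _; lia.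
    * exact: dgr_diff_diff.
    * by rewrite rpredZsign; apply: homog_cast (dgm_homogZ ah ch) _; rewrite /j; lia.
    * by rewrite raddfZsign /= dgm_leibniz_twist dc scaler0 addr0.
  + split; rewrite ?rpred0 ?raddf0 ?dgm_diff_diff ?scale0r ?scaler0 //.
    by apply: homog_cast (dgm_diff_homog yh) _.
- move=> x [_ _ x0]; rewrite scale0r scaler0 => dx.
  by apply: (trivial_cohomologyP M 0).1 => //; apply/cocycleP.
by apply/boundaryP; exists m => //; apply: homog_cast mh _; rewrite /j; lia.
Qed.

(** With [j = 1] and all of [Z^0(M)] placed over 0, the test module has no cohomology in negative
    degrees. A bound [n < 0] therefore kills Ext^0, and [test_lifting] makes [c] a boundary. *)
Lemma inj_bound_neg M n : (forall k : int, k < 0 -> trivial_zmod (cohomology M k)) ->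
  inj_bound M n -> n < 0 -> trivial_zmod (cohomology M 0).
Proof.
move=> Mlow nM n0; apply/trivial_cohomologyP => c cZ.
have GP : lifting_problem 1 c (fun w x => w = 0 /\ x \in cocycle M 0).
  split=> [|w x [-> /cocycleP[x0 dx]]|w x [-> /cocycleP[x0 dx]]
    |w x w' x' [-> xB] [-> x'B]|b w x b0 [-> xZ]|a ah|y yh].
  + by [].
  + by rewrite rpred0.
  + by rewrite raddf0 dx scale0r scaler0.
  + by rewrite subrr rpredB.
  + split; first by rewrite mulr0.
    by apply: cocycleZ0 => //; apply/cocycleP; split=> //; exact: diff_homog0.
  + split; first exact: diff_homog0.
    rewrite rpredZsign; apply: cocycleZ0 => //; apply/cocycleP.
    by split=> //; exact: diff_homog0.
  + split=> //; apply/cocycleP; split; last exact: dgm_diff_diff.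
    by apply: homog_cast (dgm_diff_homog yh) _.
have [] := inj_bound_Ext nM (test_bounded A_nonpos GP Mlow) (b := 0) (i := 1 - 1).
- by move=> k k0; apply: test_cohomology_low => //; lia.
- by lia.
move=> P vP; have [m [mh dm _]] := test_lifting (kpr_quasi_iso P) vP.
by rewrite -dm; apply/boundaryP; exists m.
Qed.

Theorem Inj_criterion M : Inj M <-> injectivity_criterion M.
Proof.
split=> [[/derived_iso_zero/acyclic_criterion //|[infM injM]]|critM].
  have [_ Mlow'] := (int_inf_eqP _ _).1 infM.
  have [bM _] := (int_inf_eqP _ _).1 injM.
  have Mlow (k : int) : k < 0 -> trivial_zmod (cohomology M k).
    by move=> k0; apply: contrapT => /Mlow'; rewrite leNgt k0.
  move=> j c G GP Gb.
  have low k : k < j -> trivial_zmod (cohomology (test_module A_nonpos GP) k).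
    by move=> kj; apply: test_cohomology_low.
  have [|P vP] := inj_bound_Ext (i := 1 - j) bM (test_bounded A_nonpos GP Mlow) low.
    by lia.
  have [m [mh dm mG]] := test_lifting (kpr_quasi_iso P) vP.
  exists m; split=> //; apply: mG; apply: low; lia.
have [H0M|H0M] := pselect (trivial_zmod (cohomology M 0)).
  by left; apply/derived_iso_zero/criterion_acyclic.
right; split; apply/int_inf_eqP; split=> //.
- by move=> n Hn; rewrite leNgt; apply/negP => /(criterion_low critM).
- exact: criterion_inj_bound.
move=> n nM; rewrite leNgt; apply/negP => n0.
exact: H0M (inj_bound_neg (criterion_low critM) nM n0).
Qed.

End InjectivityCriterion.

(** * The character dual of [A] *)

Section Divisible.
Implicit Types V D : zmodType.

Definition divisible D : Prop := forall (n : nat) (y : D), (0 < n)%N -> exists z, z *+ n = y.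

(** The integers [k] with [v *~ k] in [S] form an ideal, generated by its least positive element if
    there is one. *)
Lemma subgroup_order V (S : V -> Prop) (v : V) : S 0 -> (forall x y, S x -> S y -> S (x - y)) ->
  (forall k : int, S (v *~ k) -> k = 0) \/
  exists n : nat, [/\ (0 < n)%N, S (v *+ n) &
    forall k : int, S (v *~ k) -> exists q : int, k = q * n%:Z].
Proof.
move=> S0 SB; have SN x : S x -> S (- x) by move=> Sx; rewrite -sub0r; exact: SB.
have SD x y : S x -> S y -> S (x + y) by move=> Sx /SN Sy; rewrite -[y]opprK; exact: SB.
have SMn x n : S x -> S (x *+ n).
  by move=> Sx; elim: n => [|n IHn]; rewrite ?mulr0n // mulrS; exact: SD.
have SMz x k : S x -> S (x *~ k).
  by move=> Sx; case: k => n; [|apply: SN]; exact: SMn.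
have [ex|nex] := pselect (exists n : nat, (0 < n)%N && `[< S (v *+ n) >]); last first.
  left=> k Sk; apply: contrapT => k0; apply: nex; exists `|k|%N.
  apply/andP; split; first lia.
  by apply/asboolP; have := SMz _ (sgz k) Sk; rewrite -mulrzA mulrC -abszEsg -pmulrn.
right; case: (ex_minnP ex) => n /andP[n0 /asboolP Sn] nmin; exists n; split=> // k Sk.
have Sr : S (v *~ (k %% n)%Z).
  have := SB _ _ Sk (SMz _ (k %/ n)%Z Sn).
  by rewrite pmulrn -mulrzA -mulrzBr [n%:Z * _]mulrC; congr (S (_ *~ _)); rewrite /modz.
exists (k %/ n)%Z; rewrite {1}(divz_eq k n) [X in _ + X](_ : _ = 0) ?addr0 //.
have r0 : 0 <= (k %% n)%Z by rewrite modz_ge0 //; lia.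
have rn : (k %% n)%Z < n by rewrite ltz_pmod //; lia.
case: (k %% n)%Z Sr r0 rn => // -[//|r] Sr _ rn.
by have := nmin r.+1; rewrite -pmulrn in Sr; rewrite (introT (asboolP _) Sr) => /(_ isT); lia.
Qed.

(** Baer's theorem over the integers, with the partial map given as a relation so that it applies
    directly to lifting problems. *)
Lemma divisible_extension V D (G : V -> D -> Prop) : divisible D -> G 0 0 ->
  (forall v y v' y', G v y -> G v' y' -> G (v - v') (y - y')) ->
  (forall y, G 0 y -> y = 0) ->
  exists f : {additive V -> D}, forall v y, G v y -> f v = y.
Proof.
move=> divD G0 GB Gf.
(* Joining the graph of [G] makes the condition hold for the union of the empty chain. *)
pose ok (S : set (V * D)) := let H := (S `|` [set p | G p.1 p.2])%classic in
  (forall p q, H p -> H q -> H (p - q)) /\ (forall y, H (0, y) -> y = 0).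
have [F Fok Ftot|S [[HB Hf] Smax]] := @Zorn_bigcup _ ok.
  have two p q : (\bigcup_(X in F) X `|` [set p | G p.1 p.2])%classic p ->
      (\bigcup_(X in F) X `|` [set p | G p.1 p.2])%classic q ->
      (G p.1 p.2 /\ G q.1 q.2) \/ exists2 X, F X &
      (X `|` [set p | G p.1 p.2])%classic p /\ (X `|` [set p | G p.1 p.2])%classic q.
    move=> [[X FX Xp]|Gp] [[Y FY Yq]|Gq].
    - by have [XY|YX] := Ftot _ _ FX FY; right; [exists Y|exists X] => //;
        split; left=> //; [exact: XY|exact: YX].
    - by right; exists X => //; split; [left|right].
    - by right; exists Y => //; split; [right|left].
    - by left.
  split=> [p q Hp Hq|y Hy].
    have [[Gp Gq]|[X FX [Xp Xq]]] := two p q Hp Hq; first by right; exact: GB.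
    by have [XpB|] := (Fok X FX).1 p q Xp Xq; [left; exists X | right].
  by have [[/Gf]|[X /Fok[_ Xf] [/Xf]]] := two _ _ Hy Hy.
pose K v y := (S `|` [set p | G p.1 p.2])%classic (v, y).
have K0 : K 0 0 by right.
have KB v y v' y' : K v y -> K v' y' -> K (v - v') (y - y') by exact: HB.
have KN v y : K v y -> K (- v) (- y) by move=> /(KB _ _ _ _ K0); rewrite !sub0r.
have KD v y v' y' : K v y -> K v' y' -> K (v + v') (y + y').
  by move=> Kv /KN/(KB _ _ _ _ Kv); rewrite !opprK.
have KMn v y n : K v y -> K (v *+ n) (y *+ n).
  by move=> Kv; elim: n => [|n IHn]; rewrite ?mulr0n // !mulrS; exact: KD.
have KMz v y k : K v y -> K (v *~ k) (y *~ k).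
  by move=> Kv; case: k => n; [|apply: KN]; exact: KMn.
have domK v : exists y, K v y.
  apply: contrapT => nv.
  (* The value at [v] is 0 if no nonzero multiple of [v] lies in the domain, and otherwise an [n]-th
     part of the value at the first positive multiple. *)
  have [z zP] : exists z, forall k u y, K u y -> u + v *~ k = 0 -> y + z *~ k = 0.
    have domB x x' : (exists y, K x y) -> (exists y, K x' y) -> exists y, K (x - x') y.
      by move=> [y Ky] [y' Ky']; exists (y - y'); exact: KB.
    have vk k u y : K u y -> u + v *~ k = 0 -> exists y', K (v *~ k) y'.
      by move=> /KN Ku /addr0_eq uk; exists (- y); rewrite -uk.
    have [free|[n [n0 [y0 Kn] ndiv]]] :=
        subgroup_order (S := fun x => exists y, K x y) v (ex_intro _ 0 K0) domB.
      exists 0 => k u y Kuy uk; have k0 := free _ (vk _ _ _ Kuy uk).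
      by move: uk; rewrite k0 !mulr0z !addr0 => u0; apply: Hf; rewrite -u0.
    have [z zn] := divD n y0 n0; exists z => k u y Kuy uk.
    have [q kE] := ndiv _ (vk _ _ _ Kuy uk).
    have zk : z *~ k = y0 *~ q by rewrite kE mulrC mulrzA -pmulrn zn.
    have vkE : v *~ k = (v *+ n) *~ q by rewrite kE mulrC mulrzA -pmulrn.
    by apply: Hf; have := KD _ _ _ _ Kuy (KMz _ _ q Kn); rewrite -vkE uk -zk.
  pose S' := [set p : V * D | exists k u y,
    [/\ K u y, p.1 = u + v *~ k & p.2 = y + z *~ k]]%classic.
  have KS' u y : K u y -> S' (u, y).
    by move=> Ku; exists 0, u, y; rewrite !mulr0z !addr0.
  have H'S' p : (S' `|` [set p | G p.1 p.2])%classic p -> S' p.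
    by case=> // Gp; case: p Gp => u y /= Gu; apply: KS'; right.
  apply: (Smax S').
    split=> [[u y] Su|S'S]; first by apply: KS'; left.
    apply: nv; exists z; left; apply: S'S.
    by exists 1, 0, 0; rewrite /= !mulr1z !add0r.
  split=> [[p1 p2] [q1 q2] /H'S'[k [u [y [Ku /= -> ->]]]] /H'S'[k' [u' [y' [Ku' /= -> ->]]]]|y].
    left; exists (k - k'), (u - u'), (y - y'); split; first exact: KB.
      by rewrite /= mulrzBr opprD addrACA.
    by rewrite /= mulrzBr opprD addrACA.
  by move=> /H'S'[k [u [y' [Ku /= u0 ->]]]]; exact: zP Ku (esym u0).
have [f fP] := choice domK.
have fB : zmod_morphism f.
  move=> x y; apply/subr0_eq/Hf.
  have := KB _ _ _ _ (fP (x - y)) (KB _ _ _ _ (fP x) (fP y)).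
  by rewrite subrr.
pose F : {additive V -> D} := HB.pack f (GRing.isZmodMorphism.Build V D f fB).
exists F => v y Gvy; apply/subr0_eq/Hf.
have := KB _ _ _ _ (fP v) (or_intror Gvy : K v y).
by rewrite subrr.
Qed.

End Divisible.

Section RationalsModuloIntegers.
Local Open Scope quotient_scope.

Definition int_rat : {pred rat} := [pred x | x \is a Num.int].
Fact int_rat_zmod_closed : zmod_closed int_rat.
Proof. by split=> [|x y]; rewrite !inE ?rpred0 //; exact: rpredB. Qed.
HB.instance Definition _ := GRing.isZmodClosed.Build rat int_rat int_rat_zmod_closed.

Definition QZ := Quotient.quot int_rat.
HB.instance Definition _ := GRing.Zmodule.on QZ.
Definition QZpi (x : rat) : QZ := \pi_QZ x.
Fact QZpi_zmod : zmod_morphism QZpi.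
Proof. by move=> x y; exact: (raddfB (\pi_(Quotient.quot int_rat))). Qed.
HB.instance Definition _ := GRing.isZmodMorphism.Build rat QZ QZpi QZpi_zmod.

Lemma QZpi_eq0 x : QZpi x = 0 <-> x \is a Num.int.
Proof.
rewrite -(raddf0 QZpi); split=> [/eqmodP|xi]; last apply/eqmodP;
  by rewrite /= /Quotient.equiv subr0.
Qed.

Lemma QZ_divisible : divisible QZ.
Proof.
move=> n y n0; rewrite -[y]reprK -/(QZpi _); exists (QZpi (repr y / n%:R)).
by rewrite -raddfMn -[_ *+ n]mulr_natr divfK // pnatr_eq0 -lt0n.
Qed.

(** On [S + Z v] send [S] to 0 and [v] to the class of [q], where [q] is [1/n] if [v] has order [n]
    modulo [S] and [1/2] if the order is infinite; then extend by divisibility. *)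
Lemma QZ_separation (V : zmodType) (S : V -> Prop) (v : V) : S 0 ->
  (forall x y, S x -> S y -> S (x - y)) -> ~ S v ->
  exists f : {additive V -> QZ}, (forall x, S x -> f x = 0) /\ f v <> 0.
Proof.
move=> S0 SB nSv.
have [q qv qint] : exists2 q : rat, ~ q \is a Num.int &
    forall k : int, S (v *~ k) -> q *~ k \is a Num.int.
  have [free|[n [n0 Sn ndiv]]] := subgroup_order v S0 SB.
    exists (1 / 2%:R) => [|k /free ->]; last by rewrite mulr0z rpred0.
    by [].
  exists (n%:R^-1) => [/intrP[m nm]|k /ndiv[m ->]].
    have /eqP : m%:~R * n%:~R = 1%:~R :> rat by rewrite -nm pmulrn mulVf // pnatr_eq0 -lt0n.
    rewrite -intrM eqr_int => /eqP/(congr1 absz)/eqP.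
    by rewrite abszM muln_eq1 => /andP[_ /eqP n1]; rewrite -[n]/`|n|%N n1 in Sn.
  rewrite mulrC mulrzA -pmulrn -[_ *+ n]mulr_natr mulVf ?intr_int //.
  by rewrite pnatr_eq0 -lt0n.
pose G x y := exists k s, [/\ S s, x = s + v *~ k & y = QZpi (q *~ k)].
have [|x y x' y' [k [s [Ss -> ->]]] [k' [s' [Ss' -> ->]]]|y [k [s [Ss xE ->]]]|f fG] :=
    divisible_extension QZ_divisible (G := G).
- by exists 0, 0; rewrite !mulr0z addr0 raddf0.
- exists (k - k'), (s - s'); split; first exact: SB.
    by rewrite mulrzBr opprD addrACA.
  by rewrite mulrzBr raddfB.
- by apply/QZpi_eq0/qint; rewrite -(addr0_eq (esym xE)) -sub0r; exact: SB.
exists f; split=> [x Sx|]; first by apply: fG; exists 0, x; rewrite !mulr0z addr0 raddf0.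
rewrite (fG v (QZpi q)); first by move/QZpi_eq0.
by exists 1, 0; rewrite !mulr1z add0r.
Qed.

End RationalsModuloIntegers.

(** * The graded character dual as a DG-module *)

Section Dual.
Variables (A : dgRing) (D : zmodType).
Local Notation cA := (component (dgr_grading A)).
Local Notation AA := (homog (dgr_grading A)).

(** Vanishing in almost all degrees yields the graded dual, the direct sum of the groups
    [Hom_Z(A^n, D)]. *)
Definition dual_pred : {pred A -> D} := [pred f | `[< zmod_morphism f /\
  exists t : seq int, forall n a, a \in AA n -> n \notin t -> f a = 0 >]].

Fact dual_zmod_closed : zmod_closed dual_pred.
Proof.
split=> [|f g /asboolP[fB [s fs]] /asboolP[gB [t gt]]]; apply/asboolP.
  by split=> [x y|]; [rewrite subr0 | exists [::]].
split=> [x y|].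
  by rewrite !fctE fB gB subrACA.
exists (s ++ t) => n a an; rewrite mem_cat negb_or => /andP[ns nt].
by rewrite !fctE (fs n) // (gt n) // subr0.
Qed.
HB.instance Definition _ := GRing.isZmodClosed.Build (A -> D) dual_pred dual_zmod_closed.

Record dual := Dual { dual_val :> A -> D; _ : dual_val \in dual_pred }.
HB.instance Definition _ := [isSub for dual_val].
HB.instance Definition _ := [Choice of dual by <:].
HB.instance Definition _ := [SubChoice_isSubZmodule of dual by <:].
Implicit Types f g : dual.

Lemma dual_eqP f g : f =1 g -> f = g.
Proof. by move=> fg; apply/val_inj/funext. Qed.

Fact dual_zmod f : zmod_morphism f.
Proof. by have /asboolP[] := valP f. Qed.
HB.instance Definition _ f := GRing.isZmodMorphism.Build A D (dual_val f) (@dual_zmod f).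

Lemma dual_support f : exists t : seq int, forall n a, a \in AA n -> n \notin t -> f a = 0.
Proof. by have /asboolP[] := valP f. Qed.

Lemma dual_addE f g b : (f + g) b = f b + g b. Proof. by []. Qed.
Lemma dual_zeroE b : (0 : dual) b = 0. Proof. by []. Qed.

(* The sign rule gives (a f)(b) = (-1)^(|a| (|f| + |b|)) f(b a), and [f (b * a)]
   vanishes unless |f| + |b| = - |a|, whence the twist. *)
Fact dual_scale_proof (a : A) f : (fun b => f (b * twist 1 a)) \in dual_pred.
Proof.
apply/asboolP; split=> [x y|]; first by rewrite mulrBl raddfB.
move: a; apply: (@homog_ind _ (dgr_grading A)) => [|a a' [s fs] [t ft]|i a ai].
- by exists [::] => n b _ _; rewrite raddf0 mulr0 raddf0.
- exists (s ++ t) => n b bn; rewrite mem_cat negb_or => /andP[ns nt].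
  by rewrite (raddfD (twist 1)) mulrDr (raddfD f) /= (fs n) // (ft n) // addr0.
have [t ft] := dual_support f; exists [seq m - i | m <- t] => n b bn nt.
apply: ft (dgr_homogM bn (twist_homog 1 ai)) _; apply: contra nt => nit.
by apply/mapP; exists (n + i); rewrite ?addrK.
Qed.
Definition dual_scale a f : dual := Dual (dual_scale_proof a f).

Fact dual_scaleA a b f : dual_scale a (dual_scale b f) = dual_scale (a * b) f.
Proof. by apply: dual_eqP => x; rewrite /= twistM mulrA. Qed.
Fact dual_scale1 : left_id 1 dual_scale.
Proof. by move=> f; apply: dual_eqP => x; rewrite /= twist1 mulr1. Qed.
Fact dual_scaleDr : right_distributive dual_scale +%R.
Proof. by move=> a f g; apply: dual_eqP. Qed.
Fact dual_scaleDl f : {morph dual_scale^~ f : a b / a + b}.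
Proof. by move=> a b; apply: dual_eqP => x; rewrite dual_addE /= raddfD mulrDr raddfD. Qed.
HB.instance Definition _ := GRing.Zmodule_isLmodule.Build A dual
  dual_scaleA dual_scale1 dual_scaleDr dual_scaleDl.

Lemma dual_scaleE a f b : (a *: f) b = f (b * twist 1 a). Proof. by []. Qed.

Fact dual_component_proof n f : (fun b => f (cA (- n) b)) \in dual_pred.
Proof.
apply/asboolP; split=> [x y|]; first by rewrite !raddfB.
exists [:: - n] => m b bm; rewrite mem_seq1 => mn.
by rewrite (component_homogE _ bm) eq_sym (negPf mn) raddf0.
Qed.
Definition dual_component_fun n f : dual := Dual (dual_component_proof n f).
Fact dual_component_zmod n : zmod_morphism (dual_component_fun n).
Proof. by move=> f g; apply: dual_eqP. Qed.
HB.instance Definition _ n :=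
  GRing.isZmodMorphism.Build dual dual (dual_component_fun n) (dual_component_zmod n).
Definition dual_component n : {additive dual -> dual} := dual_component_fun n.

Fact dual_componentK m n f : dual_component m (dual_component n f) =
  if m == n then dual_component n f else 0.
Proof.
apply: dual_eqP => b /=; rewrite componentK eqr_opp eq_sym.
by case: eqP => [->|] //=; rewrite ?raddf0.
Qed.

Fact dual_component_sum f : exists2 s : seq int,
  uniq s & f = \sum_(n <- s) dual_component n f.
Proof.
have [t ft] := dual_support f; pose s := undup [seq - n | n <- t].
exists s; first exact: undup_uniq.
have sumE b : (\sum_(n <- s) dual_component n f) b = \sum_(n <- s) f (cA (- n) b).
  by elim: (s) => [|n s' IHs]; rewrite ?big_nil // !big_cons dual_addE IHs.
apply: dual_eqP => b; rewrite sumE; move: b.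
apply: (@homog_ind _ (dgr_grading A)) => [|a b fa fb|n b bn].
- by rewrite raddf0 big1 // => n _; rewrite !raddf0.
- rewrite (raddfD f) /= fa fb -big_split; apply: eq_bigr => n _.
  by rewrite (raddfD (cA _)) (raddfD f).
have [nt|nt] := boolP (n \in t); last first.
  rewrite (ft n b bn nt) big1 // => m _; rewrite (component_homogE _ bn).
  by case: ifP; rewrite ?(ft n b bn nt) ?raddf0.
have ns : - n \in s by rewrite mem_undup (map_f _ nt).
rewrite (bigD1_seq (- n)) ?undup_uniq //= opprK (component_homogE _ bn) eqxx.
rewrite big1 ?addr0 // => m mn; rewrite (component_homogE _ bn).
by rewrite eqr_oppLR (negPf mn) raddf0.
Qed.

Definition dual_grading : grading dual := Grading dual_componentK dual_component_sum.

Lemma dual_homogP n f : reflect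
  (forall k b, b \in AA k -> k != - n -> f b = 0) (f \in homog dual_grading n).
Proof.
apply: (iffP (homogP _ _ _)) => [fE k b bk kn|fn].
  have := congr1 (fun g : dual => g b) fE; rewrite /= (component_homogE _ bk).
  by rewrite eq_sym (negPf kn) raddf0.
apply: dual_eqP; apply: (@homog_ind _ (dgr_grading A)) => [|a b fa fb|k b bk].
- by rewrite !raddf0.
- by rewrite (raddfD f) /= -fa -fb /= (raddfD (cA _)) (raddfD f).
rewrite /= (component_homogE _ bk); case: eqP => // /eqP; rewrite eq_sym => kn.
by rewrite raddf0 (fn k).
Qed.

(** The Hom differential is [- (-1)^|f|] times [f] after [d], and [f (d b)] vanishes unless
    [|f| = - |b| - 1]; the sign is therefore [(-1)^|b|]. *)
Fact dual_diff_proof f : (fun b => f (dgr_diff A (twist 1 b))) \in dual_pred.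
Proof.
apply/asboolP; split=> [x y|]; first by rewrite !raddfB.
have [t ft] := dual_support f; exists [seq m - 1 | m <- t] => n b bn nt.
apply: ft (dgr_diff_homog (twist_homog 1 bn)) _; apply: contra nt => n1t.
by apply/mapP; exists (n + 1); rewrite ?addrK.
Qed.
Definition dual_diff_fun f : dual := Dual (dual_diff_proof f).
Fact dual_diff_zmod : zmod_morphism dual_diff_fun.
Proof. by move=> f g; apply: dual_eqP. Qed.
HB.instance Definition _ :=
  GRing.isZmodMorphism.Build dual dual dual_diff_fun dual_diff_zmod.

Definition dg_dual : dgModule A.
Proof.
apply: (@DGModule A dual dual_grading dual_diff_fun).
- move=> i j a f ai /dual_homogP fj; apply/dual_homogP => k b bk kij.
  apply: fj (dgr_homogM bk (twist_homog 1 ai)) _.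
  by apply: contra kij => /eqP kij; apply/eqP; lia.
- move=> i f /dual_homogP fi; apply/dual_homogP => k b bk ki.
  apply: fi (dgr_diff_homog (twist_homog 1 bk)) _.
  by apply: contra ki => /eqP ki; apply/eqP; lia.
- move=> f; apply: dual_eqP => b /=.
  by rewrite twist_diff raddfMsign /= dgr_diff_diff mulr0 raddf0.
- move=> i a f ai.
  have -> : (-1) ^+ `|i| *: (a *: dual_diff_fun f) = twist 1 a *: dual_diff_fun f.
    by rewrite scalerA (twistE _ ai) mul1n.
  apply: dual_eqP => b; rewrite dual_addE !dual_scaleE /= twistM !twist1K.
  rewrite dgr_leibniz_twist raddfD twist1K twist_diff expr1 mulN1r mulrN raddfN /=.
  by rewrite addrCA addNr addr0.
Defined.

End Dual.

Section DualCriterion.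
Variables (A : dgRing) (A_nonpos : nonpositive A) (D : zmodType) (divD : divisible D).
Local Notation M := (dg_dual A D).
Local Notation AA := (homog (dgr_grading A)).
Implicit Types f x : dual A D.

Lemma dual_diffE f b : (dgm_diff M f : dual A D) b = f (dgr_diff A (twist 1 b)).
Proof. by []. Qed.

Lemma dual_neg n f : n < 0 -> f \in homog (dgm_grading M) n -> f = 0.
Proof.
move=> n0 /dual_homogP fn; apply: dual_eqP.
apply: (@homog_ind _ (dgr_grading A)) => [|a b fa fb|k b bk].
- by rewrite raddf0.
- by rewrite (raddfD f) /= fa fb addr0.
have [kn|] := eqVneq k (- n); last exact: fn.
by rewrite (A_nonpos (i := k) _ bk) ?raddf0 //; lia.
Qed.

Lemma dual_boundary0 x : x \in boundary M 0 -> x = 0.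
Proof. by case/boundaryP=> y yh ->; rewrite (dual_neg _ yh) ?raddf0. Qed.

Lemma dual_sign_scale n x b : ((-1) ^+ n *: x) b = x ((-1) ^+ n * b).
Proof.
rewrite dual_scaleE (twistE _ (i := 0)) ?muln0 ?mul1r ?commr_sign //.
by rewrite -[_ ^+ n]mulr1 rpredMsign dgr_homog1.
Qed.

(** Evaluation at 1 turns linear maps into the dual into additive maps to [D], so divisibility of
    [D] suffices for the extension. *)
Lemma dual_criterion : injectivity_criterion M.
Proof.
move=> j c G GP Gb; set e := `|1 - j|%N.
(* Evaluating at the unit [(-1) ^+ e] rather than at 1 is what makes [x] and [w *: m] cancel. *)
have [|w y w' y' [x [Gx ->]] [x' [Gx' ->]]|y [x [/Gb/dual_boundary0 -> ->]]|g gG] :=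
    divisible_extension divD (G := fun w y => exists x, G w x /\ y = x ((-1) ^+ e)).
- by exists 0; split=> //; exact: lp0 GP.
- by exists (x - x'); split=> //; exact: lp_sub GP _ _ _ _ Gx Gx'.
- by [].
have {}gG w x : G w x -> g w = x ((-1) ^+ e) by move=> Gx; apply: gG; exists x.
have mP : (fun b => g (component (dgr_grading A) j b)) \in @dual_pred A D.
  apply/asboolP; split=> [x y|]; first by rewrite !raddfB.
  exists [:: j] => n b bn; rewrite mem_seq1 => nj.
  by rewrite (component_homogE _ bn) eq_sym (negPf nj) raddf0.
pose m : dual A D := Dual mP.
have mE b : b \in AA j -> m b = g b by move=> /homogP bj; rewrite /= bj.
have mh : m \in homog (dgm_grading M) (- j).
  apply/dual_homogP => k b bk; rewrite opprK /= (component_homogE _ bk) eq_sym => /negPf ->.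
  by rewrite raddf0.
have /cocycleP[/dual_homogP ch dc] := lp_cocycle GP.
exists m; split=> //.
- apply: dual_eqP => b; rewrite dual_diffE; move: b.
  apply: (@homog_ind _ (dgr_grading A)) => [|a b ma mb|k b bk].
  + by rewrite !raddf0.
  + have cD : (c : dual A D) (a + b) = (c : dual A D) a + (c : dual A D) b by exact: raddfD.
    by rewrite cD -ma -mb (raddfD (twist 1)) (raddfD (dgr_diff A)) (raddfD m).
  have tbk := twist_homog 1 bk.
  have [kj|kj] := eqVneq k (j - 1); last first.
    rewrite (ch k b bk); last by apply: contra kj => /eqP kj; apply/eqP; lia.
    have /dual_homogP/(_ _ _ (dgr_diff_homog tbk)) -> // := mh.
    by rewrite opprK; apply: contra kj => /eqP kj; apply/eqP; lia.
  rewrite kj in bk tbk.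
  rewrite mE; last by apply: homog_cast (dgr_diff_homog tbk) _; lia.
  rewrite (gG _ _ (lp_diffl GP tbk)) dual_sign_scale -expr2 sqrr_sign.
  by rewrite dual_scaleE mul1r twist1K.
move=> w x Gwx; have [wj /dual_homogP xh] := lp_homog GP Gwx.
suff -> : x + w *: m = 0 by rewrite rpred0.
apply: dual_eqP => b; rewrite dual_addE dual_scaleE dual_zeroE; move: b.
apply: (@homog_ind _ (dgr_grading A)) => [|a b ma mb|k b bk].
- by rewrite mul0r !raddf0 addr0.
- by rewrite mulrDl (raddfD x) (raddfD m) addrACA ma mb addr0.
have [k0|k0] := eqVneq k 0; last first.
  rewrite (xh k b bk) ?oppr0 // add0r.
  have /dual_homogP/(_ _ _ (dgr_homogM bk (twist_homog 1 wj))) -> // := mh.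
  by rewrite opprK; apply: contra k0 => /eqP k0; apply/eqP; lia.
rewrite k0 in bk; have bwj := dgr_homogM bk (twist_homog 1 wj).
rewrite mE; last by rewrite -[j]add0r.
rewrite (twistE _ wj) mul1n mulrA.
have sb : b * (-1) ^+ `|j| \in AA 0 by rewrite commr_sign rpredMsign.
(* [lp_scale] reduces the value at [b] to a value at the unit. *)
rewrite (gG _ _ (lp_scale GP sb Gwx)) dual_scaleE twist_homog0 // commr_sign mulrA -exprD.
by rewrite (@sign_oddN _ _ 0) ?expr0 ?mulN1r ?raddfN ?subrr // /e; parity.
Qed.

End DualCriterion.

(** * Direct sums and finiteness *)

Section DirectSumCriterion.
Variables (A : dgRing) (A_nonpos : nonpositive A).

(* Noetherianity of the [H^0(A)]-module [H^j(A)], read on cocycles. *)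
Definition cocycles_noetherian (j : int) : Prop :=
  forall W : A -> Prop, (forall w, W w -> w \in cocycle (dg_regular A) j) ->
    W 0 -> (forall w w', W w -> W w' -> W (w - w')) ->
    (forall b w, b \in homog (dgr_grading A) 0 -> W w -> W (b * w)) ->
  exists k (g : 'I_k -> A), (forall i, W (g i)) /\
    forall w, W w -> exists b : 'I_k -> A, (forall i, b i \in homog (dgr_grading A) 0) /\
      w - \sum_(i < k) b i * g i \in boundary (dg_regular A) j.

Variables (X : Type) (M : X -> dgModule A).

Lemma dsum_criterion : (forall j, cocycles_noetherian j) ->
  (forall x, injectivity_criterion (M x)) -> injectivity_criterion (dg_dsum M).
Proof.
move=> noeth critM j c G GP Gb; set e := `|1 - j|%N.
pose W w := exists x, G w x.
have WZ w : W w -> w \in cocycle (dg_regular A) j.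
  move=> [x Gx]; have [wj _] := lp_homog GP Gx; have [dw _] := lp_dom GP Gx.
  by apply/cocycleP.
have [|w w' [x Gx] [x' Gx']|b w b0 [x Gx]|k [g [gW gP]]] := noeth j W WZ.
- by exists 0; exact: lp0 GP.
- by exists (x - x'); exact: lp_sub GP _ _ _ _ Gx Gx'.
- by exists (b *: x); exact: lp_scale GP _ _ _ b0 Gx.
have [xi xiP] := choice gW.
have [t ct] : exists t : seq {classic X}, forall y, (y : {classic X}) \notin t ->
    (c : dsum M) y = 0 /\ forall i, (xi i : dsum M) y = 0.
  have supp (f : dsum M) : exists t : seq {classic X},
      forall y, (y : {classic X}) \notin t -> f y = 0.
    have [t _ ft] := dsum_supp f; exists t => y yt; apply: contrapT => /ft.
    by rewrite (negPf yt).
  have [t0 ct0] := supp c; have [tf tfP] := choice (fun i => supp (xi i)).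
  exists (t0 ++ flatten [seq tf i | i <- enum 'I_k]) => y; rewrite mem_cat negb_or => /andP[yt0 yt].
  split=> [|i]; first exact: ct0.
  apply: tfP; apply: contra yt => yu; apply/flattenP; exists (tf i) => //.
  by apply: map_f; rewrite mem_enum.
(* Subtracting the combination of generators and a pair from [lp_diffl] leads to a pair over 0 with
   the same component at [y]. *)
have Gout y w x : G w x -> (y : {classic X}) \notin t -> (x : dsum M) y \in boundary (M y) 0.
  move=> Gx /ct[cy xiy]; have [b [bh /boundaryP[a ah wE]]] := gP w (ex_intro _ x Gx).
  have G1 : G (\sum_(i < k) b i * g i) (\sum_(i < k) b i *: xi i).
    elim/big_ind2: _ => [|w1 x1 w2 x2|i _].
    - exact: lp0 GP.
    - exact: lpD GP _ _ _ _.
    - exact: lp_scale GP _ _ _ (bh i) (xiP i).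
  have := lp_sub GP (lp_sub GP Gx G1) (lp_diffl GP ah).
  rewrite wE subrr => /Gb/(dsum_boundary y); rewrite /= cy !scaler0 oppr0 addr0.
  suff -> : (\sum_(i < k) b i *: xi i : dsum M) y = 0 by rewrite oppr0 addr0.
  by rewrite dsum_sumE big1 // => i _; rewrite /= xiy scaler0.
(* Taking 0 outside [t] keeps the family of local solutions finitely supported. *)
have local y : exists m : M y, [/\ m \in homog (dgm_grading (M y)) (- j),
    dgm_diff (M y) m = (c : dsum M) y,
    (forall w x, G w x -> (x : dsum M) y + w *: m \in boundary (M y) 0) &
    ((y : {classic X}) \notin t -> m = 0)].
  have [yt|yt] := boolP ((y : {classic X}) \in t); last first.
    exists 0; split=> // [||w x Gx]; first exact: rpred0.
      by rewrite raddf0 (ct y yt).1.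
    by rewrite scaler0 addr0; exact: Gout Gx yt.
  (* The projection of [G] to one summand; the boundary [u] provides [lp_diffr]. *)
  pose Gy w z := exists x u, [/\ G w x, u \in boundary (M y) 0 & z = (x : dsum M) y + u].
  have /cocycleP[/dsum_homogP ch dc] := lp_cocycle GP.
  have dcy : dgm_diff (M y) ((c : dsum M) y) = 0.
    exact: (congr1 (fun f : dsum M => f y) dc).
  have [||m [mh dm mG]] := critM y j ((c : dsum M) y) Gy.
  - split.
    + by apply/cocycleP; split=> //; exact: ch.
    + move=> w z [x [u [Gx /boundaryP[v vh ->] ->]]].
      have [wj /dsum_homogP xh] := lp_homog GP Gx; split=> //; rewrite rpredD ?xh //.
      by apply: homog_cast (dgm_diff_homog vh) _.
    + move=> w z [x [u [Gx /boundaryP[v vh ->] ->]]]; have [dw dx] := lp_dom GP Gx.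
      split=> //; rewrite raddfD /= dgm_diff_diff addr0.
      exact: (congr1 (fun f : dsum M => f y) dx).
    + move=> w z w' z' [x [u [Gx uB ->]]] [x' [u' [Gx' u'B ->]]].
      exists (x - x'), (u - u'); split; rewrite ?rpredB //; first exact: lp_sub GP _ _ _ _ Gx Gx'.
      by rewrite /= opprD addrACA.
    + move=> b w z b0 [x [u [Gx uB ->]]]; exists (b *: x), (b *: u); split.
      * exact: lp_scale GP _ _ _ b0 Gx.
      * rewrite -[0]add0r boundaryZr //; apply/cocycleP; split=> //.
        exact: diff_homog0.
      * by rewrite scalerDr.
    + move=> a ah; exists ((-1) ^+ e *: (a *: c)), 0; split; rewrite ?rpred0 ?addr0 //.
      exact: lp_diffl GP _ ah.
    + move=> v vh; exists 0, (dgm_diff (M y) v); split; rewrite ?add0r //.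
        exact: lp0 GP.
      by apply/boundaryP; exists v.
  - move=> z [x [u [/Gb/(dsum_boundary y) xB uB ->]]]; exact: rpredD.
  exists m; split=> // w x Gx.
  by apply: mG; exists x, 0; rewrite rpred0 addr0.
pose m0 y := sval (cid (local y)).
have m0P y : [/\ m0 y \in homog (dgm_grading (M y)) (- j),
    dgm_diff (M y) (m0 y) = (c : dsum M) y,
    (forall w x, G w x -> (x : dsum M) y + w *: m0 y \in boundary (M y) 0) &
    ((y : {classic X}) \notin t -> m0 y = 0)] by exact: svalP (cid (local y)).
have mfin : finite_set [set y | m0 y <> 0]%classic.
  apply: (sub_finite_set _ (finite_seq t)) => y /= my; apply: contrapT => /negP yt.
  by apply: my; have [_ _ _] := m0P y; apply.
exists (DSum mfin); split.
- by apply/dsum_homogP => y; have [] := m0P y.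
- by apply: dsum_eqP => y; have [_ + _ _] := m0P y.
by move=> w x Gx; apply: dsum_mem_boundary => y; have [_ _ + _] := m0P y; apply.
Qed.

End DirectSumCriterion.

(** * Spans and chain conditions *)

Section FinitelyGenerated.
Variable R : pzRingType.
Implicit Types (M : lmodType R).

Fixpoint span M (s : seq M) (x : M) : Prop :=
  if s is u :: s' then exists a : R, span s' (x - a *: u) else x = 0.

Record submodule_prop M (S : M -> Prop) : Prop := SubmoduleProp {
  sub_prop0 : S 0;
  sub_propB : forall x y, S x -> S y -> S (x - y);
  sub_propZ : forall a x, S x -> S (a *: x)
}.

Lemma sub_propD M (S : M -> Prop) x y : submodule_prop S -> S x -> S y -> S (x + y).
Proof.
move=> SP Sx Sy; rewrite -[y]opprK; apply: (sub_propB SP) => //.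
by rewrite -scaleN1r; exact: (sub_propZ SP).
Qed.

Lemma span_submodule M (s : seq M) : submodule_prop (span s).
Proof.
elim: s => [|u s [s0 sB sZ]]; split=> [|x y|a x] /=.
- by [].
- by move=> -> ->; rewrite subrr.
- by move=> ->; rewrite scaler0.
- by exists 0; rewrite scale0r subrr.
- move=> [a xa] [b yb]; exists (a - b).
  by rewrite scalerBl subrACA; exact: sB.
- by move=> [b xb]; exists (a * b); rewrite -scalerA -scalerBr; exact: sZ.
Qed.

Lemma span_consr M (s : seq M) u x : span s x -> span (u :: s) x.
Proof. by move=> sx; exists 0; rewrite scale0r subr0. Qed.

Lemma span_head M (s : seq M) u : span (u :: s) u.
Proof. by exists 1; rewrite scale1r subrr; exact: sub_prop0 (span_submodule s). Qed.

Lemma span_cat M (s t : seq M) x y : span s x -> span t y -> span (s ++ t) (x + y).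
Proof.
elim: s x => [|u s IHs] x /=; first by move=> ->; rewrite add0r.
by move=> [a sx] ty; exists a; rewrite addrAC; exact: IHs.
Qed.

Lemma span_sum M (s : seq M) x : span s x ->
  exists c : 'I_(size s) -> R, x = \sum_(i < size s) c i *: s`_i.
Proof.
elim: s x => [|u s IHs] x /=; first by move=> ->; exists (fun=> 0); rewrite big_ord0.
move=> [a /IHs[c xE]].
exists (fun i => if unlift ord0 i is Some k then c k else a).
rewrite big_ord_recl unlift_none /= -[LHS](subrK (a *: u)) addrC xE; congr (_ + _).
by apply: eq_bigr => i _; rewrite liftK.
Qed.

Definition acc M : Prop := forall L : nat -> M -> Prop,
  (forall n, submodule_prop (L n)) -> (forall n x, L n x -> L n.+1 x) ->
  exists m, forall n x, (m <= n)%N -> L n x -> L m x.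

(** Otherwise one could adjoin again and again an element of [S] outside the current span. *)
Lemma acc_span M (S : M -> Prop) : acc M -> submodule_prop S ->
  exists s : seq M, (forall u, u \in s -> S u) /\ forall x, S x -> span s x.
Proof.
move=> accM SP; apply: contrapT => nS.
have /choice[pick pickP] s : exists u, (forall v, v \in s -> S v) -> S u /\ ~ span s u.
  have [sS|sS] := pselect (forall v, v \in s -> S v); last by exists 0 => /sS.
  apply: contrapT => nu; apply: nS; exists s; split=> // x Sx; apply: contrapT => nx.
  by apply: nu; exists x.
pose ch n := iter n (fun s => pick s :: s) [::].
have chS n v : v \in ch n -> S v.
  elim: n v => // n IHn v; rewrite inE => /predU1P[->|]; last exact: IHn.
  exact: (pickP (ch n) IHn).1.
have [||m mP] := accM (fun n => span (ch n)).
- by move=> n; exact: span_submodule.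
- by move=> n x; exact: span_consr.
apply: (pickP (ch m) (chS m)).2; apply: mP (leqnSn m) _; exact: span_head.
Qed.

Lemma acc_finitely_generated M : acc M -> finitely_generated M.
Proof.
move=> accM; have [|s [_ sP]] := @acc_span M (fun=> True) accM; first by [].
by exists (size s), (fun i => s`_i) => x; apply: span_sum; exact: sP.
Qed.

Lemma left_noetherianP : left_noetherian R <-> acc (R^o : lmodType R).
Proof.
split=> [noeth L LP Linc|accR I Isub Iinc].
  have [||m mP] := noeth (fun n => [pred x | `[< L n x >]]).
  - move=> n; split=> [|a x y /asboolP Lx /asboolP Ly]; apply/asboolP.
      exact: sub_prop0 (LP n).
    by apply: sub_propD => //; exact: sub_propZ (LP n) _ _ _.
  - by move=> n x /asboolP Lx; apply/asboolP; exact: Linc.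
  exists m => n x mn Lx; have := mP n mn x; rewrite !inE.
  by rewrite (introT (asboolP _) Lx) => /esym/asboolP.
have IP n : submodule_prop (fun x : R^o => x \in I n).
  have [I0 Ilin] := Isub n; split=> // [x y Ix Iy|a x Ix].
    by rewrite addrC -scaleN1r; exact: Ilin.
  by rewrite -[_ *: _]addr0; exact: Ilin.
have [|m mP] := accR _ IP; first by move=> n x; exact: Iinc.
exists m => n mn x; apply/idP/idP; first exact: mP.
elim: n mn => [|n IHn]; first by rewrite leqn0 => /eqP ->.
rewrite leq_eqVlt => /predU1P[-> //|mn] Ix; exact/Iinc/IHn.
Qed.

(** By induction on the generators: the coefficients of [g0] in elements of [S] form a finitely
    generated left ideal, and lifts of its generators reduce [S] to its intersection with the span
    of the rest. *)
Lemma span_submodule_fg M (g : seq M) (S : M -> Prop) : acc (R^o : lmodType R) ->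
  submodule_prop S -> (forall x, S x -> span g x) ->
  exists s : seq M, (forall u, u \in s -> S u) /\ forall x, S x -> span s x.
Proof.
move=> accR; elim: g S => [|g0 g IHg] S SP Sg.
  by exists [::].
have gP := span_submodule g.
pose I (r : R^o) := exists2 x, S x & span g (x - (r : R) *: g0).
have IP : submodule_prop I.
  split=> [|r r' [x Sx xr] [x' Sx' xr']|a r [x Sx xr]].
  - by exists 0; [exact: sub_prop0 SP | rewrite scale0r subrr; exact: sub_prop0 gP].
  - exists (x - x'); first exact: sub_propB.
    by rewrite scalerBl subrACA; exact: sub_propB.
  - exists (a *: x); first exact: sub_propZ.
    by rewrite [a *: r]/(a * r) -scalerA -scalerBr; exact: sub_propZ.
have [rs [rsI rsP]] := acc_span accR IP.
have /choice[f fP] (r : R^o) : exists x, I r -> S x /\ span g (x - (r : R) *: g0).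
  by have [[x Sx xr]|nI] := pselect (I r); [exists x | exists 0].
have SgP : submodule_prop (fun x => S x /\ span g x).
  split=> [|x y [Sx gx] [Sy gy]|a x [Sx gx]]; split;
    by [exact: sub_prop0 SP | exact: sub_prop0 gP | exact: sub_propB | exact: sub_propZ].
have [s' [s'S s'P]] := IHg _ SgP (fun x => @proj2 _ _).
exists (map f rs ++ s'); split=> [u|x Sx].
  by rewrite mem_cat => /orP[/mapP[r /rsI/fP[Sfr _] ->]|/s'S[]].
have [r gxr] := Sg x Sx; have /rsP rsr : I r by exists x.
have [y [Sy ys gy]] : exists y, [/\ S y, span (map f rs) y & span g (y - (r : R) *: g0)].
  elim: (rs) rsI r rsr {gxr} => [|r0 rs' IHrs] rsI r /=.
    by move=> ->; exists 0; split=> //; rewrite ?scale0r ?subrr;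
      [exact: sub_prop0 SP | exact: sub_prop0 gP].
  move=> [a /IHrs[r' r'rs|y [Sy yrs gy]]]; first by apply: rsI; rewrite inE r'rs orbT.
  have [Sf gf] := fP r0 (rsI r0 (mem_head _ _)).
  have {}gf : span g (f r0 - (r0 : R) *: g0) by [].
  exists (y + a *: f r0); split.
  - by apply: sub_propD => //; exact: sub_propZ.
  - by exists a; rewrite addrK.
  - have -> : y + a *: f r0 - (r : R) *: g0 =
        (y - (r - a *: r0 : R) *: g0) + a *: (f r0 - (r0 : R) *: g0).
      rewrite [a *: r0]/(a * r0) scalerBl scalerBr scalerA opprB -!addrA.
      by congr (_ + _); rewrite [RHS]addrC -addrA subrK addrC.
    by apply: sub_propD => //; exact: sub_propZ.
rewrite -[x](subrK y) addrC; apply: span_cat => //; apply: s'P; split.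
  exact: sub_propB.
by rewrite -[x](subrK ((r : R) *: g0)) -addrA -[_ *: g0 - y]opprB; exact: sub_propB.
Qed.

End FinitelyGenerated.

(** * Chain conditions on the cohomology of [A] *)

Section CohomologyNoetherian.
Variables (A : dgRing) (A_nonpos : nonpositive A).
Local Notation AA := (homog (dgr_grading A)).
Local Notation Z := (cocycle (dg_regular A)).
Local Notation BB := (boundary (dg_regular A)).
Local Notation H j := (cohomology (dg_regular A) j : lmodType (H0 A)).

Lemma cocycle_homog0 b : b \in AA 0 -> b \in Z 0.
Proof. by move=> b0; apply/cocycleP; split=> //; exact: diff_homog0. Qed.

Lemma cocycles_noetherian_of j : left_noetherian (H0 A) ->
  finitely_generated (H j) -> cocycles_noetherian A j.
Proof.
move=> /left_noetherianP accR [k [g gP]] W WZ W0 WB WM.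
pose S (x : H j) := exists w (wZ : w \in Z j), W w /\ x = subclass _ wZ.
have SP : submodule_prop S.
  split=> [|x y [w [wZ [Ww ->]]] [w' [w'Z [Ww' ->]]]|a x [w [wZ [Ww ->]]]].
  - by exists 0, (rpred0 _); split=> //; rewrite subclass0.
  - exists (w - w'), (rpredB wZ w'Z); split; first exact: WB.
    by apply: (addIr (subclass (BB j) w'Z)); rewrite subrK subclassD;
      apply/subclass_eqP; rewrite subrK subrr rpred0.
  have [b [bZ ->]] := H0P a; have /cocycleP[b0 _] := bZ.
  exists (b * w), (cocycleZ0 bZ wZ); split; first exact: WM.
  exact: H0_actE.
have spang x : span [seq g i | i <- enum 'I_k] x.
  have [c ->] := gP x; elim/big_ind: _ => [|y z|i _].
  - exact: sub_prop0 (span_submodule _).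
  - exact: sub_propD (span_submodule _).
  - apply: (sub_propZ (span_submodule _)).
    have : i \in enum 'I_k by rewrite mem_enum.
    elim: (enum 'I_k) => // i' s IHs; rewrite inE => /predU1P[->|/IHs] /=.
      exact: span_head.
    exact: span_consr.
have [s [sS sP]] := span_submodule_fg accR SP (fun x _ => spang x).
have /choice[h hP] (i : 'I_(size s)) : exists w, exists wZ : w \in Z j, W w /\ s`_i = subclass _ wZ.
  by have /sS[w [wZ wP]] := mem_nth 0 (ltn_ord i); exists w, wZ.
exists (size s), h; split=> [i|w Ww]; first by have [wZ []] := hP i.
have wZ := WZ w Ww.
have [|c cE] := span_sum (sP (subclass _ wZ) _); first by exists w, wZ.
exists (fun i => subrepr (c i)); split=> [i|].
  by have /cocycleP[] := subrepr_num (c i).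
have [vZ vE] : exists vZ : \sum_(i < size s) subrepr (c i) * h i \in Z j,
    \sum_(i < size s) c i *: s`_i = subclass (BB j) vZ.
  elim/big_ind2: _ => [|x1 v1 x2 v2 [v1Z ->] [v2Z ->]|i _].
  - by exists (rpred0 _); rewrite subclass0.
  - by exists (rpredD v1Z v2Z); exact: subclassD.
  have [hZ [_ ->]] := hP i.
  exists (cocycleZ0 (subrepr_num (c i)) hZ).
  by rewrite -[X in X *: _]subreprK; exact: H0_actE.
by apply/(subclass_eqP _ wZ vZ); rewrite cE.
Qed.

Lemma finitely_generated_H0 : finitely_generated (H 0).
Proof.
exists 1%N, (fun=> H0_one A) => x; exists (fun=> x).
by rewrite big_ord1; apply/esym; exact: (mulr1 (x : H0 A)).
Qed.

Lemma finitely_generated_pos j : 0 < j -> finitely_generated (H j).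
Proof.
move=> j0; exists 0%N, (fun=> 0) => x; exists (fun=> 0); rewrite big_ord0.
have [a [aZ ->]] := cohomologyP x; apply/subclass_eq0.
by have /cocycleP[/(A_nonpos j0) -> _] := aZ; rewrite rpred0.
Qed.

Section AscendingChain.
Variable j : int.

(** Made total by the value 0, so that formulas carry no membership proofs. *)
Definition class_of (w : A) : H j :=
  if pselect (w \in Z j) is left wZ then subclass _ wZ else 0.

Lemma class_ofE w (wZ : w \in Z j) : class_of w = subclass _ wZ.
Proof.
rewrite /class_of; case: pselect => // wZ'; apply/subclass_eqP; rewrite subrr rpred0 //.
Qed.

Lemma class_ofB w w' : w \in Z j -> w' \in Z j -> class_of (w - w') = class_of w - class_of w'.
Proof.
move=> wZ w'Z; apply: (addIr (class_of w')); rewrite subrK (class_ofE (rpredB wZ w'Z)).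
by rewrite (class_ofE wZ) (class_ofE w'Z) subclassD; apply/subclass_eqP; rewrite subrK subrr rpred0.
Qed.

Lemma class_of_boundary w : w \in BB j -> class_of w = 0.
Proof. by rewrite /class_of; case: pselect => // wZ wB; apply/subclass_eq0. Qed.

Lemma class_of_scale b w (bZ : b \in Z 0) : w \in Z j ->
  class_of (b * w) = (subclass _ bZ : H0 A) *: class_of w.
Proof.
move=> wZ; rewrite (class_ofE wZ) (class_ofE (cocycleZ0 bZ wZ : b * w \in Z j)).
by apply/esym; exact: H0_actE.
Qed.

Lemma class_of_surj x : exists2 w, w \in Z j & x = class_of w.
Proof. by have [w [wZ ->]] := cohomologyP x; exists w; rewrite ?(class_ofE wZ). Qed.

Lemma component_mulr0 k b b' : b' \in AA 0 ->
  component (dgr_grading A) k (b * b') = component (dgr_grading A) k b * b'.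
Proof.
move=> b'0; move: b; apply: (@homog_ind _ (dgr_grading A)) => [|a b aP bP|i b bi].
- by rewrite mul0r !raddf0 mul0r.
- by rewrite mulrDl !raddfD /= aP bP mulrDl.
have := dgr_homogM bi b'0; rewrite addr0 => bbi.
by rewrite (component_homogE _ bbi) (component_homogE _ bi); case: ifP; rewrite ?mul0r.
Qed.

(* Bass' argument: characters [f n] of [L n.+1 / L n] define a map from the union of the
   chain to the direct sum; being the multiplication by some [m], it has only finitely
   many nonzero components. *)
Lemma criterion_acc : injectivity_criterion (dg_dsum (fun _ : nat => dg_dual A QZ)) -> acc (H j).
Proof.
move=> crit L LP Linc.
(* [f n] detects growth: it kills [L n], and it kills [L n.+1] only if the chain does not grow at
   [n]. *)
have /choice[f fP] n : exists f : {additive H j -> QZ}, (forall x, L n x -> f x = 0) /\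
    ((forall x, L n.+1 x -> f x = 0) -> forall x, L n.+1 x -> L n x).
  have [[v Lv nLv]|nv] := pselect (exists2 v, L n.+1 v & ~ L n v); last first.
    exists \0; split=> // _ x Lx; apply: contrapT => nLx; apply: nv; by exists x.
  have [f [fL fv]] := QZ_separation (sub_prop0 (LP n)) (sub_propB (LP n)) nLv.
  by exists f; split=> // /(_ v Lv).
have Lle m n x : (m <= n)%N -> L m x -> L n x.
  move=> mn Lx; elim: n mn => [|n IHn]; first by case: m Lx.
  by rewrite leq_eqVlt => /predU1P[<- //|/IHn /Linc].
set M := dg_dsum _ in crit.
pose G (w : A) (x : M) := w \in Z j /\ exists2 N, L N (class_of w) &
  forall n b, (dsum_fun x n : dual A QZ) b = f n (class_of (component (dgr_grading A) 0 b * w)).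
have cZ b w : w \in Z j -> component (dgr_grading A) 0 b * w \in Z j.
  by apply: cocycleZ0; exact: cocycle_homog0 (component_homog _ _ _).
have GP : lifting_problem j (0 : M) G.
  split.
  - exact: rpred0.
  - move=> w x [/cocycleP[wj _] [N _ xE]]; split=> //.
    apply/dsum_homogP => n; apply/dual_homogP => k b bk k0.
    rewrite xE (component_homogE _ bk) eq_sym ifN; last by rewrite oppr0 in k0.
    by rewrite mul0r class_of_boundary ?rpred0 ?raddf0.
  - move=> w x [wZ [N _ xE]]; have /cocycleP[_ dw] := wZ; split=> //.
    rewrite !scaler0; apply: dsum_eqP => n; apply: dual_eqP => b.
    rewrite [LHS](xE n) component_dgr_diff class_of_boundary ?raddf0 //.
    rewrite -[j]add0r; apply: (boundaryZl (M := dg_regular A)) wZ; apply/boundaryP.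
    by exists (component (dgr_grading A) (0 - 1) (twist 1 b)); rewrite ?component_homog.
  - move=> w x w' x' [wZ [N LN xE]] [w'Z [N' LN' xE']]; split; first exact: rpredB.
    exists (maxn N N') => [|n b].
      rewrite class_ofB //; apply: (sub_propB (LP _)).
        exact: Lle (leq_maxl _ _) LN.
      exact: Lle (leq_maxr _ _) LN'.
    by rewrite mulrBr class_ofB ?cZ // raddfB /= -xE -xE'.
  - move=> b w x b0 [wZ [N LN xE]]; have bZ := cocycle_homog0 b0.
    split; first exact: (cocycleZ0 (M := dg_regular A) bZ wZ).
    exists N => [|n b']; first by rewrite (class_of_scale bZ wZ); exact: (sub_propZ (LP N)).
    rewrite mulrA -component_mulr0 // -xE.
    by rewrite -[X in _ = _ (_ * X)](twist_homog0 1 b0).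
  - move=> a ah; have dB : dgr_diff A a \in BB j by apply/boundaryP; exists a.
    split.
      apply/cocycleP; split; last exact: dgr_diff_diff.
      by apply: homog_cast (dgr_diff_homog ah) _; lia.
    exists 0%N => [|n b]; first by rewrite class_of_boundary //; exact: sub_prop0 (LP 0%N).
    rewrite !scaler0 class_of_boundary ?raddf0 // -[j]add0r.
    apply: (boundaryZr (M := dg_regular A)); last by rewrite ?add0r.
    exact/cocycle_homog0/component_homog.
  - move=> y /dsum_homogP yh; have -> : y = 0.
      by apply: dsum_eqP => n; apply: (dual_neg A_nonpos _ (yh n)).
    split; first exact: rpred0.
    exists 0%N => [|n b]; first by rewrite class_of_boundary ?rpred0 //; exact: sub_prop0 (LP 0%N).
    by rewrite mulr0 class_of_boundary ?rpred0 // !raddf0.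
have [x [_ [N _ xE]]|m [_ _ mG]] := crit j 0 G GP.
  suff -> : x = 0 by rewrite rpred0.
  apply: dsum_eqP => n; apply: dual_eqP => b.
  by rewrite xE mulr0 class_of_boundary ?rpred0 ?raddf0.
have [N0 mN0] : exists N0, forall n, (N0 <= n)%N -> (m : dsum _) n = 0.
  have [t _ tm] := dsum_supp (m : dsum _); exists (\max_(i <- t) (i : nat)).+1 => n.
  move=> nt; apply: contrapT => /tm nint.
  have := @leq_bigmax_seq {classic nat} t xpredT (fun i => i : nat) n nint isT.
  by rewrite leqNgt => /negP.
have step n : (N0 <= n)%N -> forall x, L n.+1 x -> L n x.
  move=> N0n; apply: (fP n).2 => v Lv; have [w wZ vE] := class_of_surj v.
  have dP k : (fun b => f k (class_of (component (dgr_grading A) 0 b * w))) \in @dual_pred A QZ.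
    apply/asboolP; split=> [b b'|].
      by rewrite raddfB mulrBl class_ofB ?cZ // raddfB.
    exists [:: 0] => i b bi; rewrite mem_seq1 => i0.
    rewrite (component_homogE _ bi) eq_sym (negPf i0) mul0r.
    by rewrite class_of_boundary ?rpred0 ?raddf0.
  have xfin : finite_set [set k | (Dual (dP k) : dg_dual A QZ) <> 0]%classic.
    apply: (sub_finite_set _ (finite_II n.+1)) => k /= k0; rewrite ltnNge; apply/negP => nk.
    apply: k0; apply: dual_eqP => b /=; apply: (fP k).1.
    rewrite (class_of_scale (cocycle_homog0 (component_homog _ _ _)) wZ).
    by apply: (sub_propZ (LP k)); rewrite -vE; exact: Lle nk Lv.
  have Gx : G w (DSum (M := fun _ : nat => dg_dual A QZ) xfin).
    by split=> //; exists n.+1; rewrite -?vE.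
  (* Beyond the support of [m] the component of [x] is itself a boundary, hence 0, and its value at
     1 is [f n v]. *)
  have /(dsum_boundary n) := mG _ _ Gx; rewrite /= mN0 // scaler0 addr0.
  move=> /(dual_boundary0 A_nonpos) /(congr1 (fun g : dual A QZ => g 1)) /=.
  have /homogP -> := dgr_homog1 A.
  by rewrite mul1r -vE.
exists N0 => n x; elim: n => [|n IHn]; first by rewrite leqn0 => /eqP ->.
by rewrite leq_eqVlt => /predU1P[-> //|N0n] /(step n N0n); exact: IHn.
Qed.

End AscendingChain.
End CohomologyNoetherian.

Theorem theorem1p3 (A : dgRing) (A_nonpos : nonpositive A) :
  (forall (X : Type) (M : X -> dgModule A),
     (forall x : X, Inj (M x)) -> Inj (dg_dsum M)) <->
  (left_noetherian (H0 A) /\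
   forall i : int, i < 0 ->
     finitely_generated (cohomology (dg_regular A) i : lmodType (H0 A))).
Proof.
split=> [closed|[noeth fg] X M injM].
  have critM : injectivity_criterion (dg_dsum (fun _ : nat => dg_dual A QZ)).
    apply/(Inj_criterion A_nonpos)/closed => _.
    exact/(Inj_criterion A_nonpos)/(dual_criterion A_nonpos QZ_divisible).
  split=> [|i _]; last exact/acc_finitely_generated/criterion_acc.
  (* The left regular module of [H0 A] is the cohomology in degree 0, with the same submodules. *)
  apply/left_noetherianP => L LP; apply: (criterion_acc (j := 0) A_nonpos critM) => n.
  by have [L0 LB LZ] := LP n; split; [exact: L0 | exact: LB | exact: LZ].
apply/(Inj_criterion A_nonpos)/(dsum_criterion A_nonpos) => [j|x]; last first.
  exact/(Inj_criterion A_nonpos)/injM.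
(* The criterion involves every degree [j]: [H^0(A)] is cyclic over itself and positive degrees
   vanish. *)
apply: cocycles_noetherian_of => //; case: (ltgtP j 0) => [/fg //|j0|->].
  exact: finitely_generated_pos.
exact: finitely_generated_H0.
Qed.
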